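(* Let $n\ge 1$. For all $\nu\in\Lambda$ the functions $\mathcal I^{(a)}_\nu$, $a=1,2$, are bounded (and hence analytic) polynomials in $(u,v)\in\mathcal H^1$. Moreover, for $(u,v)\in\mathcal H^3$, $$\{\mathcal I^{(a)}_\nu,\mathcal I^{(b)}_{\nu'}\}=\{\mathcal I^{(a)}_\nu,M_j\}=0\qquad \forall\, a,b\in\{1,2\},\ \forall\,\nu,\nu'\in\Lambda,\ \forall\, j\in\mathbb Z^n\setminus\{0\}.$$ Finally, $$H=\frac12\Big(\sum_{\nu\in\Lambda}\mathcal I^{(1)}_\nu-1\Big),\qquad J_k=\sum_{\nu\in\Lambda}\nu^{k-1}\mathcal I^{(1)}_\nu+(k-1)\sum_{\nu\in\Lambda}\nu^{k}\mathcal I^{(2)}_\nu\quad (k\ge 2),$$ where the sum in the formula for $H$ is absolutely convergent in $\mathcal H^2$, while the sum in the formula for $J_k$ is absolutely convergent in $\mathcal H^k$.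
   Context: Setting: the Kirchhoff-Pohozaev equation $u_{tt}-\big(1+\int_{\mathbb T^n}|\nabla u|^2dx\big)^{-2}\Delta u=0$ on $\mathbb T^n=(\mathbb R/2\pi\mathbb Z)^n$. Functions $u,v$ are real valued with zero average, with Fourier expansions $u=\sum_{j\in\mathbb Z^n\setminus\{0\}}u_j\frac{e^{ij\cdot x}}{(2\pi)^{n/2}}$, $v=\sum_{j\in\mathbb Z^n\setminus\{0\}}v_j\frac{e^{ij\cdot x}}{(2\pi)^{n/2}}$ (so $u_{-j}=\bar u_j$, $v_{-j}=\bar v_j$). For $s\ge1$, $\mathcal H^s=H^s(\mathbb T^n)\times H^{s-1}(\mathbb T^n)$ with $\|(u,v)\|^2_{\mathcal H^s}=\|u\|_{H^s}^2+\|v\|_{H^{s-1}}^2$. The Poisson bracket is $\{F,G\}=\int_{\mathbb T^n}(\nabla_uF\,\nabla_vG-\nabla_vF\,\nabla_uG)\,dx$ with $L^2$-gradients (extended complex-bilinearly to complex valued functions). Hamiltonian: $H(u,v)=\frac12\int_{\mathbb T^n}v^2dx-\frac12\,\frac{1}{1+\int_{\mathbb T^n}|\nabla u|^2dx}$. Building blocks: with $\nabla^{2k}u=\Delta^ku$, $\nabla^{2k+1}u=\nabla(\Delta^ku)$ and $\|\cdot\|$ the $L^2(\mathbb T^n)$ norm, for $k\ge1$ set $D_k=\|\nabla^ku\|^2$, $B_k=\|\nabla^{k-1}v\|^2$, $Q_k=\int_{\mathbb T^n}\nabla^{k-1}u\cdot\nabla^{k-1}v\,dx$, $A=\frac1{1+D_1}$,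 $E_k=\frac{B_k}{A}+AD_k$, $F_k=\frac{B_k}{A}-AD_k$. For $k\ge2$, $$J_k=E_k-\sum_{j=2}^kQ_jQ_{k+2-j}+\frac14\sum_{j=2}^{k-1}(E_jE_{k+1-j}-F_jF_{k+1-j}).$$ $\Lambda=\{\nu\in\mathbb R^+:\nu=|j|^2\text{ for some }j\in\mathbb Z^n\setminus\{0\}\}$, $S_\nu=\{j\in\mathbb Z^n\setminus\{0\}:|j|^2=\nu\}$, and $$\mathcal I^{(1)}_\nu=\sum_{j\in S_\nu}\Big(A\nu|u_j|^2+|v_j|^2+\sum_{\nu'\in\Lambda,\,\nu'\ne\nu}\ \sum_{k\in S_{\nu'}}\frac{\nu\nu'}{\nu-\nu'}|u_jv_k-u_kv_j|^2\Big),$$ $$\mathcal I^{(2)}_\nu=\frac12\sum_{j,k\in S_\nu}|u_jv_k-u_kv_j|^2,\qquad M_j=\frac12(u_jv_{-j}-u_{-j}v_j).$$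
   Formalization: I^(1)_ν contains the factor A=1/(1+D_1), so it is not a polynomial in (u,v) (for u=c cos x, v=0, n=ν=1 it is πc²/(1+πc²)); instead it is shown that I^(1)_ν=A·P+Q with P,Q bounded polynomials on H^1, and that I^(1)_ν is analytic on H^1. *)

(* Defs.v *)
From HB Require Import structures.
From mathcomp Require Import all_boot all_order all_algebra complex.
From mathcomp Require Import all_classical all_reals all_analysis.
Set Implicit Arguments.
Unset Strict Implicit.
Unset Printing Implicit Defensive.
Import Order.TTheory GRing.Theory Num.Theory.
Import numFieldNormedType.Exports.
Local Open Scope classical_set_scope.
Local Open Scope ring_scope.
Local Open Scope complex_scope.

(* The torus is the cube [0, 2 pi]^n inside n.-tuple R, with n-dimensional
   Lebesgue measure, obtained by iterating the binary product. *)

Section circle.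
Variable R : realType.

Let mcircle : @measurable _ (measurableTypeR R) `[0%R, (2 * pi)%R]%classic.
Proof. exact: measurable_itv. Qed.

Let circle_fin :
  (@lebesgue_measure R `[0%R, (2 * pi)%R]%classic < +oo)%E.
Proof.
by rewrite lebesgue_measure_itv/=; case: ifP => _; rewrite -?EFinB ltry.
Qed.

Definition circle_measure :
    {finite_measure set (measurableTypeR R) -> \bar R} :=
  mfrestr mcircle circle_fin.

End circle.

Section cons_measure.
Context (R : realType) (n : nat).
Variable m1 : {finite_measure set (measurableTypeR R) -> \bar R}.
Variable m2 : {finite_measure set (n.-tuple (measurableTypeR R)) -> \bar R}.

Definition tcons (p : measurableTypeR R * n.-tuple (measurableTypeR R)) :
  n.+1.-tuple (measurableTypeR R) := [tuple of p.1 :: p.2].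

Let measurable_tcons : measurable_fun setT tcons.
Proof. exact: measurable_cons. Qed.

Definition cons_measure : set (n.+1.-tuple (measurableTypeR R)) -> \bar R :=
  pushforward (m1 \x m2)%E tcons.

Let cons_measure0 : cons_measure set0 = 0%E.
Proof. by rewrite /cons_measure /pushforward preimage_set0 measure0. Qed.

Let cons_measure_ge0 A : (0 <= cons_measure A)%E.
Proof. exact: measure_ge0. Qed.

Let cons_measure_sigma_additive : semi_sigma_additive cons_measure.
Proof.
move=> F mF tF mUF; rewrite /cons_measure /pushforward preimage_bigcup.
apply: measure_semi_sigma_additive.
- by move=> k; rewrite -[X in measurable X]setTI; exact: measurable_tcons.
- apply/trivIsetP => /= i j _ _ ij; rewrite -preimage_setI.
  by move/trivIsetP : tF => /(_ _ _ _ _ ij) ->//; rewrite preimage_set0.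
- rewrite -preimage_bigcup -[X in measurable X]setTI.
  exact: measurable_tcons.
Qed.

HB.instance Definition _ := isMeasure.Build _ _ _ cons_measure
  cons_measure0 cons_measure_ge0 cons_measure_sigma_additive.

Let cons_measure_fin : fin_num_fun cons_measure.
Proof.
move=> A mA; rewrite ge0_fin_numE ?measure_ge0//.
apply: (@le_lt_trans _ _ ((m1 \x m2)%E (setT `*` setT))).
  rewrite /cons_measure /pushforward setXTT le_measure ?inE//.
  by rewrite -[X in measurable X]setTI; exact: measurable_tcons.
rewrite product_measure1E// lte_mul_pinfty// ?measure_ge0//.
  exact: fin_num_measure.
by rewrite -ge0_fin_numE ?measure_ge0//; exact: fin_num_measure.
Qed.

HB.instance Definition _ := Measure_isFinite.Build _ _ _
  cons_measure cons_measure_fin.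

End cons_measure.

Fixpoint torus_measure (R : realType) (n : nat) :
    {finite_measure set (n.-tuple (measurableTypeR R)) -> \bar R} :=
  match n with
  | 0 => dirac [tuple] : {finite_measure set _ -> \bar R}
  | m.+1 => cons_measure (circle_measure R) (torus_measure R m)
  end.

Section kirchhoff.
Variables (R : realType) (n : nat).

Local Notation normc := ComplexField.Normc.normc.
Local Notation torus := (n.-tuple (measurableTypeR R)).
Local Notation mu := (torus_measure R n).
Local Notation Zn := 'rV[int]_n.
Implicit Types (j k : Zn) (f g : torus -> R).

(* Sum of an absolutely summable family; a junk value otherwise. *)
Definition asum (I : choiceType) (D : set I) (a : I -> R) : R :=
  fine (\esum_(i in D) (EFin \o a)^\+ i)%E
  - fine (\esum_(i in D) (EFin \o a)^\- i)%E.

Definition abs_summable (I : choiceType) (D : set I) (a : I -> R) : Prop :=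
  summable D (EFin \o a).

Definition cintegral (h : torus -> R[i]) : R[i] :=
  (\int[mu]_x complex.Re (h x))%R +i* (\int[mu]_x complex.Im (h x))%R.

Definition freq2 (j : Zn) : R := \sum_(i < n) (j 0 i)%:~R ^+ 2.

Definition phase (j : Zn) (x : torus) : R :=
  \sum_(i < n) (j 0 i)%:~R * (tnth x i : R).

Definition emode (j : Zn) (x : torus) : R[i] :=
  ((Num.sqrt ((2 * pi) ^+ n))^-1)%:C * (cos (phase j x) +i* sin (phase j x)).

Definition fcoef f (j : Zn) : R[i] :=
  cintegral (fun x => (f x)%:C * conjc (emode j x)).

Definition fourier_partial f (N : nat) (x : torus) : R[i] :=
  \sum_(j \in [set j : Zn | j != 0 /\ freq2 j <= N%:R]) (fcoef f j * emode j x).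

(* Real-valued zero-average L^2 functions with their Fourier expansion.  The
   convergence clause is automatic for a zero-average function of L^2, by
   completeness of the trigonometric system. *)
Definition L2zero f : Prop :=
  [/\ f \in Lfun mu 2%:E,
      (\int[mu]_x f x)%R = 0 &
      (fun N => \int[mu]_x normc ((f x)%:C - fourier_partial f N x) ^+ 2)%R
        @ \oo --> (0 : R)].

Definition sobolev (s : nat) f : Prop :=
  L2zero f /\
  abs_summable [set: Zn] (fun j => freq2 j ^+ s * normc (fcoef f j) ^+ 2).

Definition sobolev_sqnorm (s : nat) f : R :=
  asum [set: Zn] (fun j => freq2 j ^+ s * normc (fcoef f j) ^+ 2).

(* Phase space points w = (u, v). *)
Definition state : Type := ((torus -> R^o) * (torus -> R^o))%type.
Implicit Types (w h : state).

Definition inH (s : nat) w : Prop := sobolev s w.1 /\ sobolev s.-1 w.2.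

Definition Hnorm (s : nat) w : R :=
  Num.sqrt (sobolev_sqnorm s w.1 + sobolev_sqnorm s.-1 w.2).

(* The distributional derivative on the torus: testing against emode (- j)
   gives the Fourier coefficients i j_l (fcoef f j).  As an L^2 function it is
   determined up to a null set; it is junk when f has no such derivative. *)
Definition pderiv (l : 'I_n) f : torus -> R :=
  xget (cst 0) [set g | L2zero g /\
    forall j, fcoef g j = (0 +i* (j 0 l)%:~R) * fcoef f j].

Definition laplacian f : torus -> R :=
  fun x => \sum_(l < n) pderiv l (pderiv l f) x.

(* The L^2 product of nabla^k f and nabla^k g. *)
Definition nabla_dot (k : nat) f g : R :=
  let f' := iter k./2 laplacian f in
  let g' := iter k./2 laplacian g in
  if odd k then \sum_(l < n) (\int[mu]_x (pderiv l f' x * pderiv l g' x))%R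
  else (\int[mu]_x (f' x * g' x))%R.

Definition Hamiltonian w : R :=
  2^-1 * (\int[mu]_x (w.2 x ^+ 2))%R
  - 2^-1 * (1 + \sum_(l < n) (\int[mu]_x (pderiv l w.1 x ^+ 2))%R)^-1.

Definition blockD (k : nat) w : R := nabla_dot k w.1 w.1.
Definition blockB (k : nat) w : R := nabla_dot k.-1 w.2 w.2.
Definition blockQ (k : nat) w : R := nabla_dot k.-1 w.1 w.2.
Definition blockA w : R := (1 + blockD 1 w)^-1.
Definition blockE (k : nat) w : R := blockB k w / blockA w + blockA w * blockD k w.
Definition blockF (k : nat) w : R := blockB k w / blockA w - blockA w * blockD k w.

Definition blockJ (k : nat) w : R :=
  blockE k w - \sum_(2 <= j < k.+1) blockQ j w * blockQ (k + 2 - j) w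
  + 4^-1 * \sum_(2 <= j < k) (blockE j w * blockE (k + 1 - j) w
                              - blockF j w * blockF (k + 1 - j) w).

Definition Lambda : set R := [set nu | exists2 j : Zn, j != 0 & nu = freq2 j].

Definition shell (nu : R) : set Zn := [set j | j != 0 /\ freq2 j = nu].

Definition wedge w j k : R[i] :=
  fcoef w.1 j * fcoef w.2 k - fcoef w.1 k * fcoef w.2 j.

Definition interaction w (nu : R) j (nu' : R) : R :=
  \sum_(k \in shell nu') (nu * nu' / (nu - nu') * normc (wedge w j k) ^+ 2).

Definition I1 (nu : R) w : R :=
  \sum_(j \in shell nu)
    (blockA w * nu * normc (fcoef w.1 j) ^+ 2 + normc (fcoef w.2 j) ^+ 2
     + asum (Lambda `\ nu) (interaction w nu j)).

Definition I2 (nu : R) w : R :=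
  2^-1 * \sum_(j \in shell nu) \sum_(k \in shell nu) normc (wedge w j k) ^+ 2.

Definition momentum j w : R[i] :=
  (2^-1)%:C * (fcoef w.1 j * fcoef w.2 (- j) - fcoef w.1 (- j) * fcoef w.2 j).

(* L is an m-linear form on H^1 bounded by C in the H^1 norm. *)
Definition bounded_multilinear (m : nat) (L : ('I_m -> state) -> R) (C : R) :
    Prop :=
  (forall (z : 'I_m -> state) (i : 'I_m) (a : R) (h1 h2 : state),
     (forall p, inH 1 (z p)) -> inH 1 h1 -> inH 1 h2 ->
     L (@dfwith 'I_m (fun=> state) z i (a *: h1 + h2)) =
       a * L (@dfwith 'I_m (fun=> state) z i h1)
       + L (@dfwith 'I_m (fun=> state) z i h2)) /\
  (forall z : 'I_m -> state, (forall p, inH 1 (z p)) ->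
     `|L z| <= C * \prod_(p < m) Hnorm 1 (z p)).

Definition bounded_polynomial (P : state -> R) : Prop :=
  exists (d : nat) (L : forall m, ('I_m -> state) -> R) (C : nat -> R),
    (forall m, bounded_multilinear (L m) (C m)) /\
    forall w, inH 1 w -> P w = \sum_(m < d) L m (fun=> w).

(* Locally on H^1, P is the sum of a power series of bounded homogeneous
   polynomials with positive radius of normal convergence. *)
Definition analytic (P : state -> R) : Prop :=
  forall w, inH 1 w ->
  exists (L : forall m, ('I_m -> state) -> R) (C r : R),
    [/\ 0 < r,
        forall m, bounded_multilinear (L m) (C / r ^+ m) &
        forall h, inH 1 h -> Hnorm 1 h < r ->
          series (fun m => L m (fun=> h)) @ \oo --> P (w + h)].

(* G is the pair (grad_u F, grad_v F) of L^2 gradients of F at w. *)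
Definition is_L2gradient (F : state -> R) w (G : state) : Prop :=
  [/\ L2zero G.1, L2zero G.2 &
      forall h, inH 1 h ->
        is_derive (0 : R) 1 (fun t : R => F (w + t *: h))
          (\int[mu]_x (G.1 x * h.1 x) + \int[mu]_x (G.2 x * h.2 x))%R].

Definition gradient_bracket (G K : state) : R :=
  (\int[mu]_x (G.1 x * K.2 x - G.2 x * K.1 x))%R.

(* {F, G}(w) exists and equals z, the bracket being extended complex-bilinearly
   from the real and imaginary parts. *)
Definition has_bracket (F G : state -> R[i]) w (z : R[i]) : Prop :=
  exists Fr Fi Gr Gi : state,
    [/\ is_L2gradient (fun y => complex.Re (F y)) w Fr,
        is_L2gradient (fun y => complex.Im (F y)) w Fi,
        is_L2gradient (fun y => complex.Re (G y)) w Gr,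
        is_L2gradient (fun y => complex.Im (G y)) w Gi &
        z = (gradient_bracket Fr Gr - gradient_bracket Fi Gi)
            +i* (gradient_bracket Fr Gi + gradient_bracket Fi Gr)].

(* The function with superscript (1) for b = false, (2) for b = true. *)
Definition calI (b : bool) : R -> state -> R := if b then I2 else I1.

End kirchhoff.

(* Main.v *)
From HB Require Import structures.
Require Import Defs.
From mathcomp Require Import all_boot all_order all_algebra complex finmap.
From mathcomp Require Import all_classical all_reals all_analysis.
From mathcomp Require Import measurable_realfun zify ring lra.
Set Implicit Arguments.
Unset Strict Implicit.
Unset Printing Implicit Defensive.
Import Order.TTheory GRing.Theory Num.Theory.
Import numFieldNormedType.Exports.
Local Open Scope classical_set_scope.
Local Open Scope ring_scope.
Local Open Scope complex_scope.

(** The first integrals depend on the state only through the moments |u_j|^2,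
    |v_j|^2 and Re (u_j conj v_j) of its Fourier coefficients: opening the square
    |u_j v_k - u_k v_j|^2 leaves, apart from these, only products of
    Im (u_j conj v_j), which is odd in j and cancels in sums over shells.  So
    everything is expressed with the quadratic forms

      form m a b w w = sum_j m(|j|^2) Re (a_j conj b_j),   a, b in {u, v},

    for three kinds of multipliers m: the indicator ind nu of a shell, the kernel
    cc nu mu = nu mu / (nu - mu) of the interaction, and the identity.  With X, Y,
    Z the forms of ind nu and Tx, Ty, Tz those of cc nu,

      I1 = A nu X + Y + X Ty + Y Tx - 2 Z Tz,      I2 = X Y - Z^2,

    where A = 1 / (1 + D_1) and D_1 is the form of the identity in u (I1E, I2E).

    Regularity.  Distinct frequencies are distinct natural numbers, so the kernel
    has no small divisors (norm_cc) and all these forms are continuous on H^1 by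
    Cauchy-Schwarz (form_le).  Hence I2 is a polynomial, and I1 is one up to the
    factor A.  This factor is analytic: around any state, D_1 is a constant plus
    a linear plus a quadratic form, and the homogeneous terms of 1 / (1 + D_1)
    are given by a linear recursion with geometric bounds (power_series_inv).

    Brackets.  A function of the moments has the gradient
    (2 fx u + fz v, fz u + 2 fy v), mode by mode, where its symbol fx, fy, fz is a
    combination of ind nu, cc nu and the identity; by Parseval the bracket of two
    such functions is a sum over modes of products of symbols.  The kernels
    satisfy the partial fraction identity of a Gaudin model, so the product of a
    symbol of frequency nu and one of frequency la is again a combination of
    single multipliers (lin3_mul).  The bracket becomes a polynomial in the forms
    and A, and vanishes identically (bracket_distinct, bracket_same).  The
    momenta generate rotations of pairs of modes, which fix all the moments.

    Sums.  By the bounds on the kernel, the double sum of nu^m times the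
    interactions converges absolutely and is the limit of the sums over
    ball x ball (double_sum_cc).  On such a finite sum one may exchange the two
    modes.  For m = 0 the sum vanishes, as the kernel is antisymmetric, and the
    formula for H follows from A D_1 = 1 - A.  In general, symmetrization replaces
    the kernel by

      (nu^m - mu^m) nu mu / (nu - mu) = sum_(i < m) nu^(m - i) mu^(i + 1),

    a polynomial whose value m nu^(m + 1) on the diagonal is exactly what the sum
    of the I2 contributes (psum_symmetrized).  Its monomials separate the two
    modes and give the products Q_i Q_j and B_i D_j of J_k. *)

(** * Integrals of plane waves over the torus *)

Section circle_integral.
Variable R : realType.

Lemma periodic_cos_int (k : int) (c : R) : cos (k%:~R * (2 * pi) + c) = cos c.
Proof.
case: k => n.
  rewrite -(periodicn (@cosD2pi R) n c) -[_ *+ n]mulr_natr -[pi *+ 2]mulr_natr.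
  by congr cos; rewrite -pmulrn; ring.
rewrite -(periodicn (@cosD2pi R) n.+1 (_ + c)) NegzE -[_ *+ n.+1]mulr_natr -[pi *+ 2]mulr_natr.
by congr cos; rewrite rmorphN/= -pmulrn; ring.
Qed.

Lemma periodic_sin_int (k : int) (c : R) : sin (k%:~R * (2 * pi) + c) = sin c.
Proof. by rewrite -!cosBpihalf -addrA periodic_cos_int. Qed.

(** The circle carries the restriction of Lebesgue measure to an interval of
    the line, so the rest of the line is negligible. *)
Lemma circle_integralE (f : R -> R) : measurable_fun [set: R] f ->
  [bounded f x | x in [set: R]] ->
  (\int[circle_measure R]_x (f x)%:E
   = \int[lebesgue_measure]_(x in `[0%R, (2 * pi)%R]) (f x)%:E)%E.
Proof.
move=> mf bf.
have intf : (circle_measure R).-integrable setT (EFin \o f).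
  apply: measurable_bounded_integrable => //.
  by rewrite -ge0_fin_numE ?measure_ge0//; exact: fin_num_measure.
rewrite (@negligible_integral _ (measurableTypeR R) R (circle_measure R)
  setT (~` `[0%R, (2 * pi)%R]) (EFin \o f)) //; last 2 first.
- exact: measurableC.
- by rewrite /circle_measure /= /mfrestr /mrestr setICl measure0.
rewrite setTD setCK; apply: eq_measure_integral => A mA A02.
by rewrite /circle_measure /= /mfrestr /mrestr setIidl.
Qed.

Lemma circle_cos (k : int) (c : R) :
  (\int[circle_measure R]_x (cos (k%:~R * x + c))%:E
   = (if k == 0 then 2 * pi * cos c else 0)%:E)%E.
Proof.
have pi2 : 0 < 2 * pi :> R by rewrite mulr_gt0 ?pi_gt0.
have cphi : continuous (fun x : R => k%:~R * x + c).
  move=> x; apply: cvgD; last exact: cvg_cst.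
  by apply: cvgM; [exact: cvg_cst|exact: cvg_id].
have ccos : continuous (fun x : R => cos (k%:~R * x + c)).
  by move=> x; apply: continuous_comp; [exact: cphi|exact: continuous_cos].
rewrite (@circle_integralE (fun x => cos (k%:~R * x + c))); last 2 first.
- exact: continuous_measurable_fun.
- exists 1; split => // M M1 x _ /=; apply: le_trans (ltW M1).
  by rewrite ler_norml cos_geN1 cos_le1.
case: eqVneq => [->|k0].
  under eq_integral do rewrite mul0r add0r.
  rewrite integral_cst//= lebesgue_measure_itv/= lte_fin pi2 sube0 -EFinM.
  by rewrite mulrC.
have kR : (k%:~R : R) != 0 by rewrite intr_eq0.
pose F (x : R) := k%:~R^-1 * sin (k%:~R * x + c).
have cF : continuous F.
  move=> x; apply: cvgM; first exact: cvg_cst.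
  by apply: continuous_comp; [exact: cphi|exact: continuous_sin].
have dF (x : R) : is_derive x 1 F (cos (k%:~R * x + c)).
  have dphi : is_derive x 1 (fun x : R => k%:~R * x + c) k%:~R.
    by apply: is_derive_eq; rewrite /= addr0 /GRing.scale/= mulr1.
  have dsin := @is_derive1_comp R sin (fun x => k%:~R * x + c) x _ _
    (is_derive_sin (k%:~R * x + c)) dphi.
  rewrite /F; apply: is_derive_eq.
  by rewrite /= /GRing.scale/=  mulrCA mulVf// mulr1.
rewrite (@continuous_FTC2 _ _ F)//.
- rewrite -EFinB /F mulr0 add0r periodic_sin_int subrr//.
- exact/continuous_subspaceT.
- split=> [x _||].
  + by have [] := dF x.
  + exact/cvg_at_right_filter/cF.
  + exact/cvg_at_left_filter/cF.
- by move=> x _; rewrite derive1E; exact: derive_val.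
Qed.

End circle_integral.

Section torus_integral.
Variable R : realType.
Local Notation torus n := (n.-tuple (measurableTypeR R)).

Definition lphase n (m : 'I_n -> int) (x : torus n) : R :=
  \sum_(i < n) (m i)%:~R * (tnth x i : R).

Lemma measurable_lphase n (m : 'I_n -> int) : measurable_fun setT (lphase m).
Proof.
apply: measurable_sum => i; apply: measurable_funM => //.
exact: measurable_tnth.
Qed.

Lemma measurable_cos_lphase n (m : 'I_n -> int) (c : R) :
  measurable_fun setT (fun x : torus n => cos (lphase m x + c)).
Proof.
apply: measurableT_comp.
  by apply: continuous_measurable_fun; exact: continuous_cos.
by apply: measurable_funD => //; exact: measurable_lphase.
Qed.

Lemma finite_measureT_lty d (T : measurableType d)
  (mu : {finite_measure set T -> \bar R}) : (mu setT < +oo)%E.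
Proof. by rewrite -ge0_fin_numE ?measure_ge0//; exact: fin_num_measure. Qed.

Lemma integrable_cos d (T : measurableType d)
    (mu : {measure set T -> \bar R}) (g : T -> R) :
  (mu setT < +oo)%E -> measurable_fun setT g ->
  mu.-integrable setT (fun x => (cos (g x))%:E).
Proof.
move=> muT mg; apply: (@measurable_bounded_integrable _ _ _ _ (fun x => cos (g x))) => //.
- apply: measurableT_comp => //.
  by apply: continuous_measurable_fun; exact: continuous_cos.
- exists 1; split => // M M1 x _ /=; apply: le_trans (ltW M1).
  by rewrite ler_norml cos_geN1 cos_le1.
Qed.

(** Fubini, integrating over the first circle: there the other coordinates only
    shift the argument of the cosine.  The free phase c makes the induction
    close, and gives the sines as well through c = - pi / 2. *)
Lemma torus_cos n (m : 'I_n -> int) (c : R) :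
  (\int[torus_measure R n]_x (cos (lphase m x + c))%:E
   = (if [forall i, m i == 0] then (2 * pi) ^+ n * cos c else 0)%:E)%E.
Proof.
elim: n m c => [|n IH] m c.
  rewrite /= (_ : [forall i, m i == 0]); last by apply/forallP => -[].
  rewrite integral_dirac//=; last first.
    by apply/measurable_EFinP; exact: measurable_cos_lphase.
  by rewrite diracT mul1e /lphase big_ord0 add0r mul1r.
have mg : measurable_fun setT (fun x : torus n.+1 => lphase m x + c).
  by apply: measurable_funD => //; exact: measurable_lphase.
have mtc : measurable_fun setT (@tcons R n) by exact: measurable_cons.
pose m1 := circle_measure R; pose m2 := torus_measure R n.
have m12fin : ((m1 \x m2)%E setT < +oo)%E.
  rewrite -setXTT product_measure1E// lte_mul_pinfty// ?measure_ge0//.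
    exact: fin_num_measure.
  exact: finite_measureT_lty.
have mgt : measurable_fun setT (fun p => lphase m (@tcons R n p) + c).
  by apply: measurableT_comp mg mtc.
have icos : (m1 \x m2)%E.-integrable setT
    (fun p => (cos (lphase m (@tcons R n p) + c))%:E).
  exact: (integrable_cos m12fin mgt).
rewrite /= /cons_measure.
rewrite (@integral_pushforward _ _ _ _ _ (@tcons R n) mtc _ setT
  (fun x => (cos (lphase m x + c))%:E))//; last first.
  by apply/measurable_EFinP; exact: measurable_cos_lphase.
rewrite preimage_setT -(integral21_prod_meas1 icos).
pose m' (i : 'I_n) := m (lift ord0 i).
have step (y : torus n) :
    (\int[m1]_x ((EFin \o (fun p => cos (lphase m (@tcons R n p) + c))) (x, y))
    = (if m ord0 == 0 then 2 * pi else 0)%:E * (cos (lphase m' y + c))%:E)%E.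
  transitivity (\int[m1]_x (cos ((m ord0)%:~R * x + (lphase m' y + c)))%:E)%E.
    apply: eq_integral => x _ /=; congr (cos _)%:E.
    rewrite /lphase big_ord_recl /= tnth0 addrA; congr (_ + _ + _).
    by apply: eq_bigr => i _; rewrite tnthS.
  by rewrite circle_cos -EFinM; case: ifP; rewrite ?mul0r.
transitivity (\int[m2]_y ((if m ord0 == 0 then 2 * pi else 0)%:E
    * (cos (lphase m' y + c))%:E))%E.
  by apply: eq_integral => y _; exact: step.
rewrite integralZl//; last first.
  apply: (integrable_cos (finite_measureT_lty m2)).
  by apply: measurable_funD => //; exact: measurable_lphase.
rewrite IH -EFinM; congr EFin.
rewrite (_ : [forall i, m i == 0] = (m ord0 == 0) && [forall i, m' i == 0]); last first.
  apply/forallP/andP => [m0|[m0 /forallP mS] i].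
    by split=> //; apply/forallP => i; exact: m0.
  by case: (unliftP ord0 i) => [j ->|->//]; exact: mS.
case: ifP => _; rewrite ?mul0r//=; case: ifP => _; rewrite ?mulr0//.
by rewrite exprS !mulrA.
Qed.
End torus_integral.

(** * The inner product and completeness of L^2 *)

Section L2_inner_product.
Context d (T : measurableType d) (R : realType).
Variable mu : {finite_measure set T -> \bar R}.
Local Notation L2 := (Lfun mu 2%:E).
Implicit Types f g h : T -> R.

Definition ip f g : R := \int[mu]_x (f x * g x).

Let le12 : (1 <= 2%:E :> \bar R)%E.
Proof. by rewrite lee_fin ler1n. Qed.

Lemma L2_lincomb a f g : f \in L2 -> g \in L2 ->
  (fun x => a * f x + g x) \in L2.
Proof.
by move=> Lf Lg; have [_ H] := Lfun_submod_closed mu le12; exact: (H a f g Lf Lg).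
Qed.

Lemma eq_L2 f g : f =1 g -> f \in L2 -> g \in L2.
Proof. by move=> /funext ->. Qed.

Lemma L2_0 : (fun _ => 0) \in L2.
Proof. by have [] := Lfun_submod_closed mu le12. Qed.

Lemma L2_scale a f : f \in L2 -> (fun x => a * f x) \in L2.
Proof.
move=> Lf; apply: eq_L2 (L2_lincomb a Lf L2_0) => x.
by rewrite addr0.
Qed.

Lemma L2_add f g : f \in L2 -> g \in L2 -> (fun x => f x + g x) \in L2.
Proof.
move=> Lf Lg; apply: eq_L2 (L2_lincomb 1 Lf Lg) => x.
by rewrite mul1r.
Qed.

Lemma L2_sub f g : f \in L2 -> g \in L2 -> (fun x => f x - g x) \in L2.
Proof.
move=> Lf Lg; apply: eq_L2 (L2_lincomb (-1) Lg Lf) => x.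
by rewrite mulN1r addrC.
Qed.

Lemma L2_sum (I : Type) (r : seq I) (F : I -> T -> R) :
  (forall i, F i \in L2) -> (fun x => \sum_(i <- r) F i x) \in L2.
Proof.
move=> LF; elim: r => [|i r IH].
  by under eq_fun do rewrite big_nil; exact: L2_0.
by under eq_fun do rewrite big_cons; exact: (L2_add (LF i) IH).
Qed.

Lemma L2_measurable f : f \in L2 -> measurable_fun setT f.
Proof. by move=> /sub_Lfun_mfun; rewrite inE. Qed.

Lemma measurable_L2 f : measurable_fun setT f ->
  (\int[mu]_x (f x ^+ 2)%:E < +oo)%E -> f \in L2.
Proof.
move=> mf f2; rewrite inE; apply/andP; split; first by rewrite inE.
rewrite inE /= /finite_norm unlock /Lnorm poweR_lty//.
apply: le_lt_trans f2; apply: ge0_le_integral => //.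
- by move=> x _; rewrite lee_fin powR_ge0.
- apply: measurableT_comp => //.
  apply: (measurableT_comp (measurable_powR _)) => //.
  exact: measurableT_comp.
- by apply/measurable_EFinP; exact: measurable_funX.
- by move=> x _ /=; rewrite lee_fin powR_mulrn// real_normK// num_real.
Qed.

Lemma L2_bounded f : measurable_fun setT f -> [bounded f x | x in setT] ->
  f \in L2.
Proof.
move=> mf [M [_ bM]]; pose B := `|M| + 1.
have B0 : 0 <= B by rewrite addr_ge0.
apply: measurable_L2 => //.
apply: (@le_lt_trans _ _ (\int[mu]_x (cst (B ^+ 2)%:E) x)%E).
  apply: ge0_le_integral => //.
  - by move=> x _; rewrite lee_fin sqr_ge0.
  - by apply/measurable_EFinP; exact: measurable_funX.
  move=> x _; rewrite lee_fin -[leLHS]real_normK ?num_real// lerXn2r ?nnegrE//.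
  by apply: bM => //; rewrite (le_lt_trans (ler_norm _))// ltrDl.
rewrite integral_cst// lte_mul_pinfty ?lee_fin ?sqr_ge0//.
by rewrite -ge0_fin_numE ?measure_ge0//; exact: fin_num_measure.
Qed.

Lemma integrable_ip f g : f \in L2 -> g \in L2 ->
  mu.-integrable setT (EFin \o (fun x => f x * g x)).
Proof. by move=> Lf Lg; exact/Lfun1_integrable/Lfun2_mul_Lfun1. Qed.

Lemma ipC f g : ip f g = ip g f.
Proof. by apply: eq_Rintegral => x _; rewrite mulrC. Qed.

Lemma ip_ge0 f : 0 <= ip f f.
Proof. by apply: Rintegral_ge0 => x _; rewrite -expr2 sqr_ge0. Qed.

Lemma ip_lincomb a f g h : f \in L2 -> g \in L2 -> h \in L2 ->
  ip (fun x => a * f x + g x) h = a * ip f h + ip g h.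
Proof.
move=> Lf Lg Lh; rewrite /ip.
under eq_Rintegral do rewrite mulrDl.
rewrite RintegralD//; last 2 first.
- exact: integrable_ip (L2_scale a Lf) Lh.
- exact: integrable_ip.
congr (_ + _); rewrite -RintegralZl//; last exact: integrable_ip.
by apply: eq_Rintegral => x _; rewrite mulrA.
Qed.

Lemma ip0l g : ip (fun=> 0) g = 0.
Proof.
rewrite /ip; under eq_Rintegral do rewrite mul0r.
by rewrite Rintegral_cst// mul0r.
Qed.

Lemma ipZl a f h : f \in L2 -> h \in L2 -> ip (fun x => a * f x) h = a * ip f h.
Proof.
move=> Lf Lh; rewrite -[RHS]addr0 -[X in _ = _ + X](ip0l h) -ip_lincomb//; last exact: L2_0.
by congr ip; apply/funext => x; rewrite addr0.
Qed.

Lemma ipDl f g h : f \in L2 -> g \in L2 -> h \in L2 ->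
  ip (fun x => f x + g x) h = ip f h + ip g h.
Proof.
move=> Lf Lg Lh; rewrite -[ip f h]mul1r -ip_lincomb//.
by congr ip; apply/funext => x; rewrite mul1r.
Qed.

Lemma ipBl f g h : f \in L2 -> g \in L2 -> h \in L2 ->
  ip (fun x => f x - g x) h = ip f h - ip g h.
Proof.
move=> Lf Lg Lh; rewrite addrC -mulN1r -ip_lincomb//.
by congr ip; apply/funext => x; rewrite mulN1r addrC.
Qed.

Lemma ip_sqr_lincomb a f g : f \in L2 -> g \in L2 ->
  ip (fun x => a * f x + g x) (fun x => a * f x + g x)
  = a ^+ 2 * ip f f + 2 * a * ip f g + ip g g.
Proof.
move=> Lf Lg; have Lh := L2_lincomb a Lf Lg.
rewrite (ip_lincomb a Lf Lg Lh) (ipC f) (ipC g) (ip_lincomb a Lf Lg Lf).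
by rewrite (ip_lincomb a Lf Lg Lg) (ipC g f); ring.
Qed.

Lemma ip_sqrB f g : f \in L2 -> g \in L2 ->
  ip (fun x => f x - g x) (fun x => f x - g x) = ip f f - 2 * ip f g + ip g g.
Proof.
move=> Lf Lg; rewrite (_ : (fun x => _) = fun x => (-1) * g x + f x).
  by rewrite ip_sqr_lincomb// (ipC g); ring.
by apply/funext => x; rewrite mulN1r addrC.
Qed.

Lemma ip_suml (I : Type) (r : seq I) (F : I -> T -> R) h :
  (forall i, F i \in L2) -> h \in L2 ->
  ip (fun x => \sum_(i <- r) F i x) h = \sum_(i <- r) ip (F i) h.
Proof.
move=> LF Lh; elim: r => [|i r IH].
  by rewrite big_nil; under eq_fun do rewrite big_nil; exact: ip0l.
rewrite big_cons -IH -ipDl//; last exact: L2_sum.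
by congr ip; apply/funext => x; rewrite big_cons.
Qed.

Lemma ip_CauchySchwarz f g : f \in L2 -> g \in L2 ->
  ip f g ^+ 2 <= ip f f * ip g g.
Proof.
move=> Lf Lg.
have pos t : 0 <= t ^+ 2 * ip f f + 2 * t * ip f g + ip g g.
  have := ip_ge0 (fun x => t * f x + g x).
  by rewrite ip_sqr_lincomb.
have [ff0|ffN0] := eqVneq (ip f f) 0.
  have [->|fgN0] := eqVneq (ip f g) 0; first by rewrite expr0n/= mulr_ge0 ?ip_ge0.
  have := pos (- (ip g g + 1) / (2 * ip f g)); rewrite ff0 mulr0 add0r.
  rewrite [X in X + _](_ : _ = - (ip g g + 1)); last by field.
  by move=> H; exfalso; lra.
have := pos (- ip f g / ip f f).
have ffp : 0 < ip f f by rewrite lt_neqAle eq_sym ffN0 ip_ge0.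
rewrite [X in 0 <= X](_ : _ = (ip f f * ip g g - ip f g ^+ 2) / ip f f); last by field.
by rewrite pmulr_lge0 ?invr_gt0// subr_ge0.
Qed.

Lemma ip_sqr_le f g : f \in L2 -> g \in L2 ->
  `|ip f g| <= Num.sqrt (ip f f) * Num.sqrt (ip g g).
Proof.
move=> Lf Lg; rewrite -sqrtrM ?ip_ge0// -sqrtr_sqr ler_wsqrtr//.
exact: ip_CauchySchwarz.
Qed.

(** Convergence in L^2 implies weak convergence; this is how Fourier
    coefficients and Parseval's formula pass to the limit. *)
Lemma cvg_ip (F : nat -> T -> R) f g : (forall n, F n \in L2) ->
  f \in L2 -> g \in L2 ->
  (fun n => ip (fun x => f x - F n x) (fun x => f x - F n x)) @ \oo --> (0 : R) ->
  (fun n => ip (F n) g) @ \oo --> ip f g.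
Proof.
move=> LF Lf Lg F0.
have s0 : (fun n => Num.sqrt (ip (fun x => f x - F n x) (fun x => f x - F n x))
    * Num.sqrt (ip g g)) @ \oo --> (0 : R).
  rewrite -[X in _ --> X](mul0r (Num.sqrt (ip g g))); apply: cvgM; last exact: cvg_cst.
  rewrite -[X in _ --> X](@sqrtr0 R).
  by apply: (cvg_comp _ _ F0); exact: sqrt_continuous.
apply/cvgrPdist_lt => e e0; near=> n.
rewrite -ipBl// (le_lt_trans (ip_sqr_le _ _))//; first exact: L2_sub.
near: n; move/cvgrPdist_lt: s0 => /(_ _ e0); apply: filterS => n /=.
by rewrite sub0r normrN; apply: le_lt_trans; exact: ler_norm.
Unshelve. all: by end_near. Qed.

(** A sequence given by its increments D, with norms at most 2^-i.  Its partial
    sums S converge where the function G = sum_i 2^i D_i^2 is finite; G has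
    finite integral, and it also dominates the error of every partial sum, so
    the pointwise limit is the limit in L^2. *)
Section completeness.
Variable D : nat -> T -> R.
Hypothesis LD : forall i, D i \in L2.
Hypothesis smallD : forall i, ip (D i) (D i) <= 4 ^- i.

Let S m x := \sum_(0 <= i < m) D i x.
Let G x := (\sum_(i <oo) (2 ^+ i * D i x ^+ 2)%:E)%E.

(* Cauchy-Schwarz with the weights 2^i, in the form of an induction on the
   number of terms. *)
Let tail_le m k x : (S (m + k) x - S m x) ^+ 2 <=
   2 * 2 ^- m * \sum_(m <= i < m + k) 2 ^+ i * D i x ^+ 2.
Proof.
elim: k m => [|k IH] m.
  by rewrite addn0 subrr expr0n/= big_geq// mulr0.
have lmk : (m < m + k.+1)%N by rewrite addnS ltnS leq_addr.
rewrite big_ltn// mulrDr.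
have -> : S (m + k.+1) x - S m x = D m x + (S (m.+1 + k) x - S m.+1 x).
  have -> : S m.+1 x = S m x + D m x by rewrite /S big_nat_recr.
  by rewrite addSnnS; ring.
have := IH m.+1; rewrite addSnnS.
set a := D m x; set b := _ - _; set Z := \sum_(_ <= i < _) _ => IHm.
rewrite (_ : 2 * 2 ^- m * (2 ^+ m * a ^+ 2) = 2 * a ^+ 2); last first.
  by rewrite mulrA mulfVK// expf_neq0// pnatr_eq0.
have : b ^+ 2 <= 2 ^- m * Z.
  by move: IHm; rewrite [2 ^+ m.+1]exprS invfM mulrA mulfV// mul1r.
have := sqr_ge0 (a - b); rewrite !expr2 -mulrA; nra.
Qed.

Let mD i : measurable_fun setT (fun x => 2 ^+ i * D i x ^+ 2).
Proof.
by apply: measurable_funM => //; apply: measurable_funX; exact: L2_measurable.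
Qed.

Let G_int : (\int[mu]_x G x <= 4%:E)%E.
Proof.
rewrite integral_nneseries//; last 2 first.
- by move=> n; apply/measurable_EFinP/(mD n).
- by move=> n x _; rewrite lee_fin mulr_ge0 ?sqr_ge0 ?exprn_ge0.
have term n : (\int[mu]_x (2 ^+ n * D n x ^+ 2)%:E <= (geometric 1 (2^-1) n)%:E)%E.
  have intD := integrable_ip (LD n) (LD n).
  under eq_integral do rewrite EFinM expr2.
  rewrite integralZl// -[X in (_ * X)%E]fineK; last exact: integrable_fin_num.
  rewrite -EFinM lee_fin /= mul1r.
  apply: le_trans (_ : 2 ^+ n * 4 ^- n <= _).
    by rewrite ler_wpM2l ?exprn_ge0//; exact: smallD.
  rewrite (_ : 4 = 2 * 2); last by ring.
  by rewrite exprMn invfM mulrA mulfV ?expf_neq0 ?pnatr_eq0// mul1r exprVn.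
apply: le_trans (_ : (\sum_(n <oo) (geometric 1 (2^-1 : R) n)%:E <= _)%E).
  by apply: lee_nneseries => // n _ _; apply: integral_ge0 => x _;
    rewrite lee_fin mulr_ge0 ?sqr_ge0 ?exprn_ge0.
apply: lime_le.
  by apply: is_cvg_nneseries => n _ _; rewrite lee_fin /= mul1r exprn_ge0.
apply: nearW => n; rewrite sumEFin lee_fin.
have := @geometric_seriesE R 1 2^-1; rewrite /series /= => H.
have h1 : 2^-1 != 1 :> R by rewrite lt_eqF//; lra.
have /= -> := congr1 (fun h : nat -> R => h n) (H h1).
have h0 : 0 <= (2^-1 : R) ^+ n by rewrite exprn_ge0.
rewrite (_ : 1 - 2^-1 = 2^-1); last by field.
by rewrite invrK; lra.
Qed.

Let mG : measurable_fun setT G.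
Proof.
apply: ge0_emeasurable_sum => // [n x _ _|n _].
  by rewrite lee_fin mulr_ge0 ?sqr_ge0 ?exprn_ge0.
by apply/measurable_EFinP/(mD n).
Qed.

Let G_finite x : (G x < +oo)%E -> exists2 l, S ^~ x @ \oo --> l &
  forall m, (((l - S m x) ^+ 2)%:E <= (2 * 2 ^- m)%:E * G x)%E.
Proof.
have G0 : (0 <= G x)%E.
  by apply: nneseries_ge0 => n _ _; rewrite lee_fin mulr_ge0 ?sqr_ge0 ?exprn_ge0.
move=> Gfin; have : G x \is a fin_num by rewrite ge0_fin_numE.
move=> /fineK; set g := fine _ => Gg.
have g0 : 0 <= g by rewrite -lee_fin Gg.
have part m n : (m <= n)%N -> (S n x - S m x) ^+ 2 <= 2 * 2 ^- m * g.
  move=> mn; rewrite -(subnKC mn); apply: le_trans (tail_le _ _ _) _.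
  rewrite ler_wpM2l ?mulr_ge0 ?invr_ge0 ?exprn_ge0//.
  rewrite -lee_fin Gg -sumEFin /G.
  apply: le_trans (_ : (\sum_(0 <= i < m + (n - m)) (2 ^+ i * D i x ^+ 2)%:E <= _)%E).
    rewrite !sumEFin lee_fin [leRHS](@big_cat_nat _ _ _ m)//= ?leq_addr//.
    by rewrite lerDr sumr_ge0// => i _; rewrite mulr_ge0 ?sqr_ge0 ?exprn_ge0.
  by apply: nneseries_lim_ge => i _ _; rewrite lee_fin mulr_ge0 ?sqr_ge0 ?exprn_ge0.
have geo0 : (fun m => 2 * 2 ^- m * g) @ \oo --> (0 : R).
  rewrite (_ : (fun _ => _) = geometric (2 * g) 2^-1).
    by apply: cvg_geometric; rewrite ger0_norm// invf_lt1// ltr1n.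
  by apply/funext => m; rewrite /= exprVn mulrAC.
have cS : cvgn (S ^~ x).
  apply: cauchy_cvg; apply: cauchy_exP => e e0.
  have [m _ /(_ m (leqnn m))/=] := (cvgrPdist_lt _ _).1 geo0 (e ^+ 2) (exprn_gt0 2 e0).
  rewrite sub0r normrN => me; exists (S m x).
  near=> n; rewrite /ball/= -(ltr_pXn2r (n:=2)) ?nnegrE ?(ltW e0)//.
  rewrite real_normK ?num_real// (le_lt_trans _ me)// (le_trans _ (ler_norm _))//.
  rewrite -sqrrN opprB; apply: part.
  by near: n; exists m.
exists (limn (S ^~ x)); first exact: cS.
move=> m; rewrite -Gg -EFinM lee_fin.
have cl : (fun n => (S n x - S m x) ^+ 2) @ \oo --> (limn (S ^~ x) - S m x) ^+ 2.
  have c1 : (fun n => S n x - S m x) @ \oo --> limn (S ^~ x) - S m x.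
    by apply: cvgB; [exact: cS|exact: cvg_cst].
  rewrite expr2; under eq_fun do rewrite expr2.
  exact: cvgM.
rewrite -(cvg_lim _ cl)//; apply: limr_le; first by apply: cvgP cl.
by exists m => // n /= mn; exact: part.
Unshelve. all: by end_near. Qed.

Lemma L2_complete : exists2 f, f \in L2 &
  forall m, ip (fun x => f x - \sum_(0 <= i < m) D i x)
               (fun x => f x - \sum_(0 <= i < m) D i x) <= 8 * 2 ^- m.
Proof.
(* The upper limit is measurable everywhere; where G is infinite the bound on
   the error says nothing and the value of f is irrelevant. *)
pose f x := fine (limn_esup (fun m => (S m x)%:E)).
have mS m : measurable_fun setT (S m).
  by apply: measurable_sum => i; exact: L2_measurable.
have mf : measurable_fun setT f.
  apply: measurableT_comp; first exact: fine_measurable.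
  by apply: measurable_fun_limn_esup => n; apply/measurable_EFinP; exact: mS.
have G0 x : (0 <= G x)%E.
  by apply: nneseries_ge0 => n _ _; rewrite lee_fin mulr_ge0 ?sqr_ge0 ?exprn_ge0.
have c0 m : 0 < 2 * 2 ^- m :> R by rewrite mulr_gt0// invr_gt0 exprn_gt0.
have bnd m x : (((f x - S m x) ^+ 2)%:E <= (2 * 2 ^- m)%:E * G x)%E.
  have [Gy|] := eqVneq (G x) +oo%E.
    by rewrite Gy gt0_muley ?leey// lte_fin.
  rewrite -ltey => /G_finite[l Sl]; rewrite /f.
  suff -> : limn_esup (fun m => (S m x)%:E) = l%:E by apply.
  have SlE : (fun m => (S m x)%:E) @ \oo --> l%:E by apply: cvg_EFin => //; exact: nearW.
  by rewrite is_cvg_limn_esupE; [exact: cvg_lim|exact: cvgP SlE].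
have bint m : (\int[mu]_x ((f x - S m x) ^+ 2)%:E <= (8 * 2 ^- m)%:E)%E.
  apply: (@le_trans _ _ (\int[mu]_x ((2 * 2 ^- m)%:E * G x))%E).
    apply: ge0_le_integral => //.
    - by move=> x _; rewrite lee_fin sqr_ge0.
    - by apply/measurable_EFinP; apply: measurable_funX; exact: measurable_funB.
    - exact: measurable_funeM.
  rewrite (@ge0_integralZl _ _ _ _ _ measurableT _ mG)//.
  rewrite (_ : 8 * 2 ^- m = 2 * 2 ^- m * 4); last by ring.
  by rewrite [leRHS]EFinM; apply: lee_wpmul2l => //; rewrite lee_fin ltW.
have fS m : (fun x => f x - S m x) \in L2.
  apply: measurable_L2; first exact: measurable_funB.
  by apply: le_lt_trans (bint m) _; rewrite ltry.
exists f.
  by apply: eq_L2 (fS 0) => x; rewrite /S big_nil subr0.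
move=> m; rewrite /ip /Rintegral -lee_fin fineK; last first.
  exact: integrable_fin_num (integrable_ip (fS m) (fS m)).
exact: bint.
Qed.

End completeness.
End L2_inner_product.

(** * Summation along an exhaustion *)

Section exhaustion.
Variables (R : realType) (I : choiceType) (D : set I) (s : nat -> seq I).
Hypothesis s_uniq : forall N, uniq (s N).
Hypothesis sD : forall N i, i \in s N -> D i.
Hypothesis s_mono : forall N M, (N <= M)%N -> {subset s N <= s M}.
Hypothesis s_cover : forall i, D i -> exists N, i \in s N.

Lemma le_sum_subset (r r' : seq I) (a : I -> R) : uniq r -> uniq r' ->
  {subset r <= r'} -> (forall i, i \in r' -> 0 <= a i) ->
  \sum_(i <- r) a i <= \sum_(i <- r') a i.
Proof.
move=> ur ur' rr' a0.
have -> : \sum_(i <- r) a i = \sum_(i <- r' | i \in r) a i.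
  rewrite -[RHS]big_filter; apply: perm_big; apply: uniq_perm => //.
    exact: filter_uniq.
  move=> i; rewrite mem_filter; case: (boolP (i \in r)) => //= ir.
  by rewrite rr'.
rewrite [leRHS](bigID (mem r))/= lerDl big_seq_cond sumr_ge0// => i /andP[ir' _].
exact: a0.
Qed.

(** A finite subset of D lies in some s N, because the s N are nested and cover
    D; so the supremum over finite subsets is the limit along the s N. *)
Lemma esum_exhaust (a : I -> R) (l : R) : (forall i, 0 <= a i) ->
  (fun N => \sum_(i <- s N) a i) @ \oo --> l ->
  \esum_(i in D) (a i)%:E = l%:E.
Proof.
move=> a0 al.
have nd : {homo (fun N => \sum_(i <- s N) a i) : n m / (n <= m)%N >-> n <= m}.
  by move=> n m nm; apply: le_sum_subset => //; exact: s_mono.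
have le_l N : \sum_(i <- s N) a i <= l.
  rewrite -(cvg_lim _ al)//; apply: nondecreasing_cvgn_le => //.
  exact: cvgP al.
have fsE N : (\sum_(i \in [set` s N]) (a i)%:E = (\sum_(i <- s N) a i)%:E)%E.
  by rewrite -fsbig_seq// sumEFin.
apply/eqP; rewrite eq_le; apply/andP; split.
  apply: ge_ereal_sup => _ [X [finX XD] <-].
  have [N XN] : exists N, forall i, i \in (fset_set X : seq I) -> i \in s N.
    have : forall i, i \in (fset_set X : seq I) -> D i.
      by move=> i; rewrite in_fset_set// => /set_mem/XD.
    elim: (fset_set X : seq I) => [|i r IH] Dr; first by exists 0%N => i.
    have [i' i'r|N HN] := IH; first by apply: Dr; rewrite in_cons i'r orbT.
    have [M HM] := s_cover (Dr i (mem_head _ _)).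
    exists (maxn N M) => i'; rewrite in_cons => /predU1P[->|/HN].
      exact: s_mono (leq_maxr _ _) _ HM.
    exact: s_mono (leq_maxl _ _) _.
  rewrite fsbig_finite// sumEFin lee_fin (le_trans _ (le_l N))//.
  exact: le_sum_subset.
have lE : ((fun N => (\sum_(i <- s N) a i)%:E) @ \oo --> l%:E)%E.
  by apply: cvg_EFin => //; exact: nearW.
rewrite -(cvg_lim _ lE)//; apply: lime_le; first exact: cvgP lE.
apply: nearW => N; rewrite -fsE.
apply: esum_ge; exists [set` s N] => //; split; first exact: finite_seq.
by move=> i /= /sD.
Qed.

Lemma bounded_sum_cvg (a : I -> R) (B : R) :
  (forall N, \sum_(i <- s N) `|a i| <= B) ->
  cvgn (fun N => \sum_(i <- s N) a i).
Proof.
move=> aB.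
have cvg_ge0 (b : I -> R) C : (forall i, 0 <= b i) ->
    (forall N, \sum_(i <- s N) b i <= C) -> cvgn (fun N => \sum_(i <- s N) b i).
  move=> b0 bC; apply: nondecreasing_is_cvgn.
    by move=> n m nm; apply: le_sum_subset => //; exact: s_mono.
  by exists C => _ [N _ <-].
have c1 := @cvg_ge0 (fun i => `|a i|) _ (fun i => normr_ge0 _) aB.
have c2 : cvgn (fun N => \sum_(i <- s N) (`|a i| + a i)).
  apply: (@cvg_ge0 _ (B + B)) => [i|N].
    by rewrite -lerBlDr sub0r ler_normr lexx orbT.
  apply: le_trans (lerD (aB N) (aB N)); rewrite -big_split/=.
  by apply: ler_sum => i _; rewrite lerD2l ler_norm.
have -> : (fun N => \sum_(i <- s N) a i) =
    (fun N => \sum_(i <- s N) (`|a i| + a i)) - (fun N => \sum_(i <- s N) `|a i|).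
  by apply/funext => N /=; rewrite fctE big_split/= addrAC subrr add0r.
exact: is_cvgB c2 c1.
Qed.

Lemma asum_exhaust (a : I -> R) (B : R) :
  (forall N, \sum_(i <- s N) `|a i| <= B) ->
  abs_summable D a /\ (fun N => \sum_(i <- s N) a i) @ \oo --> asum D a.
Proof.
move=> aB.
have bnd (b : I -> R) : (forall i, `|b i| <= `|a i|) ->
    cvgn (fun N => \sum_(i <- s N) b i).
  move=> ba; apply: (@bounded_sum_cvg _ B) => N.
  by apply: le_trans (aB N); exact: ler_sum.
split.
  rewrite /abs_summable /summable.
  have := @esum_exhaust (fun i => `|a i|) _ (fun i => normr_ge0 _)
            (bnd (fun i => `|a i|) _).
  move=> /= ->; first exact: ltry.
  by move=> i; rewrite normr_id.
(* asum is built on the positive and negative parts, which inherit the bound. *)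
pose p i := Num.max (a i) 0; pose q i := Num.max (- a i) 0.
have pa i : `|p i| <= `|a i|.
  by rewrite /p; case: (lerP (a i) 0) => _; rewrite ?normr0.
have qa i : `|q i| <= `|a i|.
  by rewrite /q -(normrN (a i)); case: (lerP (- a i) 0) => _; rewrite ?normr0.
have cp := bnd p pa; have cq := bnd q qa.
have p0 i : 0 <= p i by rewrite /p le_max lexx orbT.
have q0 i : 0 <= q i by rewrite /q le_max lexx orbT.
have -> : asum D a = limn (fun N => \sum_(i <- s N) p i)
                   - limn (fun N => \sum_(i <- s N) q i).
  have Ep : (\esum_(i in D) (EFin \o a)^\+ i
      = (limn (fun N => \sum_(i <- s N) p i))%:E)%E.
    rewrite -(esum_exhaust p0 cp); apply: eq_esum => i _ /=.
    by rewrite funepos.unlock /= EFin_max.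
  have Eq : (\esum_(i in D) (EFin \o a)^\- i
      = (limn (fun N => \sum_(i <- s N) q i))%:E)%E.
    rewrite -(esum_exhaust q0 cq); apply: eq_esum => i _ /=.
    by rewrite funeneg.unlock /= EFin_max.
  by rewrite /asum Ep Eq.
have -> : (fun N => \sum_(i <- s N) a i) =
    (fun N => \sum_(i <- s N) p i - \sum_(i <- s N) q i).
  apply/funext => N; rewrite -sumrB; apply: eq_bigr => i _.
  by rewrite /p /q; case: (lerP (a i) 0); case: (lerP (- a i) 0); lra.
exact: cvgB.
Qed.

Lemma abs_summable_bounded (a : I -> R) :
  abs_summable D a -> exists B : R, forall N, \sum_(i <- s N) `|a i| <= B.
Proof.
rewrite /abs_summable summableE => /fineK aE.
exists (fine (\esum_(i in D) `|(a i)%:E|)%E) => N.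
rewrite -lee_fin [X in (_ <= X)%E]aE -sumEFin.
apply: esum_ge; exists [set` s N]; last by rewrite -fsbig_seq.
by split; [exact: finite_seq|move=> i /= /sD].
Qed.

End exhaustion.

(** * Sums over the lattice and over the frequencies *)

Section lattice_balls.
Variables (R : realType) (n : nat).
Local Notation Zn := 'rV[int]_n.
Implicit Types (j k : Zn) (a b : Zn -> R) (nu : R).

Definition nfreq j : nat := (\sum_(i < n) `|j 0%R i| ^ 2)%N.

(** The squared frequencies are natural numbers; this is the only arithmetic of
    the lattice that is used. *)
Lemma freq2E j : freq2 R j = (nfreq j)%:R.
Proof.
rewrite /freq2 /nfreq natr_sum; apply: eq_bigr => i _.
by rewrite natrX -[LHS]real_normK ?num_real// natr_absz intr_norm.
Qed.

Definition ball N : set Zn := [set j | j != 0 /\ (nfreq j <= N)%N].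

Lemma finite_ball N : finite_set (ball N).
Proof.
pose h (f : {ffun 'I_n -> 'I_(N + N).+1}) : Zn :=
  \row_i ((f i : nat)%:Z - N%:Z).
apply: (@sub_finite_set _ _ (h @` setT)); last first.
  by apply: finite_image; exact: finite_finset.
move=> j [_ jN].
have le_jN i : (`|j 0%R i| <= N)%N.
  apply: leq_trans jN; apply: (@leq_trans (`|j 0%R i| ^ 2)%N).
    by case: `|_|%N => // m; rewrite -mulnn leq_pmulr.
  by rewrite /nfreq (bigD1 i)//= leq_addr.
have bnd i : (absz (j 0%R i + N%:Z)%R < (N + N).+1)%N by have := le_jN i; lia.
exists [ffun i => Ordinal (bnd i)] => //; apply/rowP => i.
rewrite mxE ffunE /=.
by have := le_jN i; lia.
Qed.

Definition bl N : seq Zn := fset_set (ball N).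

Lemma bl_uniq N : uniq (bl N). Proof. exact: fset_uniq. Qed.

Lemma mem_bl N j : (j \in bl N) = (j != 0) && (nfreq j <= N)%N.
Proof.
rewrite /bl in_fset_set; last exact: finite_ball.
by apply/idP/andP => [/set_mem//|?]; apply/mem_set.
Qed.

Lemma bl_mono N M : (N <= M)%N -> {subset bl N <= bl M}.
Proof. by move=> NM j; rewrite !mem_bl => /andP[-> /leq_trans->]. Qed.

Lemma fourier_ballE N : [set j : Zn | j != 0 /\ freq2 R j <= N%:R] = ball N.
Proof.
by apply/seteqP; split=> j /= []; rewrite freq2E ler_nat.
Qed.

End lattice_balls.

(** The limit along balls, the origin being left out because the functions have
    zero average.  Sealed, so that comparing two sums does not unfold the
    limit. *)
HB.lock Definition sumZ (R : realType) (n : nat) (a : 'rV[int]_n -> R) : R :=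
  limn (fun N => \sum_(j <- bl n N) a j).

Section lattice_sums.
Variables (R : realType) (n : nat).
Local Notation Zn := 'rV[int]_n.
Local Notation bl := (bl n).
Local Notation ball := (@ball n).
Local Notation bl_uniq := (bl_uniq n).
Local Notation finite_ball := (@finite_ball n).
Implicit Types (j k : Zn) (a b : Zn -> R) (nu : R).

Definition psum a N := \sum_(j <- bl N) a j.
(** Absolute summability as a bound on the finite sums over balls, which is the
    form in which comparison arguments produce it. *)
Definition summ a := exists B : R, forall N, psum (fun j => `|a j|) N <= B.

Lemma cvg_psum a : summ a -> psum a @ \oo --> sumZ a.
Proof.
by move=> [B aB]; rewrite sumZ.unlock; exact: (bounded_sum_cvg bl_uniq (@bl_mono n) aB).
Qed.

Lemma sumZE a l : psum a @ \oo --> l -> sumZ a = l.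
Proof. by move=> al; rewrite sumZ.unlock; exact: cvg_lim. Qed.

Lemma eq_psum a b : (forall j, j != 0 -> a j = b j) -> psum a = psum b.
Proof.
move=> ab; apply/funext => N; rewrite /psum !big_seq; apply: eq_bigr => j.
by rewrite mem_bl => /andP[/ab].
Qed.

Lemma le_psum a b N : (forall j, j != 0 -> a j <= b j) -> psum a N <= psum b N.
Proof.
move=> ab; rewrite /psum !big_seq; apply: ler_sum => j.
by rewrite mem_bl => /andP[/ab].
Qed.

Lemma eq_sumZ a b : (forall j, j != 0 -> a j = b j) -> sumZ a = sumZ b.
Proof. by rewrite sumZ.unlock => /eq_psum ab; rewrite -[LHS]/(limn (psum a)) ab. Qed.

Lemma summ_le a b : (forall j, j != 0 -> `|a j| <= b j) -> summ b -> summ a.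
Proof.
move=> ab [B bB]; exists B => N; apply: le_trans (bB N).
by apply: le_psum => j j0; apply: le_trans (ler_norm _); exact: ab.
Qed.

Lemma summ_abs a : summ a -> summ (fun j => `|a j|).
Proof. by case=> B aB; exists B => N; under eq_fun do rewrite normr_id. Qed.

Lemma summD a b : summ a -> summ b -> summ (fun j => a j + b j).
Proof.
move=> [A aA] [B bB]; exists (A + B) => N; apply: le_trans (lerD (aA N) (bB N)).
by rewrite /psum -big_split/=; apply: ler_sum => j _; exact: ler_normD.
Qed.

Lemma summZ c a : summ a -> summ (fun j => c * a j).
Proof.
move=> [A aA]; exists (`|c| * A) => N.
apply: le_trans (ler_wpM2l (normr_ge0 c) (aA N)).
by rewrite /psum mulr_sumr; apply: ler_sum => j _; rewrite normrM.
Qed.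

Lemma sumZD a b : summ a -> summ b ->
  sumZ (fun j => a j + b j) = sumZ a + sumZ b.
Proof.
move=> /cvg_psum ca /cvg_psum cb; apply: sumZE.
rewrite (_ : psum _ = psum a + psum b); first exact: cvgD.
by apply/funext => N; rewrite /psum big_split.
Qed.

Lemma sumZZ c a : summ a -> sumZ (fun j => c * a j) = c * sumZ a.
Proof.
move=> /cvg_psum ca; apply: sumZE.
rewrite (_ : psum _ = fun N => c * psum a N); last first.
  by apply/funext => N; rewrite /psum mulr_sumr.
by apply: cvgM => //; exact: cvg_cst.
Qed.

Lemma sumZ0 : sumZ (fun _ : Zn => 0 : R) = 0.
Proof.
apply: sumZE; rewrite (_ : psum _ = fun=> 0); first exact: cvg_cst.
by apply/funext => N; rewrite /psum big1.
Qed.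

Lemma le_sumZ a b : summ a -> summ b -> (forall j, j != 0 -> a j <= b j) ->
  sumZ a <= sumZ b.
Proof.
move=> /cvg_psum ca /cvg_psum cb ab.
rewrite -(cvg_lim _ ca)// -(cvg_lim _ cb)//; apply: ler_lim.
- exact: cvgP ca.
- exact: cvgP cb.
- by apply: nearW => N; exact: le_psum.
Qed.

Lemma sumZ_ge0 a : summ a -> (forall j, j != 0 -> 0 <= a j) -> 0 <= sumZ a.
Proof.
move=> sa a0; rewrite -sumZ0; apply: le_sumZ => //.
by exists 0 => N; rewrite /psum big1// => j _; rewrite normr0.
Qed.

Lemma psum_le_sumZ a N : summ a -> (forall j, j != 0 -> 0 <= a j) ->
  psum a N <= sumZ a.
Proof.
move=> sa a0; rewrite -(cvg_lim _ (cvg_psum sa))//.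
apply: limr_ge; first exact: cvgP (cvg_psum sa).
exists N => // M /= NM; apply: le_sum_subset; rewrite ?bl_uniq//.
  exact: bl_mono.
by move=> j; rewrite mem_bl => /andP[/a0].
Qed.

Lemma le_norm_sumZ a b : summ b -> (forall j, j != 0 -> `|a j| <= b j) ->
  `|sumZ a| <= sumZ b.
Proof.
move=> sb ab; have sa := summ_le ab sb.
rewrite ler_norml; apply/andP; split.
  rewrite -mulN1r -sumZZ//; apply: le_sumZ => //; first exact: summZ.
  by move=> j /ab; rewrite ler_norml mulN1r => /andP[].
by apply: le_sumZ => // j /ab; rewrite ler_norml => /andP[].
Qed.

Lemma summ_sqrM a b : summ (fun j => a j ^+ 2) -> summ (fun j => b j ^+ 2) ->
  summ (fun j => a j * b j).
Proof.
move=> sa sb; apply: summ_le (summD sa sb) => j _.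
rewrite ler_norml; have := sqr_ge0 (a j + b j); have := sqr_ge0 (a j - b j).
by rewrite !expr2 => *; apply/andP; split; nra.
Qed.

Lemma sumZ_CauchySchwarz a b :
  summ (fun j => a j ^+ 2) -> summ (fun j => b j ^+ 2) ->
  `|sumZ (fun j => a j * b j)| <=
    Num.sqrt (sumZ (fun j => a j ^+ 2)) * Num.sqrt (sumZ (fun j => b j ^+ 2)).
Proof.
move=> sa sb; have sab := summ_sqrM sa sb.
have A0 := sumZ_ge0 sa (fun j _ => sqr_ge0 (a j)).
have B0 := sumZ_ge0 sb (fun j _ => sqr_ge0 (b j)).
have pos t : 0 <= t ^+ 2 * sumZ (fun j => a j ^+ 2)
    + 2 * t * sumZ (fun j => a j * b j) + sumZ (fun j => b j ^+ 2).
  have s1 := summZ (t ^+ 2) sa; have s2 := summZ (2 * t) sab.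
  rewrite -(sumZZ _ sa) -(sumZZ _ sab) -(sumZD s1 s2) -(sumZD (summD s1 s2) sb).
  apply: sumZ_ge0; first exact: summD (summD s1 s2) sb.
  move=> j _; have := sqr_ge0 (t * a j + b j).
  by congr (0 <= _); ring.
rewrite -sqrtrM// -sqrtr_sqr ler_wsqrtr//.
move: A0 B0 pos; set A := sumZ _; set B := sumZ _; set C := sumZ _ => A0 B0 pos.
have [A00|AN0] := eqVneq A 0.
  have [->|CN0] := eqVneq C 0; first by rewrite expr0n/= mulr_ge0.
  have := pos (- (B + 1) / (2 * C)); rewrite A00 mulr0 add0r.
  rewrite [X in X + _](_ : _ = - (B + 1)); last by field.
  by move=> H; exfalso; lra.
have := pos (- C / A).
have Ap : 0 < A by rewrite lt_neqAle eq_sym AN0.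
rewrite [X in 0 <= X](_ : _ = (A * B - C ^+ 2) / A); last by field.
by rewrite pmulr_lge0 ?invr_gt0// subr_ge0.
Qed.

Lemma mem_shell nu j : (j \in @shell R n nu) = (j != 0) && (freq2 R j == nu).
Proof.
by apply/idP/andP => [/set_mem[? /eqP]|[? /eqP ?]]//; apply/mem_set.
Qed.

Lemma sum_shell (V : idomainType) nu (F : Zn -> V) N : nu <= N%:R ->
  \sum_(j \in @shell R n nu) F j = \sum_(j <- bl N | freq2 R j == nu) F j.
Proof.
move=> nuN.
have fin : finite_set (@shell R n nu).
  apply: sub_finite_set (finite_ball N) => j [j0 jnu]; split => //.
  by rewrite -(ler_nat R) -freq2E jnu.
rewrite fsbig_finite// -[RHS]big_filter; apply: perm_big; apply: uniq_perm.
- exact: fset_uniq.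
- by rewrite filter_uniq ?bl_uniq.
- move=> j; rewrite in_fset_set// mem_shell mem_filter mem_bl andbC.
  case: eqP => //= jnu; case: (j != 0) => //=.
  by rewrite -(ler_nat R) -freq2E jnu nuN.
Qed.

Definition ind nu mu : R := if mu == nu then 1 else 0.

Lemma natP nu : exists N : nat, nu <= N%:R.
Proof.
by exists (Num.truncn `|nu|).+1; rewrite (le_trans (ler_norm _))// ltW// truncnS_gt.
Qed.

Lemma psum_ind nu a N : nu <= N%:R ->
  psum (fun j => ind nu (freq2 R j) * a j) N = \sum_(j \in @shell R n nu) a j.
Proof.
move=> nuN; rewrite (sum_shell _ nuN) /psum [RHS]big_mkcond.
by apply: eq_bigr => j _; rewrite /ind; case: ifP => _; rewrite ?mul1r ?mul0r.
Qed.

Lemma sumZ_ind nu a :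
  sumZ (fun j => ind nu (freq2 R j) * a j) = \sum_(j \in @shell R n nu) a j.
Proof.
have [N nuN] := natP nu; apply: sumZE; apply: cvg_near_cst.
by exists N => // M /= NM; rewrite psum_ind// (le_trans nuN)// ler_nat.
Qed.

(** The frequencies met in a ball exhaust Lambda, and the shells of these
    frequencies partition the ball. *)
Definition fl N : seq R := undup [seq freq2 R j | j <- bl N].

Lemma mem_fl N nu : reflect (exists2 j, j \in bl N & nu = freq2 R j) (nu \in fl N).
Proof. by rewrite mem_undup; exact: mapP. Qed.

Lemma sum_fl a N :
  \sum_(nu <- fl N) \sum_(j \in @shell R n nu) a j = psum a N.
Proof.
transitivity (\sum_(nu <- fl N) \sum_(j <- bl N | freq2 R j == nu) a j).
  rewrite !big_seq; apply: eq_bigr => nu /mem_fl[j + ->].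
  rewrite mem_bl => /andP[j0 jN].
  by rewrite (@sum_shell _ _ _ N)// freq2E ler_nat.
rewrite (exchange_big_dep predT)//= /psum big_seq [RHS]big_seq.
apply: eq_bigr => j jN; rewrite (eq_bigl (pred1 (freq2 R j))); last first.
  by move=> nu; rewrite /= eq_sym.
rewrite -big_filter filter_pred1_uniq ?undup_uniq//; last by apply/mem_fl; exists j.
by rewrite big_seq1.
Qed.

Lemma fl_uniq N : uniq (fl N). Proof. exact: undup_uniq. Qed.

Lemma fl_Lambda N nu : nu \in fl N -> Lambda n nu.
Proof. by move=> /mem_fl[j + ->]; rewrite mem_bl => /andP[j0 _]; exists j. Qed.

Lemma fl_mono N M : (N <= M)%N -> {subset fl N <= fl M}.
Proof.
by move=> NM nu /mem_fl[j jN ->]; apply/mem_fl; exists j => //; exact: bl_mono jN.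
Qed.

Lemma fl_cover nu : Lambda n nu -> exists N, nu \in fl N.
Proof.
by move=> [j j0 ->]; exists (nfreq j); apply/mem_fl; exists j => //; rewrite mem_bl j0 /=.
Qed.

(* A sum over frequencies of shell sums is a sum over the lattice: both have
   the same partial sums along balls. *)
Let Lambda_sum_on (P : pred R) (g : R -> R) a :
  summ a -> (forall mu, ~~ P mu -> g mu = 0) ->
  (forall mu, Lambda n mu -> g mu = \sum_(j \in @shell R n mu) a j) ->
  abs_summable (Lambda n `&` [set` P]) g /\ asum (Lambda n `&` [set` P]) g = sumZ a.
Proof.
move=> sa gP gE; have [B aB] := sa.
pose s N := [seq mu <- fl N | P mu].
have sE (f : R -> R) N : (forall mu, ~~ P mu -> f mu = 0) -> \sum_(mu <- s N) f mu = \sum_(mu <- fl N) f mu.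
  move=> f0; rewrite big_filter [RHS](bigID P)/=.
  by rewrite [X in _ + X]big1 ?addr0// => mu; exact: f0.
have gB N : \sum_(mu <- s N) `|g mu| <= B.
  rewrite (sE (fun mu => `|g mu|)); last by move=> mu /gP ->; rewrite normr0.
  apply: le_trans (aB N).
  rewrite -sum_fl !big_seq; apply: ler_sum => mu /fl_Lambda Lmu.
  rewrite gE//; have [M muM] := natP mu.
  by rewrite !(@sum_shell _ _ _ M)//; exact: ler_norm_sum.
have [|||||sg cg] := @asum_exhaust R R (Lambda n `&` [set` P]) s _ _ _ _ g B.
- by move=> N; rewrite filter_uniq ?fl_uniq.
- by move=> N mu; rewrite mem_filter => /andP[Pmu /fl_Lambda].
- by move=> N M NM mu; rewrite !mem_filter => /andP[-> /(fl_mono NM)].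
- move=> mu [/fl_cover[N muN] Pmu]; exists N.
  by rewrite mem_filter muN andbT.
- exact: gB.
split=> //; apply/esym; apply: sumZE.
rewrite (_ : psum a = fun N => \sum_(mu <- s N) g mu)//.
apply/funext => N; rewrite (sE g N gP) -sum_fl !big_seq.
by apply: eq_bigr => mu /fl_Lambda Lmu; rewrite gE.
Qed.

Lemma Lambda_sumD1 nu (g : R -> R) a : summ a -> g nu = 0 ->
  (forall mu, Lambda n mu -> g mu = \sum_(j \in @shell R n mu) a j) ->
  abs_summable (Lambda n `\ nu) g /\ asum (Lambda n `\ nu) g = sumZ a.
Proof.
move=> sa gnu gE; rewrite (_ : Lambda n `\ nu = Lambda n `&` [set` predC1 nu]).
  by apply: Lambda_sum_on => // mu; rewrite negbK => /eqP ->.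
by apply/seteqP; split=> mu /= [Lmu /eqP]; split=> //; apply/eqP.
Qed.

Lemma Lambda_sum (g : R -> R) a : summ a ->
  (forall nu, Lambda n nu -> g nu = \sum_(j \in @shell R n nu) a j) ->
  abs_summable (Lambda n) g /\ asum (Lambda n) g = sumZ a.
Proof.
move=> sa gE; rewrite (_ : Lambda n = Lambda n `&` [set` predT]).
  exact: Lambda_sum_on.
by apply/seteqP; split=> mu //= [].
Qed.

Lemma Lambda_gt0 nu : Lambda n nu -> 1 <= nu.
Proof.
move=> [j j0 ->]; rewrite freq2E ler1n lt0n; apply: contra j0 => /eqP j0.
apply/eqP/rowP => i; rewrite mxE; apply/eqP; rewrite -absz_eq0.
have : (`|j 0%R i| ^ 2 == 0)%N; last by rewrite expn_eq0 andbT.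
move: j0; rewrite /nfreq (bigD1 i)//= => /eqP; by rewrite addn_eq0 => /andP[].
Qed.

End lattice_sums.

(** * Fourier coefficients *)

(** The inner product of C as a real plane.  Sealed, so that sums of such terms
    are not mistaken for sums of two terms. *)
HB.lock Definition rp (R : realType) (a b : R[i]) : R :=
  complex.Re a * complex.Re b + complex.Im a * complex.Im b.

Lemma rpE (R : realType) (a b : R[i]) :
  rp a b = complex.Re a * complex.Re b + complex.Im a * complex.Im b.
Proof. by rewrite rp.unlock. Qed.

Section fourier.
Variables (R : realType) (n : nat).
Local Notation Zn := 'rV[int]_n.
Local Notation torus := (n.-tuple (measurableTypeR R)).
Local Notation mu := (torus_measure R n).
Local Notation L2 := (Lfun mu 2%:E).
Local Notation ip := (ip mu).
Local Notation normc := ComplexField.Normc.normc.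
Local Notation Re := complex.Re.
Local Notation Im := complex.Im.
Implicit Types (j k : Zn) (c d : Zn -> R[i]) (f g : torus -> R) (x : torus).

Lemma normc_sqr (a : R[i]) : normc a ^+ 2 = rp a a.
Proof.
by case: a => x y; rewrite !rpE /= sqr_sqrtr ?addr_ge0 ?sqr_ge0// !expr2.
Qed.

Let kappa : R := (Num.sqrt ((2 * pi) ^+ n))^-1.
(** The real and imaginary parts of the modes: the functions being real valued,
    the whole theory takes place in L^2 over the reals. *)
Definition Cm j (x : torus) : R := kappa * cos (phase j x).
Definition Sm j (x : torus) : R := kappa * sin (phase j x).

Lemma emodeE j x : emode j x = Cm j x +i* Sm j x.
Proof. by rewrite /emode /Cm /Sm; simpc. Qed.

Lemma phaseN j x : phase (- j) x = - phase j x.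
Proof.
by rewrite /phase -sumrN; apply: eq_bigr => i _; rewrite mxE rmorphN mulNr.
Qed.

Lemma phaseD j k x : phase (j + k) x = phase j x + phase k x.
Proof.
by rewrite /phase -big_split; apply: eq_bigr => i _; rewrite mxE rmorphD mulrDl.
Qed.

Lemma CmN j x : Cm (- j) x = Cm j x.
Proof. by rewrite /Cm phaseN cosN. Qed.

Lemma SmN j x : Sm (- j) x = - Sm j x.
Proof. by rewrite /Sm phaseN sinN mulrN. Qed.

Let muT_lty : (mu setT < +oo)%E := finite_measureT_lty mu.

Lemma measurable_phase j : measurable_fun setT (@phase R n j).
Proof. exact: measurable_lphase. Qed.

Lemma L2_Cm j : Cm j \in L2.
Proof.
apply: L2_scale; apply: L2_bounded.
  apply: measurableT_comp; last exact: measurable_phase.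
  by apply: continuous_measurable_fun; exact: continuous_cos.
exists 1; split => // M M1 x _ /=; apply: le_trans (ltW M1).
by rewrite ler_norml cos_geN1 cos_le1.
Qed.

Lemma L2_Sm j : Sm j \in L2.
Proof.
apply: L2_scale; apply: L2_bounded.
  apply: measurableT_comp; last exact: measurable_phase.
  by apply: continuous_measurable_fun; exact: continuous_sin.
exists 1; split => // M M1 x _ /=; apply: le_trans (ltW M1).
by rewrite ler_norml sin_geN1 sin_le1.
Qed.

Let Icos j (c : R) : \int[mu]_x cos (phase j x + c) =
  if j == 0 then (2 * pi) ^+ n * cos c else 0.
Proof.
rewrite /Rintegral (torus_cos (fun i => j 0 i) c) /=.
rewrite (_ : [forall i, _] = (j == 0)) //.
apply/forallP/eqP => [j0|-> i]; last by rewrite mxE.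
by apply/rowP => i; rewrite (eqP (j0 i)) mxE.
Qed.

Let intcos j (t : R) : mu.-integrable setT (fun x => (cos (phase j x + t))%:E).
Proof.
apply: integrable_cos => //; apply: measurable_funD => //.
exact: measurable_phase.
Qed.

Let kappaV : kappa ^+ 2 * (2 * pi) ^+ n = 1.
Proof.
have p0 : 0 < (2 * pi) ^+ n :> R by rewrite exprn_gt0 ?mulr_gt0 ?pi_gt0.
by rewrite exprVn sqr_sqrtr ?(ltW p0)// mulVf// gt_eqF.
Qed.

(* Every product of two real modes is, by the product-to-sum formulas, of the
   form required here, with c = 0 or c = - pi / 2 and e = 1 or e = -1. *)
Let ip_cos (F G : torus -> R) j k (c : R) (e : R) :
  (forall x, F x * G x = kappa ^+ 2 / 2 *
     (cos (phase (j - k) x + c) + e * cos (phase (j + k) x + c))) ->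
  ip F G = ((j == k)%:R + e * (j == - k)%:R) / 2 * cos c.
Proof.
move=> FG; rewrite /ip /Rintegral.
rewrite (_ : (fun x => _) = fun x => (kappa ^+ 2 / 2 *
   (cos (phase (j - k) x + c) + e * cos (phase (j + k) x + c)))%:E); last first.
  by apply/funext => x; rewrite FG.
have i2 : mu.-integrable setT (EFin \o (fun x => e * cos (phase (j + k) x + c))).
  rewrite (_ : EFin \o _ =
    (fun x => e%:E * (cos (phase (j + k) x + c))%:E)%E) //.
  have := integrableZl measurableT e (intcos (j + k) c). exact.
rewrite -/(Rintegral _ _ _) RintegralZl//; last first.
  by have := integrableD measurableT (intcos (j - k) c) i2.
rewrite RintegralD//; last exact: intcos.
rewrite RintegralZl//; last exact: intcos.
rewrite !Icos subr_eq0 addr_eq0.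
have := kappaV; set K := kappa ^+ 2; set P := (2 * pi) ^+ n => KP.
have -> : (if j == k then P * cos c else 0) = (j == k)%:R * (P * cos c).
  by case: ifP => _; rewrite ?mul1r ?mul0r.
have -> : (if j == - k then P * cos c else 0) = (j == - k)%:R * (P * cos c).
  by case: ifP => _; rewrite ?mul1r ?mul0r.
set u := (j == k)%:R; set v := (j == - k)%:R; set w := cos c.
transitivity (K * P * ((u + e * v) / 2 * w)); first by ring.
by rewrite KP mul1r.
Qed.

Lemma ip_CC j k : ip (Cm j) (Cm k) = ((j == k)%:R + (j == - k)%:R) / 2.
Proof.
rewrite (@ip_cos _ _ j k 0 1); first by rewrite cos0 mulr1 mul1r.
by move=> x; rewrite !addr0 !phaseD phaseN cosB cosD /Cm; field.
Qed.

Lemma ip_SS j k : ip (Sm j) (Sm k) = ((j == k)%:R - (j == - k)%:R) / 2.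
Proof.
rewrite (@ip_cos _ _ j k 0 (-1)); first by rewrite cos0 mulr1 mulN1r.
by move=> x; rewrite !addr0 !phaseD phaseN cosB cosD /Sm; field.
Qed.

Lemma ip_CS j k : ip (Cm j) (Sm k) = 0.
Proof.
rewrite ipC (@ip_cos _ _ k j (- (pi / 2)) 1); last first.
  by move=> x; rewrite !cosBpihalf !phaseD phaseN sinB sinD /Sm /Cm; field.
by rewrite cosN cos_pihalf mulr0.
Qed.

Lemma fcoefE f j : f \in L2 -> fcoef f j = ip f (Cm j) +i* - ip f (Sm j).
Proof.
move=> Lf; rewrite /fcoef /cintegral; congr (_ +i* _).
  by apply: eq_Rintegral => x _; rewrite emodeE /= mul0r subr0.
rewrite -mulN1r [ip f _]ipC -ipZl//; last exact: L2_Sm.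
rewrite ipC; apply: eq_Rintegral => x _.
by rewrite emodeE /= mul0r addr0 mulN1r.
Qed.

Lemma fcoefN f j : f \in L2 -> fcoef f (- j) = conjc (fcoef f j).
Proof.
move=> Lf; rewrite !fcoefE//=; congr (_ +i* - _).
  by apply: eq_Rintegral => x _; rewrite CmN.
rewrite -[RHS]mulN1r [in RHS]ipC -ipZl//; last exact: L2_Sm.
by rewrite [RHS]ipC; apply: eq_Rintegral => x _; rewrite SmN mulN1r.
Qed.

Lemma fcoef_lincomb (a : R) f g j : f \in L2 -> g \in L2 ->
  fcoef (fun x => a * f x + g x) j = a%:C * fcoef f j + fcoef g j.
Proof.
move=> Lf Lg; rewrite !fcoefE//; last exact: L2_lincomb.
rewrite !ip_lincomb ?L2_Cm ?L2_Sm//; simpc.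
by congr (_ +i* _); ring.
Qed.

Lemma fcoef0_eq0 f : f \in L2 -> fcoef f 0 = 0 <-> (\int[mu]_x f x)%R = 0.
Proof.
move=> Lf.
have p0 x : phase (0 : Zn) x = 0.
  by rewrite /phase big1// => i _; rewrite mxE mul0r.
have Lc : (fun=> 1 : R) \in L2 by exact: (Lfun_cst mu 1 2).
rewrite fcoefE//.
have -> : Sm 0 = (fun=> 0) by apply/funext => x; rewrite /Sm p0 sin0 mulr0.
have -> : Cm 0 = (fun=> kappa * 1) by apply/funext => x; rewrite /Cm p0 cos0.
rewrite [ip f _]ipC ipZl// [X in _ +i* - X]ipC ip0l oppr0.
have -> : ip (fun=> 1) f = (\int[mu]_x f x)%R.
  by apply: eq_Rintegral => x _; rewrite mul1r.
have k0 : kappa != 0.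
  by rewrite invr_neq0// sqrtr_eq0 -ltNge exprn_gt0// mulr_gt0 ?pi_gt0.
split=> [[] /eqP|->]; last by rewrite mulr0.
by rewrite mulf_eq0 (negbTE k0) => /eqP.
Qed.

Lemma psum_opp (a : Zn -> R) N : psum (fun j => a (- j)) N = psum a N.
Proof.
rewrite /psum -(big_map (fun j : Zn => - j) xpredT); apply: perm_big.
have nfreqN j : nfreq (- j) = nfreq j.
  by rewrite /nfreq; apply: eq_bigr => i _; rewrite mxE abszN.
apply: uniq_perm; first by rewrite map_inj_uniq ?bl_uniq//; exact: oppr_inj.
  exact: bl_uniq.
move=> j; rewrite -[j in LHS]opprK mem_map; last exact: oppr_inj.
by rewrite !mem_bl oppr_eq0 nfreqN.
Qed.

Lemma freq2N j : freq2 R (- j) = freq2 R j.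
Proof. by rewrite /freq2; apply: eq_bigr => i _; rewrite mxE rmorphN sqrrN. Qed.

(** The real part of sum_j c_j e_j over a ball; when c is hermitian the
    imaginary part vanishes. *)
Definition TP c N (x : torus) : R :=
  psum (fun j => Re (c j) * Cm j x - Im (c j) * Sm j x) N.

Lemma L2_TP c N : TP c N \in L2.
Proof.
apply: L2_sum => j; apply: L2_sub; apply: L2_scale; [exact: L2_Cm|exact: L2_Sm].
Qed.

Lemma ip_TP c N g : g \in L2 ->
  ip (TP c N) g = psum (fun j => rp (c j) (fcoef g j)) N.
Proof.
move=> Lg.
rewrite (@ip_suml _ _ _ mu _ (bl n N)
  (fun j x => Re (c j) * Cm j x - Im (c j) * Sm j x))//; last first.
  by move=> j; apply: L2_sub; apply: L2_scale; [exact: L2_Cm|exact: L2_Sm].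
apply: eq_bigr => j _.
rewrite (ipBl (L2_scale _ (L2_Cm j)) (L2_scale _ (L2_Sm j)) Lg).
rewrite (ipZl _ (L2_Cm j) Lg) (ipZl _ (L2_Sm j) Lg).
by rewrite !rpE fcoefE//= [ip g (Cm j)]ipC [ip g (Sm j)]ipC mulrN.
Qed.

Definition hermitian c := forall j, c (- j) = conjc (c j).

Lemma psum_delta (a : Zn -> R) N k :
  psum (fun j => a j * (k == j)%:R) N = if k \in bl n N then a k else 0.
Proof.
rewrite /psum; case: ifPn => [kN|kN].
  rewrite (bigD1_seq k)//= ?bl_uniq// eqxx mulr1 big1 ?addr0// => j jk.
  by rewrite eq_sym (negbTE jk) mulr0.
rewrite big_seq big1// => j jN; case: eqP => [kj|]; last by rewrite mulr0.
by rewrite kj jN in kN.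
Qed.

Lemma psum_deltaN (a : Zn -> R) N k :
  psum (fun j => a j * (k == - j)%:R) N = if k \in bl n N then a (- k) else 0.
Proof.
rewrite -psum_opp -(psum_delta (fun j => a (- j))); congr psum; apply/funext => j.
by rewrite opprK.
Qed.

(** The modes k and - k both contribute to the k-th coefficient, each with
    weight one half; the symmetry of c makes the two halves agree. *)
Lemma fcoef_TP c N k : hermitian c ->
  fcoef (TP c N) k = if k \in bl n N then c k else 0.
Proof.
move=> hc; rewrite fcoefE ?L2_TP// !ip_TP ?L2_Cm ?L2_Sm//.
have -> : psum (fun j => rp (c j) (fcoef (Cm k) j)) N =
    (psum (fun j => Re (c j) * (k == j)%:R) N +
     psum (fun j => Re (c j) * (k == - j)%:R) N) / 2.
  rewrite /psum -big_split mulr_suml; apply: eq_bigr => j _.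
  by rewrite fcoefE ?L2_Cm// !rpE/= ip_CC ip_CS oppr0 mulr0 addr0 /=; ring.
have -> : psum (fun j => rp (c j) (fcoef (Sm k) j)) N =
    (psum (fun j => - Im (c j) * (k == j)%:R) N -
     psum (fun j => - Im (c j) * (k == - j)%:R) N) / 2.
  rewrite /psum -sumrB mulr_suml; apply: eq_bigr => j _.
  by rewrite fcoefE ?L2_Sm// !rpE/= [ip (Sm k) (Cm j)]ipC ip_CS ip_SS; ring.
rewrite (psum_delta (fun j => Re (c j))) (psum_deltaN (fun j => Re (c j))).
rewrite (psum_delta (fun j => - Im (c j))) (psum_deltaN (fun j => - Im (c j))).
rewrite hc; case: ifP => _; last by rewrite subrr addr0 mul0r oppr0.
by case: (c k) => u v /=; congr (_ +i* _); field.
Qed.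

Lemma psum_odd (a : Zn -> R) N : (forall j, a (- j) = - a j) -> psum a N = 0.
Proof.
move=> ao; have := psum_opp a N.
under eq_fun do rewrite ao.
rewrite {1}/psum sumrN -/(psum a N) => H; lra.
Qed.

(** The imaginary part is odd under j -> - j, so it cancels over the ball. *)
Lemma fourier_partialE c N x : hermitian c ->
  \sum_(j \in [set j : Zn | j != 0 /\ freq2 R j <= N%:R]) (c j * emode j x)
  = (TP c N x)%:C.
Proof.
move=> hc; rewrite fourier_ballE fsbig_finite; last exact: finite_ball.
have -> : TP c N x = TP c N x + 0 by rewrite addr0.
transitivity (psum (fun j => Re (c j) * Cm j x - Im (c j) * Sm j x) N
   +i* psum (fun j => Re (c j) * Sm j x + Im (c j) * Cm j x) N); last first.
  rewrite addr0; congr (_ +i* _); apply: psum_odd => j.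
  by rewrite hc CmN SmN; case: (c j) => u v /=; ring.
rewrite /psum -/(bl n N); elim: (bl n N) => [|j r IH]; first by rewrite !big_nil.
rewrite !big_cons IH emodeE; case: (c j) => u v; simpc.
by [].
Qed.

(** The convergence of the complex Fourier series is convergence of the real
    trigonometric polynomials for the inner product of L^2. *)
Lemma L2zeroP f : L2zero f <->
  [/\ f \in L2, (\int[mu]_x f x)%R = 0 &
    (fun N => ip (fun x => f x - TP (fcoef f) N x)
                 (fun x => f x - TP (fcoef f) N x)) @ \oo --> (0 : R)].
Proof.
suff H : f \in L2 -> (fun N => \int[mu]_x normc ((f x)%:C - fourier_partial f N x) ^+ 2)%R
  = (fun N => ip (fun x => f x - TP (fcoef f) N x)
                 (fun x => f x - TP (fcoef f) N x)).
  by split=> -[Lf f0 cf]; split=> //; rewrite ?H// -?H.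
move=> Lf; apply/funext => N; apply: eq_Rintegral => x _.
rewrite /fourier_partial fourier_partialE; last by move=> j; exact: fcoefN.
by rewrite normc_sqr !rpE /= !(subr0, mulr0, addr0).
Qed.

End fourier.

(** * Parseval and Riesz-Fischer *)

Section parseval.
Variables (R : realType) (n : nat).
Local Notation Zn := 'rV[int]_n.
Local Notation torus := (n.-tuple (measurableTypeR R)).
Local Notation mu := (torus_measure R n).
Local Notation L2 := (Lfun mu 2%:E).
Local Notation ip := (ip mu).
Implicit Types (j k : Zn) (c d : Zn -> R[i]) (f g : torus -> R) (x : torus).

Lemma rp_ge0 (a : R[i]) : 0 <= rp a a.
Proof. by rewrite !rpE -!expr2 addr_ge0 ?sqr_ge0. Qed.

Lemma rpC (a b : R[i]) : rp a b = rp b a.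
Proof. by rewrite !rpE; ring. Qed.

Lemma rp_le (a b : R[i]) : `|rp a b| <= (rp a a + rp b b) / 2.
Proof.
case: a b => x y [u v]; rewrite !rpE /= ler_norml.
have := sqr_ge0 (x - u); have := sqr_ge0 (y - v).
have := sqr_ge0 (x + u); have := sqr_ge0 (y + v).
by move=> *; apply/andP; split; nra.
Qed.

Lemma rp_CauchySchwarz (a b : R[i]) : rp a b ^+ 2 <= rp a a * rp b b.
Proof.
case: a b => x y [u v]; rewrite !rpE /=.
by have := sqr_ge0 (x * v - y * u); nra.
Qed.

Lemma summ_rp c d : summ (fun j => rp (c j) (c j)) ->
  summ (fun j => rp (d j) (d j)) -> summ (fun j => rp (c j) (d j)).
Proof.
move=> sc sd; apply: summ_le (summD sc sd) => j _.
apply: le_trans (rp_le _ _) _.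
by rewrite ler_pdivrMr// ler_peMr ?ler1n// addr_ge0 ?rp_ge0.
Qed.

Lemma L2zero_L2 f : L2zero f -> f \in L2. Proof. by case. Qed.

Lemma cvg_parseval f g : L2zero f -> g \in L2 ->
  psum (fun j => rp (fcoef f j) (fcoef g j)) @ \oo --> ip f g.
Proof.
move=> /L2zeroP[Lf _ cf] Lg.
rewrite (_ : psum _ = fun N => ip (TP (fcoef f) N) g).
  by apply: cvg_ip => // N; exact: L2_TP.
by apply/funext => N; rewrite ip_TP.
Qed.

Lemma L2zero_summ f : L2zero f -> summ (fun j => rp (fcoef f j) (fcoef f j)).
Proof.
move=> f0; have cf := cvg_parseval f0 (L2zero_L2 f0).
exists (ip f f) => N.
rewrite (@eq_psum _ _ _ (fun j => rp (fcoef f j) (fcoef f j))); last first.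
  by move=> j _; rewrite ger0_norm ?rp_ge0.
rewrite -(cvg_lim _ cf)//; apply: nondecreasing_cvgn_le; last exact: cvgP cf.
move=> M M' MM'; apply: le_sum_subset; rewrite ?bl_uniq//; first exact: bl_mono.
by move=> j _; exact: rp_ge0.
Qed.

Lemma parseval f g : L2zero f -> g \in L2 ->
  ip f g = sumZ (fun j => rp (fcoef f j) (fcoef g j)).
Proof. by move=> f0 Lg; apply/esym/sumZE; exact: cvg_parseval. Qed.

Lemma L2zero_lincomb (a : R) f g : L2zero f -> L2zero g ->
  L2zero (fun x => a * f x + g x).
Proof.
move=> /L2zeroP[Lf f0 cf] /L2zeroP[Lg g0 cg]; apply/L2zeroP; split.
- exact: L2_lincomb.
- have i f' : f' \in L2 -> mu.-integrable setT (EFin \o f').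
    move=> Lf'; apply/Lfun1_integrable; apply: (Lfun_subset12 _ Lf').
    exact: fin_num_measure.
  rewrite RintegralD//; [|exact: i (L2_scale a Lf)|exact: i].
  by rewrite RintegralZl ?f0 ?g0 ?mulr0 ?addr0//; exact: i.
pose F N x := f x - TP (fcoef f) N x; pose G N x := g x - TP (fcoef g) N x.
have LF N : F N \in L2 by apply: L2_sub => //; exact: L2_TP.
have LG N : G N \in L2 by apply: L2_sub => //; exact: L2_TP.
have c0 : (fun N => 2 * a ^+ 2 * ip (F N) (F N) + 2 * ip (G N) (G N)) @ \oo --> (0 : R).
  rewrite -[X in _ --> X](addr0 (0 : R)).
  rewrite -[X in _ --> (X + _)](mulr0 (2 * a ^+ 2)) -[X in _ --> (_ + X)](mulr0 (2 : R)).
  apply: cvgD; (apply: cvgM; [exact: cvg_cst|]); [exact: cf|exact: cg].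
apply: (squeeze_cvgr _ (cvg_cst 0) c0); apply: nearW => N.
rewrite ip_ge0 /=.
have -> : (fun x => a * f x + g x - TP (fcoef (fun x0 => a * f x0 + g x0)) N x)
    = (fun x => a * F N x + G N x).
  apply/funext => x; rewrite /F /G.
  have -> : TP (fcoef (fun x0 => a * f x0 + g x0)) N x =
    a * TP (fcoef f) N x + TP (fcoef g) N x.
    rewrite /TP /psum mulr_sumr -big_split; apply: eq_bigr => j _.
    rewrite fcoef_lincomb//; case: (fcoef f j) (fcoef g j) => u v [u' v'].
    by simpc => /=; ring.
  by ring.
have := ip_ge0 mu (fun x => - a * F N x + G N x).
rewrite (ip_sqr_lincomb (- a) (LF N) (LG N)) (ip_sqr_lincomb a (LF N) (LG N)).
move: (ip (F N) (F N)) (ip (F N) (G N)) (ip (G N) (G N)) => p q r.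
by rewrite sqrrN mulrN mulNr => H; lra.
Qed.

(** Along a subsequence the partial sums have increments of norm at most 2^-i,
    so they have a limit f in L^2, whose coefficients are the c_j by weak
    continuity.  The full sequence of partial sums then converges as well: the
    squared error is |f|^2 - sum_(j in ball) |c_j|^2, which decreases with the
    ball. *)
Theorem riesz_fischer c : hermitian c -> c 0 = 0 ->
  summ (fun j => rp (c j) (c j)) -> exists2 f, L2zero f & forall j, fcoef f j = c j.
Proof.
move=> hc c0 sc; pose a j := rp (c j) (c j); pose s := sumZ a.
have a0 j : j != 0 -> 0 <= a j by move=> _; exact: rp_ge0.
(* Partial sums over nested balls: the smaller one is the projection of the
   larger one. *)
have ipTP N M : (N <= M)%N -> ip (TP c N) (TP c M) = psum a N.
  move=> NM; rewrite ip_TP ?L2_TP//; rewrite /psum !big_seq; apply: eq_bigr => j jN.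
  by rewrite fcoef_TP// (bl_mono NM jN).
have dist N M : (N <= M)%N ->
    ip (fun x => TP c M x - TP c N x) (fun x => TP c M x - TP c N x) = psum a M - psum a N.
  move=> NM; rewrite ip_sqrB ?L2_TP// [ip (TP c M) (TP c N)]ipC !ipTP//; ring.
have /choice[K KP] : forall i : nat, exists K : nat, forall N, (K <= N)%N ->
    s - psum a N <= 4 ^- i.
  move=> i; have e0 : 0 < (4 ^- i : R) by rewrite invr_gt0 exprn_gt0.
  have [K _ KP] := (cvgrPdist_le _ _).1 (cvg_psum sc) _ e0.
  by exists K => N KN; apply: le_trans (ler_norm _) _; exact: KP.
pose N_ i := (\sum_(l < i.+1) (K l).+1)%N.
have NS i : (N_ i <= N_ i.+1)%N by rewrite /N_ [leqRHS]big_ord_recr leq_addr.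
have KN i : (K i <= N_ i)%N by rewrite /N_ big_ord_recr (leq_trans (leqnSn _))// leq_addl.
pose D i x := TP c (N_ i.+1) x - TP c (N_ i) x.
have LD i : D i \in L2 by apply: L2_sub; exact: L2_TP.
have smallD i : ip (D i) (D i) <= 4 ^- i.
  rewrite /D dist//; apply: le_trans (KP i _ (KN i)).
  by rewrite lerD2r psum_le_sumZ.
have [f0 Lf0 f0P] := L2_complete LD smallD.
pose f x := f0 x + TP c (N_ 0) x.
have Lf : f \in L2 by apply: L2_add => //; exact: L2_TP.
have fP m : ip (fun x => f x - TP c (N_ m) x) (fun x => f x - TP c (N_ m) x) <= 8 * 2 ^- m.
  rewrite (_ : (fun x => _) = fun x => f0 x - \sum_(0 <= i < m) D i x)//.
  apply/funext => x; rewrite /D telescope_sumr// /f; ring.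
have geo : (fun m => 8 * 2 ^- m : R) @ \oo --> (0 : R).
  rewrite (_ : (fun _ => _) = geometric 8 2^-1).
    by apply: cvg_geometric; rewrite ger0_norm// invf_lt1// ltr1n.
  by apply/funext => m; rewrite /= exprVn.
have cfN : (fun m => ip (fun x => f x - TP c (N_ m) x)
    (fun x => f x - TP c (N_ m) x)) @ \oo --> (0 : R).
  apply: (squeeze_cvgr _ (cvg_cst 0) geo); apply: nearW => m.
  by rewrite ip_ge0 fP.
have N_ge m : (m <= N_ m)%N.
  rewrite /N_; elim: m => // m IH; rewrite big_ord_recr /=.
  by rewrite addnS ltnS (leq_trans IH)// leq_addr.
have fc j : fcoef f j = c j.
  have ev : \forall m \near \oo, fcoef (TP c (N_ m)) j = c j.
    exists (nfreq j) => // m /= jm; rewrite fcoef_TP// mem_bl.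
    by rewrite (leq_trans jm (N_ge m)) andbT; case: eqP => [->|].
  have LT m : TP c (N_ m) \in L2 by exact: L2_TP.
  have [cC cS] := (cvg_ip LT Lf (L2_Cm R j) cfN, cvg_ip LT Lf (L2_Sm R j) cfN).
  rewrite fcoefE//; apply/eqP; rewrite eq_complex /=; apply/andP; split; apply/eqP.
    rewrite -(cvg_lim _ cC)//; apply: cvg_lim => //; apply: cvg_near_cst.
    by apply: filterS ev => m; rewrite fcoefE// => <-.
  rewrite -(cvg_lim _ cS)// -[RHS]opprK; congr (- _).
  apply: cvg_lim => //; apply: cvg_near_cst.
  by apply: filterS ev => m; rewrite fcoefE// => <- /=; rewrite opprK.
have eE N : ip (fun x => f x - TP c N x) (fun x => f x - TP c N x) = ip f f - psum a N.
  have fT : ip f (TP c N) = psum a N.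
    by rewrite ipC ip_TP//; apply: eq_bigr => j _; rewrite fc.
  by rewrite ip_sqrB ?L2_TP// ipTP// fT; ring.
exists f => //; apply/L2zeroP; split => //.
  by apply/fcoef0_eq0 => //; rewrite fc.
rewrite (_ : fcoef f = c); last by apply/funext.
apply/cvgrPdist_le => e e0.
have [m _ /(_ m (leqnn m)) /= me] := (cvgrPdist_le _ _).1 geo e e0.
exists (N_ m) => // N /= mN; rewrite sub0r normrN ger0_norm ?ip_ge0//.
apply: le_trans (_ : 8 * 2 ^- m <= _); last first.
  by apply: le_trans me; rewrite sub0r normrN ler_norm.
apply: le_trans (fP m); rewrite !eE lerD2l lerN2.
apply: le_sum_subset; rewrite ?bl_uniq//; first exact: bl_mono.
by move=> j _; exact: rp_ge0.
Qed.

End parseval.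

(** * Sobolev spaces and derivatives *)

Section sobolev_spaces.
Variables (R : realType) (n : nat).
Local Notation Zn := 'rV[int]_n.
Local Notation torus := (n.-tuple (measurableTypeR R)).
Local Notation mu := (torus_measure R n).
Local Notation L2 := (Lfun mu 2%:E).
Local Notation ip := (ip mu).
Implicit Types (j k : Zn) (c d : Zn -> R[i]) (f g : torus -> R) (x : torus).

Lemma L2zero_fcoef0 f : L2zero f -> fcoef f 0 = 0.
Proof. by case=> Lf f0 _; exact/fcoef0_eq0. Qed.

Lemma freq2_ge1 j : j != 0 -> 1 <= freq2 R j.
Proof. by move=> j0; apply: (@Lambda_gt0 R n); exists j. Qed.

Lemma freq2_ge0 j : 0 <= freq2 R j.
Proof. by rewrite freq2E ler0n. Qed.

Lemma freq2_coord j l : (j 0 l)%:~R ^+ 2 <= freq2 R j.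
Proof. by rewrite /freq2 (bigD1 l)//= lerDl sumr_ge0// => i _; rewrite sqr_ge0. Qed.

Lemma rp_imul (t : R) (a b : R[i]) :
  rp ((0 +i* t) * a) ((0 +i* t) * b) = t ^+ 2 * rp a b.
Proof. by case: a b => u v [u' v']; simpc; rewrite !rpE /=; ring. Qed.

Lemma rp_scale (s t : R) (a b : R[i]) :
  rp (s%:C * a) (t%:C * b) = s * t * rp a b.
Proof. by case: a b => u v [u' v']; simpc; rewrite !rpE /=; ring. Qed.

Let weighted (s : nat) f j : R := freq2 R j ^+ s * rp (fcoef f j) (fcoef f j).

Let weighted_ge0 s f j : 0 <= weighted s f j.
Proof. by rewrite mulr_ge0 ?exprn_ge0 ?freq2_ge0 ?rp_ge0. Qed.

Let weightedE s f : (fun j => freq2 R j ^+ s * ComplexField.Normc.normc (fcoef f j) ^+ 2)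
  = weighted s f.
Proof. by apply/funext => j; rewrite normc_sqr. Qed.

Let abs_summableT f s : L2zero f -> summ (weighted s f) ->
  abs_summable [set: Zn] (weighted s f) /\ asum [set: Zn] (weighted s f) = sumZ (weighted s f).
Proof.
move=> f0 [B sB]; pose b N : seq Zn := 0 :: bl n N.
have w0 : weighted s f 0 = 0.
  by rewrite /weighted L2zero_fcoef0// !rpE /= mulr0 addr0 mulr0.
have [|||||sg cg] := @asum_exhaust R Zn setT b _ _ _ _ (weighted s f) B.
- by move=> N; rewrite /= mem_bl eqxx bl_uniq.
- by [].
- move=> N M NM j; rewrite !inE => /orP[->//|/(bl_mono NM) ->].
  by rewrite orbT.
- move=> j _; exists (nfreq j); rewrite in_cons mem_bl.
  by rewrite leqnn andbT orbN.
- by move=> N; rewrite big_cons w0 normr0 add0r; exact: sB.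
split => //; apply/esym/sumZE; rewrite (_ : psum _ = fun N => \sum_(i <- b N) weighted s f i)//.
by apply/funext => N; rewrite big_cons w0 add0r.
Qed.

Lemma sobolevP s f : sobolev s f <->
  L2zero f /\ summ (fun j => freq2 R j ^+ s * rp (fcoef f j) (fcoef f j)).
Proof.
rewrite /sobolev weightedE; split=> -[f0 sf]; split=> //.
  exact: (@abs_summable_bounded R Zn setT (bl n) (bl_uniq n) (fun _ _ _ => I) _ sf).
by have [] := abs_summableT f0 sf.
Qed.

Lemma sobolev_sqnormE s f : sobolev s f ->
  sobolev_sqnorm s f = sumZ (fun j => freq2 R j ^+ s * rp (fcoef f j) (fcoef f j)).
Proof.
by move=> /sobolevP[f0 sf]; rewrite /sobolev_sqnorm weightedE; have [] := abs_summableT f0 sf.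
Qed.

Lemma sobolev_le s t f : (s <= t)%N -> sobolev t f -> sobolev s f.
Proof.
move=> st /sobolevP[f0 sf]; apply/sobolevP; split=> //.
apply: summ_le sf => j j0; rewrite ger0_norm ?weighted_ge0//.
by rewrite ler_wpM2r ?rp_ge0// ler_weXn2l// freq2_ge1.
Qed.

Lemma sobolev_L2zero s f : sobolev s f -> L2zero f. Proof. by case. Qed.

Lemma sobolev_lincomb s (a : R) f g : sobolev s f -> sobolev s g ->
  sobolev s (fun x => a * f x + g x).
Proof.
move=> /sobolevP[f0 sf] /sobolevP[g0 sg]; apply/sobolevP; split.
  exact: L2zero_lincomb.
apply: summ_le (summD (summZ (2 * a ^+ 2) sf) (summZ 2 sg)) => j _.
rewrite fcoef_lincomb ?(L2zero_L2 f0) ?(L2zero_L2 g0)//.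
rewrite ger0_norm; last by rewrite mulr_ge0 ?exprn_ge0 ?freq2_ge0 ?rp_ge0.
rewrite [X in _ <= X + _]mulrCA [X in _ <= _ + X]mulrCA -mulrDr.
rewrite ler_wpM2l ?exprn_ge0 ?freq2_ge0//.
case: (fcoef f j) (fcoef g j) => u v [u' v']; simpc; rewrite !rpE /=.
have := sqr_ge0 (a * u - u'); have := sqr_ge0 (a * v - v').
by nra.
Qed.

Lemma sobolev0 s : sobolev s (fun _ : torus => 0 : R).
Proof.
have [f0 Lf0 fc] : exists2 f, L2zero f & forall j, fcoef f j = (fun _ : Zn => 0 : R[i]) j.
  apply: riesz_fischer => //; first by move=> j; rewrite /= oppr0.
  by exists 0 => N; rewrite /psum big1// => j _; rewrite !rpE /= mulr0 addr0 normr0.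
have sf0 : sobolev s f0.
  apply/sobolevP; split=> //.
  by exists 0 => N; rewrite /psum big1// => j _; rewrite fc !rpE /= mulr0 addr0 mulr0 normr0.
rewrite (_ : (fun=> 0) = (fun x => (-1) * f0 x + f0 x)); first exact: sobolev_lincomb.
by apply/funext => x; rewrite mulN1r addNr.
Qed.

(** The defining set of pderiv is not empty, by Riesz-Fischer, so the choice made
    there is an actual derivative. *)
Lemma pderivP l f : sobolev 1 f -> L2zero (pderiv l f) /\
  forall j, fcoef (pderiv l f) j = (0 +i* (j 0 l)%:~R) * fcoef f j.
Proof.
move=> /sobolevP[f0 sf].
pose P := [set g | L2zero g /\
    forall j, fcoef g j = (0 +i* (j 0 l)%:~R) * fcoef f j].
suff : P (pderiv l f) by [].
have [g Lg gc] : exists2 g, L2zero g &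
    forall j, fcoef g j = (fun j : Zn => (0 +i* (j 0 l)%:~R) * fcoef f j) j.
  apply: riesz_fischer.
  - move=> j; rewrite fcoefN ?(L2zero_L2 f0)// mxE rmorphN /=.
    by case: (fcoef f j) => u v; simpc.
  - by rewrite L2zero_fcoef0// mulr0.
  - apply: summ_le sf => j _; rewrite ger0_norm ?rp_ge0//.
    by rewrite expr1 rp_imul ler_wpM2r ?rp_ge0// freq2_coord.
by apply: (@xgetI _ (cst 0 : torus -> R) P g); split.
Qed.

Lemma sobolev_pderiv l s f : sobolev s.+1 f -> sobolev s (pderiv l f).
Proof.
move=> sf; have [g0 gc] := pderivP l (sobolev_le (ltn0Sn s) sf).
have [_ sf'] := (sobolevP _ _).1 sf.
apply/sobolevP; split=> //; apply: summ_le sf' => j _.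
rewrite ger0_norm; last by rewrite mulr_ge0 ?exprn_ge0 ?freq2_ge0 ?rp_ge0.
rewrite exprSr -mulrA ler_wpM2l ?exprn_ge0 ?freq2_ge0//.
by rewrite gc rp_imul ler_wpM2r ?rp_ge0// freq2_coord.
Qed.

Lemma sobolev_sum s (I : Type) (r : seq I) (F : I -> torus -> R) :
  (forall i, sobolev s (F i)) -> sobolev s (fun x => \sum_(i <- r) F i x).
Proof.
move=> sF; elim: r => [|i r IH].
  by under eq_fun do rewrite big_nil; exact: sobolev0.
have := sobolev_lincomb 1 (sF i) IH.
by under eq_fun do rewrite mul1r -(big_cons _ _ _ _ xpredT (F^~ _)).
Qed.

Lemma fcoef_sum (I : Type) (r : seq I) (F : I -> torus -> R) j :
  (forall i, F i \in L2) ->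
  fcoef (fun x => \sum_(i <- r) F i x) j = \sum_(i <- r) fcoef (F i) j.
Proof.
move=> LF; elim: r => [|i r IH].
  rewrite big_nil; under eq_fun do rewrite big_nil.
  by rewrite fcoefE ?L2_0// !ip0l oppr0.
rewrite big_cons -IH -[X in X + _]mul1r -fcoef_lincomb//; last exact: L2_sum.
by congr fcoef; apply/funext => x; rewrite big_cons mul1r.
Qed.

Lemma sobolev_laplacian s f : sobolev s.+2 f -> sobolev s (laplacian f).
Proof. by move=> sf; apply: sobolev_sum => l; do 2 apply: sobolev_pderiv. Qed.

Lemma fcoef_laplacian f j : sobolev 2 f ->
  fcoef (laplacian f) j = (- freq2 R j)%:C * fcoef f j.
Proof.
move=> sf; have sl l := sobolev_pderiv l sf.
rewrite /laplacian fcoef_sum; last first.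
  by move=> l; have [/L2zero_L2] := pderivP l (sl l).
rewrite /freq2 -sumrN rmorph_sum mulr_suml; apply: eq_bigr => l _ /=.
have [_ ->] := pderivP l (sl l).
have [_ ->] := pderivP l (sobolev_le (isT : (1 <= 2)%N) sf).
by case: (fcoef f j) => u v; simpc; congr (_ +i* _); ring.
Qed.

Lemma iter_laplacian m s f : sobolev (m.*2 + s) f ->
  sobolev s (iter m (@laplacian R n) f) /\
  forall j, fcoef (iter m (@laplacian R n) f) j = ((- freq2 R j) ^+ m)%:C * fcoef f j.
Proof.
elim: m s => [|m IH] s sf; first by split=> // j; rewrite expr0 mul1r.
have sf' : sobolev (m.*2 + s.+2) f.
  by rewrite (_ : m.*2 + s.+2 = m.+1.*2 + s)%N// doubleS !addnS !addSn.
have [sm mc] := IH _ sf'.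
split=> [|j]; first exact: sobolev_laplacian.
rewrite iterS fcoef_laplacian; last exact: sobolev_le sm.
by rewrite mc mulrA -rmorphM -exprS.
Qed.

Lemma summ_sum (I : Type) (r : seq I) (F : I -> Zn -> R) :
  (forall i, summ (F i)) -> summ (fun j => \sum_(i <- r) F i j).
Proof.
move=> sF; elim: r => [|i r IH].
  by exists 0 => N; rewrite /psum big1// => j _; rewrite big_nil normr0.
by under eq_fun do rewrite big_cons; exact: summD.
Qed.

Lemma sumZ_sum (I : Type) (r : seq I) (F : I -> Zn -> R) :
  (forall i, summ (F i)) ->
  sumZ (fun j => \sum_(i <- r) F i j) = \sum_(i <- r) sumZ (F i).
Proof.
move=> sF; elim: r => [|i r IH].
  rewrite [RHS]big_nil; apply: etrans (sumZ0 R n).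
  by apply: eq_sumZ => j _; rewrite big_nil.
rewrite big_cons -IH -sumZD//; last exact: summ_sum.
by apply: eq_sumZ => j _; rewrite big_cons.
Qed.

(** Cauchy-Schwarz at each mode: the geometric mean of the weights of f and g
    dominates the weight of the product. *)
Lemma summ_weighted_rp (s t q : nat) f g : (q.*2 <= s + t)%N ->
  sobolev s f -> sobolev t g ->
  summ (fun j => freq2 R j ^+ q * rp (fcoef f j) (fcoef g j)).
Proof.
move=> qst /sobolevP[_ sf] /sobolevP[_ sg].
apply: summ_le (summD sf sg) => j j0.
have f1 := freq2_ge1 j0; have f0 := freq2_ge0 j.
set a := fcoef f j; set b := fcoef g j.
rewrite normrM ger0_norm ?exprn_ge0// -(ler_pXn2r (n := 2))//; last 2 first.
- by rewrite nnegrE mulr_ge0 ?exprn_ge0.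
- by rewrite nnegrE addr_ge0 ?mulr_ge0 ?exprn_ge0 ?rp_ge0.
rewrite exprMn -exprM muln2 real_normK ?num_real//.
apply: (@le_trans _ _ ((freq2 R j ^+ s * rp a a) * (freq2 R j ^+ t * rp b b))).
  rewrite mulrACA -exprD; apply: ler_pM.
  - by rewrite exprn_ge0.
  - by rewrite sqr_ge0.
  - exact: ler_weXn2l.
  - exact: rp_CauchySchwarz.
set p := _ * rp a a; set r := _ * rp b b.
have p0 : 0 <= p by rewrite mulr_ge0 ?exprn_ge0 ?rp_ge0.
have r0 : 0 <= r by rewrite mulr_ge0 ?exprn_ge0 ?rp_ge0.
by rewrite expr2; nra.
Qed.

(** Parseval: m Laplacians give the multiplier (- |j|^2)^m on each factor, and for
    odd k the sum over l of the squares of the coordinates of j gives one more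
    |j|^2. *)
Lemma nabla_dotE (k : nat) f g : sobolev k f -> sobolev k g ->
  nabla_dot k f g = sumZ (fun j => freq2 R j ^+ k * rp (fcoef f j) (fcoef g j)).
Proof.
move=> skf skg.
have sfg : summ (fun j => freq2 R j ^+ k * rp (fcoef f j) (fcoef g j)).
  by apply: (summ_weighted_rp (s := k) (t := k)) => //; rewrite addnn.
move: skf skg; rewrite -{1 2}(odd_double_half k) addnC => sf sg.
have [sf' fc] := iter_laplacian sf; have [sg' gc] := iter_laplacian sg.
rewrite /nabla_dot; set m := k./2 in sf' fc sg' gc *.
have kE : k = (odd k + m.*2)%N by rewrite odd_double_half.
have freqE j : freq2 R j ^+ k = freq2 R j ^+ odd k * ((- freq2 R j) ^+ m) ^+ 2.
  by rewrite {1}kE exprD exprAC sqrrN -exprM mul2n.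
case: (odd k) in kE sf' sg' freqE *; last first.
  rewrite -[LHS]/(ip (iter m (@laplacian R n) f) (iter m (@laplacian R n) g)).
  rewrite (parseval (sobolev_L2zero sf') (L2zero_L2 (sobolev_L2zero sg'))).
  by apply: eq_sumZ => j _; rewrite fc gc freqE mul1r rp_scale.
rewrite (eq_bigr (fun l : 'I_n => sumZ (fun j => (j 0 l)%:~R ^+ 2 *
   (((- freq2 R j) ^+ m) ^+ 2 * rp (fcoef f j) (fcoef g j))))); last first.
  move=> l _; have [[p0 pc] [q0 qc]] := (pderivP l sf', pderivP l sg').
  rewrite -[LHS]/(ip (pderiv l _) (pderiv l _)).
  rewrite (parseval p0 (L2zero_L2 q0)); apply: eq_sumZ => j _.
  by rewrite pc qc fc gc rp_imul rp_scale.
rewrite -sumZ_sum.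
  apply: eq_sumZ => j _; rewrite -mulr_suml -/(freq2 R j) freqE expr1.
  by rewrite mulrA.
move=> l; apply: summ_le (summ_abs sfg) => j _.
rewrite freqE expr1 -mulrA; set Q := _ ^+ 2 * rp _ _.
rewrite (normrM (freq2 R j)) normrM; apply: ler_wpM2r (normr_ge0 _) _ _ _.
rewrite !ger0_norm ?sqr_ge0 ?freq2_ge0//.
exact: freq2_coord.
Qed.

End sobolev_spaces.

(** * Quadratic forms on the phase space *)

(** One coefficient function for both components: false selects u, true
    selects v. *)
Definition cf (R : realType) (n : nat) (a : bool) (w : state R n) (j : 'rV[int]_n)
  : R[i] := fcoef (if a then w.2 else w.1) j.

(** All the functionals of the problem are polynomials in these forms, for a few
    multipliers m.  Sealed like the lattice sum it contains. *)
HB.lock Definition form (R : realType) (n : nat) (m : R -> R) (a b : bool)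
    (z z' : state R n) : R :=
  sumZ (fun k => m (freq2 R k) * rp (cf a z k) (cf b z' k)).

Section phase_space_forms.
Variables (R : realType) (n : nat).
Local Notation Zn := 'rV[int]_n.
Local Notation state := (state R n).
Implicit Types (nu mu : R) (j k : Zn) (w z h : state) (m : R -> R) (a b : bool).

Lemma inH_L2 s w : inH s w ->
  (w.1 \in Lfun (torus_measure R n) 2%:E) /\ (w.2 \in Lfun (torus_measure R n) 2%:E).
Proof.
by move=> [/sobolev_L2zero/L2zero_L2 ? /sobolev_L2zero/L2zero_L2 ?].
Qed.

Lemma inH_le s t w : (s <= t)%N -> inH t w -> inH s w.
Proof.
move=> st [w1 w2]; split; first exact: sobolev_le w1.
by apply: sobolev_le w2; rewrite -!subn1 leq_sub2r.
Qed.

Lemma inH_lincomb s (c : R) h1 h2 : inH s h1 -> inH s h2 -> inH s (c *: h1 + h2).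
Proof.
by move=> [a1 b1] [a2 b2]; split; [exact: sobolev_lincomb a1 a2|exact: sobolev_lincomb b1 b2].
Qed.

Lemma inH0 s : inH s (0 : state).
Proof. by split; exact: sobolev0. Qed.

Lemma inHD s h1 h2 : inH s h1 -> inH s h2 -> inH s (h1 + h2).
Proof. by move=> H1 H2; have := inH_lincomb 1 H1 H2; rewrite scale1r; exact. Qed.

Lemma inHZ s (c : R) h1 : inH s h1 -> inH s (c *: h1).
Proof. by move=> H1; have := inH_lincomb c H1 (inH0 s); rewrite addr0; exact. Qed.

Lemma cf_lincomb s (c : R) h1 h2 a j : inH s h1 -> inH s h2 ->
  cf a (c *: h1 + h2) j = c%:C * cf a h1 j + cf a h2 j.
Proof.
move=> /inH_L2[p1 q1] /inH_L2[p2 q2]; rewrite /cf.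
by case: a; rewrite -fcoef_lincomb.
Qed.

Lemma cfN s w a j : inH s w -> cf a w (- j) = conjc (cf a w j).
Proof. by move=> /inH_L2[p q]; rewrite /cf; case: a; rewrite fcoefN. Qed.

Lemma formE m a b z z' :
  form m a b z z' = sumZ (fun k => m (freq2 R k) * rp (cf a z k) (cf b z' k)).
Proof. by rewrite form.unlock. Qed.

(** The weight carried by each component in the norm of H^1. *)
Definition wt a (nu : R) : R := if a then 1 else nu.

(** The multipliers for which the form is continuous on H^1: a pair of u's carries
    the weight nu, while v is only square summable. *)
Definition adm (M : R) a b m := 0 <= M /\
  forall nu, Lambda n nu -> `|m nu| <= M * (if a || b then 1 else nu).

Let E a z j : R := wt a (freq2 R j) * rp (cf a z j) (cf a z j).

Let E_ge0 a z j : 0 <= E a z j.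
Proof. by rewrite mulr_ge0 ?rp_ge0//; case: a => //=; exact: freq2_ge0. Qed.

Let summE a z : inH 1 z -> summ (E a z).
Proof.
move=> [/sobolevP[_ s1] /sobolevP[_ s2]]; case: a.
  by apply: summ_le s2 => j _; rewrite ger0_norm ?E_ge0// /E /= expr0.
by apply: summ_le s1 => j _; rewrite ger0_norm ?E_ge0// /E /= expr1.
Qed.

Lemma HnormE z : inH 1 z -> Hnorm 1 z ^+ 2 = sumZ (E false z) + sumZ (E true z).
Proof.
move=> Hz; have [s1 s2] := Hz.
have e1 : sobolev_sqnorm 1 z.1 = sumZ (E false z).
  by rewrite sobolev_sqnormE//; apply: eq_sumZ => j _; rewrite /E /= expr1.
have e2 : sobolev_sqnorm 0 z.2 = sumZ (E true z).
  by rewrite sobolev_sqnormE//; apply: eq_sumZ => j _; rewrite /E /= expr0.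
rewrite /Hnorm e1 [sobolev_sqnorm _ _]e2 sqr_sqrtr//; apply: addr_ge0.
  exact: sumZ_ge0 (summE false Hz) (fun j _ => E_ge0 false z j).
exact: sumZ_ge0 (summE true Hz) (fun j _ => E_ge0 true z j).
Qed.

Lemma Hnorm_ge0 s z : 0 <= Hnorm s z. Proof. exact: sqrtr_ge0. Qed.

Let sqrtE_le a z : inH 1 z -> Num.sqrt (sumZ (E a z)) <= Hnorm 1 z.
Proof.
move=> Hz; rewrite -(ler_pXn2r (n := 2)) ?nnegrE ?sqrtr_ge0 ?Hnorm_ge0// HnormE//.
have p0 : 0 <= sumZ (E false z).
  exact: sumZ_ge0 (summE false Hz) (fun j _ => E_ge0 false z j).
have q0 : 0 <= sumZ (E true z).
  exact: sumZ_ge0 (summE true Hz) (fun j _ => E_ge0 true z j).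
case: a; first by rewrite (sqr_sqrtr q0) lerDr.
by rewrite (sqr_sqrtr p0) lerDl.
Qed.

Let term_le M m a b z z' : adm M a b m -> forall j, j != 0 ->
  `|m (freq2 R j) * rp (cf a z j) (cf b z' j)| <=
  M * (Num.sqrt (E a z j) * Num.sqrt (E b z' j)).
Proof.
move=> [M0 mM] j j0; have Lj : Lambda n (freq2 R j) by exists j.
rewrite normrM; apply: le_trans (ler_wpM2r (normr_ge0 _) (mM _ Lj)) _.
rewrite -mulrA ler_wpM2l//.
set nu := freq2 R j; have nu1 : 1 <= nu by exact: freq2_ge1.
have l0 : 0 <= (if a || b then 1 else nu) * `|rp (cf a z j) (cf b z' j)|.
  by apply: mulr_ge0 => //; case: ifP => // _; apply: le_trans nu1.
have r0 : 0 <= Num.sqrt (E a z j) * Num.sqrt (E b z' j).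
  by apply: mulr_ge0; exact: sqrtr_ge0.
rewrite -(ler_pXn2r (n := 2))//.
rewrite !exprMn real_normK ?num_real// !sqr_sqrtr ?E_ge0//.
rewrite /E [leRHS]mulrACA; apply: ler_pM; rewrite ?sqr_ge0 ?rp_CauchySchwarz//.
rewrite /wt -/nu; clear mM l0 r0; case: a; case: b => /=;
  by rewrite ?expr1n ?mul1r ?mulr1 ?expr2.
Qed.

Let sqE a z : (fun j => Num.sqrt (E a z j) ^+ 2) = E a z.
Proof. by apply/funext => j; rewrite sqr_sqrtr ?E_ge0. Qed.

Lemma summ_form M m a b z z' : adm M a b m -> inH 1 z -> inH 1 z' ->
  summ (fun k => m (freq2 R k) * rp (cf a z k) (cf b z' k)).
Proof.
move=> mM Hz Hz'; apply: summ_le (term_le z z' mM) (summZ M _).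
by apply: summ_sqrM; rewrite sqE; exact: summE.
Qed.

(** At each mode the admissible weight is at most the geometric mean of the weights
    of the two components, so Cauchy-Schwarz applies to the sum. *)
Lemma form_le M m a b z z' : adm M a b m -> inH 1 z -> inH 1 z' ->
  `|form m a b z z'| <= M * (Hnorm 1 z * Hnorm 1 z').
Proof.
move=> mM Hz Hz'.
have sEE : summ (fun j => Num.sqrt (E a z j) * Num.sqrt (E b z' j)).
  by apply: summ_sqrM; rewrite sqE; exact: summE.
rewrite formE; have := le_norm_sumZ (summZ M sEE) (term_le z z' mM).
rewrite sumZZ// => H; apply: le_trans H _.
rewrite ler_wpM2l//; first by case: mM.
apply: le_trans (ler_norm _) _; apply: le_trans (sumZ_CauchySchwarz _ _) _.
- by rewrite sqE; exact: summE.
- by rewrite sqE; exact: summE.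
rewrite !sqE; apply: ler_pM; rewrite ?sqrtr_ge0//; exact: sqrtE_le.
Qed.

Lemma formDl M m a b (c : R) h1 h2 z : adm M a b m ->
  inH 1 h1 -> inH 1 h2 -> inH 1 z ->
  form m a b (c *: h1 + h2) z = c * form m a b h1 z + form m a b h2 z.
Proof.
move=> mM H1 H2 Hz.
rewrite !formE -(sumZZ _ (summ_form mM H1 Hz)) -sumZD; last 2 first.
- exact: summZ (summ_form mM H1 Hz).
- exact: summ_form mM H2 Hz.
apply: eq_sumZ => k _; rewrite (cf_lincomb _ _ _ H1 H2).
case: (cf a h1 k) (cf a h2 k) (cf b z k) => p q [p' q'] [p1 q1].
by simpc; rewrite !rpE /=; ring.
Qed.

Lemma formC m a b z z' : form m a b z z' = form m b a z' z.
Proof. by rewrite !formE; apply: eq_sumZ => k _; rewrite rpC. Qed.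

Lemma admC M m a b : adm M a b m -> adm M b a m.
Proof. by rewrite /adm orbC. Qed.

Lemma formDr M m a b (c : R) h1 h2 z : adm M a b m ->
  inH 1 h1 -> inH 1 h2 -> inH 1 z ->
  form m a b z (c *: h1 + h2) = c * form m a b z h1 + form m a b z h2.
Proof. by move=> /admC mM H1 H2 Hz; rewrite !(formC _ a) (formDl _ mM). Qed.

(** The divisor in the interaction of the frequencies nu and mu.  At mu = nu it
    vanishes, because division by zero is zero: sums over all mu automatically
    skip the term mu = nu. *)
Definition cc (nu mu : R) : R := nu * mu / (nu - mu).

Lemma ccC nu mu : cc nu mu = - cc mu nu.
Proof. by rewrite /cc -[mu - nu]opprB invrN mulrN opprK [mu * nu]mulrC. Qed.

Lemma cc_diag nu : cc nu nu = 0.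
Proof. by rewrite /cc subrr invr0 mulr0. Qed.

Lemma Lambda_dist nu mu : Lambda n nu -> Lambda n mu -> nu != mu -> 1 <= `|nu - mu|.
Proof.
move=> [j _ ->] [k _ ->]; rewrite !freq2E => jk.
have {}jk : nfreq j != nfreq k by apply: contra jk => /eqP ->.
have -> : (nfreq j)%:R - (nfreq k)%:R = ((nfreq j)%:Z - (nfreq k)%:Z)%:~R :> R.
  by rewrite rmorphB.
rewrite -intr_norm ler1z; lia.
Qed.

(** There are no small divisors, since distinct frequencies differ by at least
    one.  Two bounds are needed: the first is symmetric, the second trades the
    growth in mu for growth in nu by mu <= nu + |nu - mu|. *)
Lemma norm_cc nu mu : Lambda n nu -> Lambda n mu ->
  `|cc nu mu| <= nu * mu /\ `|cc nu mu| <= nu * (1 + nu).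
Proof.
move=> Ln Lm; have n1 := Lambda_gt0 Ln; have m1 := Lambda_gt0 Lm.
have [->|nm] := eqVneq nu mu.
  by rewrite cc_diag normr0; split; apply: mulr_ge0; lra.
have d1 := Lambda_dist Ln Lm nm.
have d0 : 0 < `|nu - mu| by lra.
have nm0 : 0 <= nu * mu by apply: mulr_ge0; lra.
rewrite /cc normrM normfV (ger0_norm nm0); split.
  by rewrite ler_pdivrMr// ler_peMr.
have dist : mu <= nu + `|nu - mu| by have := ler_norm (mu - nu); rewrite distrC; lra.
rewrite ler_pdivrMr// -mulrA ler_wpM2l; [by []|lra|].
by nra.
Qed.

Lemma adm_ind nu a b : adm 1 a b (ind nu).
Proof.
split=> // mu /Lambda_gt0 mu1; rewrite mul1r /ind.
by case: ifP => _; case: ifP => _; rewrite ?normr1 ?normr0//; lra.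
Qed.

Lemma adm_cc nu a b : Lambda n nu -> adm (nu * (1 + nu)) a b (cc nu).
Proof.
move=> Ln; have n1 := Lambda_gt0 Ln.
have p0 : 0 <= nu * (1 + nu) by apply: mulr_ge0; lra.
split=> // mu Lm; have m1 := Lambda_gt0 Lm.
apply: le_trans (norm_cc Ln Lm).2 _.
by case: ifP => _; rewrite ?mulr1// ler_peMr.
Qed.

Lemma adm_id : adm 1 false false id.
Proof.
by split=> // mu /Lambda_gt0 mu1; rewrite mul1r /= ger0_norm//; lra.
Qed.

End phase_space_forms.

(** * The first integrals in terms of quadratic forms *)

Section reduction.
Variables (R : realType) (n : nat).
Local Notation Zn := 'rV[int]_n.
Local Notation state := (state R n).
Local Notation Re := complex.Re.
Local Notation Im := complex.Im.
Local Notation normc := ComplexField.Normc.normc.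
Implicit Types (nu mu : R) (j k : Zn) (w z h : state) (m : R -> R) (a b : bool).

(* Im (u_j conj v_j) is odd in j, so it drops out of sums over symmetric sets. *)
Let tw w j : R := Im (cf false w j * conjc (cf true w j)).

(** The last product is odd in j and in k, so it will cancel over shells; what
    remains depends only on |u_j|^2, |v_j|^2 and Re (u_j conj v_j). *)
Lemma normc_wedge w j k : normc (wedge w j k) ^+ 2 =
  rp (cf false w j) (cf false w j) * rp (cf true w k) (cf true w k)
  + rp (cf true w j) (cf true w j) * rp (cf false w k) (cf false w k)
  - 2 * (rp (cf false w j) (cf true w j) * rp (cf false w k) (cf true w k))
  - 2 * (tw w j * tw w k).
Proof.
rewrite normc_sqr /wedge /tw /cf.
case: (fcoef w.1 j) (fcoef w.1 k) (fcoef w.2 j) (fcoef w.2 k) => a b [c d] [e f] [p q].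
by rewrite !rpE /=; ring.
Qed.

Let twN w j : inH 1 w -> tw w (- j) = - tw w j.
Proof.
move=> Hw; rewrite /tw !(cfN _ _ Hw).
by case: (cf false w j) (cf true w j) => a b [c d] /=; ring.
Qed.

Let sum_tw w m : inH 1 w -> sumZ (fun k => m (freq2 R k) * tw w k) = 0.
Proof.
move=> Hw; apply: sumZE; rewrite (_ : psum _ = fun=> 0); first exact: cvg_cst.
by apply/funext => N; apply: psum_odd => k; rewrite freq2N twN// mulrN.
Qed.

Let adm1 a b : @adm R n 1 a b (fun=> 1).
Proof.
split=> // mu /Lambda_gt0 mu1; rewrite mul1r normr1.
by case: ifP.
Qed.

Let summ_tw (M : R) w m : @adm R n M false true m -> inH 1 w ->
  summ (fun k => m (freq2 R k) * tw w k).
Proof.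
move=> [M0 mM] Hw.
have su := summ_form (adm1 false false) Hw Hw.
have sv := summ_form (adm1 true true) Hw Hw.
apply: summ_le (summZ M (summD su sv)) => k k0.
have Lk : Lambda n (freq2 R k) by exists k.
rewrite normrM ler_pM//; first by have := mM _ Lk; rewrite mulr1.
rewrite !mul1r /tw !rpE; case: (cf false w k) (cf true w k) => a b [c d] /=.
rewrite ler_norml; have := sqr_ge0 (a - d); have := sqr_ge0 (a + d).
have := sqr_ge0 (b - c); have := sqr_ge0 (b + c).
by move=> *; apply/andP; split; nra.
Qed.

(** Opening the square of the wedge product turns the sum over the other modes into
    forms with multiplier cc nu; the frequencies are grouped into shells, and the
    odd part sums to zero. *)
Lemma interaction_sum nu w j : Lambda n nu -> inH 1 w -> shell nu j ->
  abs_summable (Lambda n `\ nu) (interaction w nu j) /\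
  asum (Lambda n `\ nu) (interaction w nu j) =
    rp (cf false w j) (cf false w j) * form (cc nu) true true w w
    + rp (cf true w j) (cf true w j) * form (cc nu) false false w w
    - 2 * (rp (cf false w j) (cf true w j) * form (cc nu) false true w w).
Proof.
move=> Ln Hw [j0 jnu].
pose x k := rp (cf false w k) (cf false w k); pose y k := rp (cf true w k) (cf true w k).
pose z k := rp (cf false w k) (cf true w k); pose c k := cc nu (freq2 R k).
pose a k := x j * (c k * y k) + y j * (c k * x k) + (- (2 * z j)) * (c k * z k)
  + (- (2 * tw w j)) * (c k * tw w k).
have sy : summ (fun k => c k * y k) := summ_form (adm_cc true true Ln) Hw Hw.
have sx : summ (fun k => c k * x k) := summ_form (adm_cc false false Ln) Hw Hw.
have sz : summ (fun k => c k * z k) := summ_form (adm_cc false true Ln) Hw Hw.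
have st : summ (fun k => c k * tw w k) := summ_tw (adm_cc false true Ln) Hw.
have s1 := summD (summZ (x j) sy) (summZ (y j) sx).
have s2 := summD s1 (summZ (- (2 * z j)) sz).
have sa : summ a := summD s2 (summZ (- (2 * tw w j)) st).
have [||H1 H2] := @Lambda_sumD1 R n nu (interaction w nu j) a sa.
- rewrite /interaction fsbig1// => k _.
  by rewrite subrr invr0 mulr0 mul0r.
- move=> mu Lmu; apply: eq_fsbigr => k /set_mem[k0 kmu].
  by rewrite normc_wedge /a /c kmu /x /y /z /cc; ring.
split=> //; rewrite H2 !formE.
rewrite (sumZD s2 (summZ _ st)) (sumZD s1 (summZ _ sz)).
rewrite (sumZD (summZ _ sy) (summZ _ sx)) !sumZZ//.
by rewrite /c (sum_tw (cc nu) Hw) mulr0 addr0 mulNr -mulrA.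
Qed.

Lemma blockAE w : inH 1 w -> blockA w = (1 + form id false false w w)^-1.
Proof.
by move=> [s1 _]; rewrite formE /blockA /blockD nabla_dotE.
Qed.

Let form_shell nu a b w N : nu <= N%:R -> form (ind nu) a b w w =
  \sum_(j <- bl n N | freq2 R j == nu) rp (cf a w j) (cf b w j).
Proof. by move=> nuN; rewrite formE sumZ_ind (sum_shell _ nuN). Qed.

Lemma I1E nu w : Lambda n nu -> inH 1 w ->
  I1 nu w = blockA w * (nu * form (ind nu) false false w w)
    + form (ind nu) true true w w
    + form (ind nu) false false w w * form (cc nu) true true w w
    + form (ind nu) true true w w * form (cc nu) false false w w
    - 2 * (form (ind nu) false true w w * form (cc nu) false true w w).
Proof.
move=> Ln Hw; have [N nuN] := natP nu.
rewrite !(form_shell _ _ _ nuN) /I1.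
have -> : \sum_(j \in shell nu)
    (blockA w * nu * normc (fcoef w.1 j) ^+ 2 + normc (fcoef w.2 j) ^+ 2
     + asum (Lambda n `\ nu) (interaction w nu j)) =
  \sum_(j \in shell nu)
    (blockA w * nu * rp (cf false w j) (cf false w j) + rp (cf true w j) (cf true w j)
     + (rp (cf false w j) (cf false w j) * form (cc nu) true true w w
    + rp (cf true w j) (cf true w j) * form (cc nu) false false w w
    - 2 * (rp (cf false w j) (cf true w j) * form (cc nu) false true w w))).
  apply: eq_fsbigr => j /set_mem jnu.
  by rewrite (interaction_sum Ln Hw jnu).2 !normc_sqr.
rewrite (sum_shell _ nuN) big_split big_split sumrB big_split /=.
rewrite -!mulr_sumr -!mulr_suml; ring.
Qed.

(** A sum of squared wedge products over pairs is a Gram determinant (Lagrange's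
    identity). *)
Lemma I2E nu w : Lambda n nu -> inH 1 w ->
  I2 nu w = form (ind nu) false false w w * form (ind nu) true true w w
    - form (ind nu) false true w w ^+ 2.
Proof.
move=> Ln Hw; have [N nuN] := natP nu.
have t0 : \sum_(j <- bl n N | freq2 R j == nu) tw w j = 0.
  by rewrite -(sum_shell _ nuN) -sumZ_ind sum_tw.
rewrite !(form_shell _ _ _ nuN) /I2 (sum_shell _ nuN).
pose x k := rp (cf false w k) (cf false w k); pose y k := rp (cf true w k) (cf true w k).
pose z k := rp (cf false w k) (cf true w k).
rewrite -/x -/y -/z.
transitivity (2^-1 * \sum_(j <- bl n N | freq2 R j == nu)
   (x j * \sum_(k <- bl n N | freq2 R k == nu) y k
    + y j * \sum_(k <- bl n N | freq2 R k == nu) x k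
    - 2 * (z j * \sum_(k <- bl n N | freq2 R k == nu) z k))).
  congr (_ * _); apply: eq_bigr => j _; rewrite (sum_shell _ nuN).
  under eq_bigr do rewrite normc_wedge.
  rewrite sumrB sumrB big_split /= -!mulr_sumr t0 !mulr0 subr0.
  by rewrite -/x -/y -/z.
rewrite sumrB big_split /= -!mulr_sumr -!mulr_suml.
move: (\sum_(j <- _ | _) x j) (\sum_(j <- _ | _) y j) (\sum_(j <- _ | _) z j) => X Y Z.
by field.
Qed.

End reduction.

(** * Multilinear forms on sequences of states *)

(* Conversion must not unfold norms and Fourier coefficients to integrals. *)
#[local] Opaque Hnorm fcoef.

Section multilinear.
Variables (R : realType) (n : nat).
Local Notation state := (state R n).
Implicit Types (w h : state) (z : nat -> state) (m d : nat) (C r : R).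

(** Multilinear forms are handled on infinite sequences of states, of which an
    m-linear form reads the first m terms; this avoids casts between 'I_m and
    'I_(d + m) in products. *)
Definition upd z i h : nat -> state := fun p => if p == i then h else z p.

Definition nml m (L : (nat -> state) -> R) C : Prop :=
  (forall z i (c : R) h1 h2, (i < m)%N -> (forall p, inH 1 (z p)) ->
     inH 1 h1 -> inH 1 h2 ->
     L (upd z i (c *: h1 + h2)) = c * L (upd z i h1) + L (upd z i h2)) /\
  (forall z, (forall p, inH 1 (z p)) ->
     `|L z| <= C * \prod_(p < m) Hnorm 1 (z p)).

Definition reads m (L : (nat -> state) -> R) : Prop :=
  forall z z', (forall p, (p < m)%N -> z p = z' p) -> L z = L z'.

Lemma prod_Hnorm_ge0 m z : 0 <= \prod_(p < m) Hnorm 1 (z p).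
Proof. by apply: prodr_ge0 => p _; exact: Hnorm_ge0. Qed.

Lemma nml_bound m L C C' : C <= C' -> nml m L C -> nml m L C'.
Proof.
move=> CC' [L1 L2]; split=> // z Hz; apply: le_trans (L2 z Hz) _.
by rewrite ler_wpM2r// prod_Hnorm_ge0.
Qed.

Lemma nml0 m C : 0 <= C -> nml m (fun=> 0) C.
Proof.
move=> C0; split=> [*|z _]; first by rewrite mulr0 addr0.
by rewrite normr0 mulr_ge0 ?prod_Hnorm_ge0.
Qed.

Lemma nml_cst (c : R) : nml 0 (fun=> c) `|c|.
Proof. by split=> // z _; rewrite big_ord0 mulr1. Qed.

Lemma nmlD m L L' C C' : nml m L C -> nml m L' C' ->
  nml m (fun z => L z + L' z) (C + C').
Proof.
move=> [L1 L2] [L1' L2']; split=> [z i c h1 h2 im Hz H1 H2|z Hz].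
  by rewrite L1// L1'//; ring.
by apply: le_trans (ler_normD _ _) _; rewrite mulrDl lerD ?L2 ?L2'.
Qed.

Lemma nmlZ m L C (c : R) : nml m L C -> nml m (fun z => c * L z) (`|c| * C).
Proof.
move=> [L1 L2]; split=> [z i a h1 h2 im Hz H1 H2|z Hz]; first by rewrite L1//; ring.
by rewrite normrM -mulrA ler_wpM2l ?L2.
Qed.

Definition shift d z : nat -> state := fun p => z (d + p)%N.

(** The product puts the arguments of B first and those of L after them; reads
    guarantees that B is insensitive to the arguments of L. *)
Lemma nmlM d m B L K C : reads d B -> 0 <= K -> nml d B K -> nml m L C ->
  nml (d + m) (fun z => B z * L (shift d z)) (K * C).
Proof.
move=> rB K0 [B1 B2] [L1 L2]; split=> [z i c h1 h2 im Hz H1 H2|z Hz].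
  have [id|di] := ltnP i d.
    have sh h : shift d (upd z i h) = shift d z.
      apply/funext => p; rewrite /shift /upd.
      by case: eqP => // dpi; move: id; rewrite -dpi ltnNge leq_addr.
    by rewrite 3!sh B1// mulrDl mulrA.
  have Bz h : B (upd z i h) = B z.
    apply: rB => p pd; rewrite /upd; case: eqP => // pi.
    by move: pd; rewrite pi ltnNge di.
  have sh h : shift d (upd z i h) = upd (shift d z) (i - d)%N h.
    apply/funext => p; rewrite /shift /upd; congr (if _ then _ else _).
    by rewrite -[in RHS](eqn_add2l d) subnKC.
  rewrite 3!sh 3!Bz.
  have imd : (i - d < m)%N by rewrite ltn_subLR.
  have Hs p : inH 1 (shift d z p) by exact: Hz.
  rewrite (L1 _ _ c h1 h2 imd Hs H1 H2).
  by rewrite mulrDr mulrCA.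
rewrite normrM big_split_ord /= mulrACA; apply: ler_pM => //.
  exact: B2 z Hz.
exact: L2 (shift d z) (fun p => Hz (d + p)%N).
Qed.

Lemma reads_shift d m B L : reads d B -> reads m L ->
  reads (d + m) (fun z => B z * L (shift d z)).
Proof.
move=> rB rL z z' zz'; congr (_ * _).
  by apply: rB => p pd; apply: zz'; rewrite (leq_trans pd)// leq_addr.
by apply: rL => p pm; apply: zz'; rewrite ltn_add2l.
Qed.

(** Terms that an m-linear form does not read are filled with the zero state. *)
Definition extend m (z : 'I_m -> state) : nat -> state :=
  fun p => if insub p is Some i then z i else 0.

Lemma nml_bounded m L C : nml m L C ->
  bounded_multilinear (fun z : 'I_m -> state => L (extend z)) C.
Proof.
move=> [L1 L2].
have Hext (z : 'I_m -> state) : (forall p, inH 1 (z p)) -> forall p, inH 1 (extend z p).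
  by move=> Hz p; rewrite /extend; case: insub => // *; exact: inH0.
have ext_upd (z : 'I_m -> state) i h :
    extend (@dfwith 'I_m (fun=> state) z i h) = upd (extend z) i h.
  apply/funext => p; rewrite /extend /upd; case: insubP => [q _ qp|].
    have [qi|qi] := eqVneq q i; first by rewrite -qp qi eqxx dfwithin.
    have -> : (p == i) = false.
      by rewrite -qp -[nat_of_ord i]/(val i) (inj_eq val_inj); exact/negbTE.
    by rewrite dfwithout// eq_sym.
  by case: eqP => // ->; rewrite ltn_ord.
split=> [z i a h1 h2 Hz H1 H2|z Hz].
  rewrite (ext_upd z i (a *: h1 + h2)) (ext_upd z i h1) (ext_upd z i h2).
  exact: (L1 (extend z) i a h1 h2 (ltn_ord i) (Hext z Hz) H1 H2).
have extE (p : 'I_m) : extend z p = z p by rewrite /extend valK.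
have E : \prod_(p < m) Hnorm 1 (extend z p) = \prod_(p < m) Hnorm 1 (z p).
  by apply: eq_bigr => p _; rewrite extE.
rewrite -E; exact: (L2 (extend z) (Hext z Hz)).
Qed.

Lemma nml_form (M : R) (m : R -> R) a b : adm n M a b m ->
  nml 2 (fun z => form m a b (z 0) (z 1)) M.
Proof.
move=> mM; split=> [z i c h1 h2 i2 Hz H1 H2|z Hz]; last first.
  rewrite big_ord_recl big_ord1.
  exact: (form_le mM (Hz 0%N) (Hz 1%N)).
case: i i2 => [|[|//]] _; rewrite /upd /=.
  exact: (formDl c mM H1 H2 (Hz 1%N)).
exact: (formDr c mM H1 H2 (Hz 0%N)).
Qed.

Lemma reads_form (m : R -> R) a b : reads 2 (fun z => form m a b (z 0) (z 1)).
Proof. by move=> z z' zz'; rewrite !zz'. Qed.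

(** The differential at w of the quadratic functional. *)
Definition polar (m : R -> R) a b w h : R := form m a b w h + form m a b h w.

Lemma nml_polar (M : R) (m : R -> R) a b w : adm n M a b m -> inH 1 w ->
  nml 1 (fun z => polar m a b w (z 0)) (2 * M * Hnorm 1 w).
Proof.
move=> mM Hw; split=> [z i c h1 h2 i1 Hz H1 H2|z Hz].
  case: i i1 => [|//] _; rewrite /upd /polar /=.
  by rewrite (formDl _ mM)// (formDr _ mM)//; ring.
rewrite big_ord1; apply: le_trans (ler_normD _ _) _.
apply: le_trans (lerD (form_le mM Hw (Hz 0%N)) (form_le mM (Hz 0%N) Hw)) _.
have -> : z (nat_of_ord (ord0 : 'I_1)) = z 0%N by [].
by move: (Hnorm 1 w) (Hnorm 1 (z 0%N)) => A B; lra.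
Qed.

Lemma reads_polar (m : R -> R) a b w : reads 1 (fun z => polar m a b w (z 0)).
Proof. by move=> z z' zz'; rewrite zz'. Qed.

Lemma form_line (M : R) (m : R -> R) a b w h : adm n M a b m -> inH 1 w -> inH 1 h ->
  form m a b (w + h) (w + h) = form m a b w w + polar m a b w h + form m a b h h.
Proof.
move=> mM Hw Hh; have Hwh := inHD Hw Hh.
have E : w + h = 1 *: w + h by rewrite scale1r.
rewrite {1}E (formDl 1 mM Hw Hh Hwh) E (formDr 1 mM Hw Hh Hw) (formDr 1 mM Hw Hh Hh).
by rewrite /polar; ring.
Qed.

End multilinear.

(** * Power series on balls of H^1 *)

Section power_series.
Variables (R : realType) (n : nat).
Local Notation state := (state R n).
Implicit Types (w h : state) (z : nat -> state) (m d : nat) (C r : R) (F : state -> R).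

(** The geometric bound on the m-th term is what survives multiplication by a
    quadratic form: products only change the constant C, not the radius. *)
Definition power_series r C F : Prop :=
  0 <= C /\ exists L : nat -> (nat -> state) -> R,
    (forall m, nml m (L m) (C / r ^+ m) /\ reads m (L m)) /\
    forall h, inH 1 h -> Hnorm 1 h < r ->
      series (fun m => L m (fun=> h)) @ \oo --> F h.

Lemma power_series_analytic (P : state -> R) :
  (forall w, inH 1 w -> exists r C, 0 < r /\ power_series r C (fun h => P (w + h))) ->
  analytic P.
Proof.
move=> H w /H[r [C [r0 [C0 [L [L1 L2]]]]]].
exists (fun m (z : 'I_m -> state) => L m (extend z)), C, r; split=> //.
  by move=> m; apply: nml_bounded; have [] := L1 m.
move=> h Hh hr; have := L2 h Hh hr.
suff -> : (fun m => L m (extend (fun _ : 'I_m => h))) = (fun m => L m (fun=> h)) by [].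
apply/funext => m; have [_ rL] := L1 m.
by apply: rL => p pm; rewrite /extend insubT.
Qed.

Lemma eq_power_series r C F F' : (forall h, inH 1 h -> F h = F' h) ->
  power_series r C F -> power_series r C F'.
Proof.
move=> FF' [C0 [L [L1 L2]]]; split=> //; exists L; split=> // h Hh hr.
by rewrite -FF'//; exact: L2.
Qed.

Lemma power_seriesD r C C' F F' : power_series r C F -> power_series r C' F' ->
  power_series r (C + C') (fun h => F h + F' h).
Proof.
move=> [C0 [L [L1 L2]]] [C0' [L' [L1' L2']]]; split; first exact: addr_ge0.
exists (fun m z => L m z + L' m z); split=> [m|h Hh hr].
  have [[n1 r1] [n2 r2]] := (L1 m, L1' m).
  split; first by rewrite mulrDl; exact: nmlD.
  by move=> z z' zz'; rewrite (r1 z z' zz') (r2 z z' zz').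
have -> : series (fun m => L m (fun=> h) + L' m (fun=> h)) =
   series (fun m => L m (fun=> h)) + series (fun m => L' m (fun=> h)).
  by apply/funext => N; rewrite /series /= big_split.
by apply: cvgD; [exact: L2|exact: L2'].
Qed.

Lemma power_seriesZ r C F (c : R) : power_series r C F ->
  power_series r (`|c| * C) (fun h => c * F h).
Proof.
move=> [C0 [L [L1 L2]]]; split; first exact: mulr_ge0.
exists (fun m z => c * L m z); split=> [m|h Hh hr].
  have [n1 r1] := L1 m.
  split; first by rewrite -mulrA; exact: nmlZ.
  by move=> z z' zz'; rewrite (r1 z z' zz').
have -> : series (fun m => c * L m (fun=> h)) =
   fun N => c * series (fun m => L m (fun=> h)) N.
  by apply/funext => N; rewrite /series /= mulr_sumr.
by apply: cvgM; [exact: cvg_cst|exact: L2].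
Qed.

Lemma power_series_cst r (c : R) : 0 < r -> power_series r `|c| (fun=> c).
Proof.
move=> r0; split=> //.
exists (fun m _ => if m is 0%N then c else 0); split=> [[|m]|h Hh hr].
- by rewrite expr0 divr1; split=> //; exact: nml_cst.
- split=> //; apply: nml0; apply: divr_ge0 => //.
  by rewrite exprn_ge0// ltW.
apply: cvg_near_cst; exists 1%N => // N /= N1.
by rewrite /series /= big_ltn// big1_seq ?addr0// => -[|m] //; rewrite mem_index_iota.
Qed.

(** Multiplication by a d-linear form shifts the series by d terms; the factor
    r ^ d restores the normalization of the bounds. *)
Lemma power_series_mul r C F d B K : 0 < r -> 0 <= K -> reads d B -> nml d B K ->
  power_series r C F -> power_series r (K * C * r ^+ d) (fun h => B (fun=> h) * F h).
Proof.
move=> r0 K0 rB nB [C0 [L [L1 L2]]].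
have r0' m : 0 <= r ^+ m by rewrite exprn_ge0 ?ltW.
split; first by rewrite !mulr_ge0.
exists (fun m z => if (m < d)%N then 0 else B z * L (m - d)%N (shift d z)).
split=> [m|h Hh hr].
  case: ltnP => md.
    by split=> //; apply: nml0; apply: divr_ge0 => //; rewrite !mulr_ge0.
  have [nL rL] := L1 (m - d)%N.
  split; last by have := reads_shift rB rL; rewrite subnKC.
  have := nmlM rB K0 nB nL; rewrite subnKC//; apply: nml_bound.
  rewrite -{2}(subnKC md) exprD invfM -!mulrA.
  by rewrite [r ^+ d * _]mulrA mulfV ?mul1r// expf_neq0 ?gt_eqF.
rewrite -(cvg_shiftn d) /=.
rewrite (_ : (fun N => _) = fun N => B (fun=> h) * series (fun m => L m (fun=> h)) N).
  by apply: cvgM; [exact: cvg_cst|exact: L2].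
apply/funext => N; rewrite /series /= (@big_cat_nat _ _ _ d)//= ?leq_addl//.
rewrite big_nat big1 ?add0r; last by move=> k /andP[_ ->].
rewrite -{1}[d]add0n big_addn addnK mulr_sumr; apply: eq_bigr => k _.
by rewrite ltnNge leq_addl /= addnK.
Qed.

(** Around w a quadratic form is a constant, plus a linear form, plus a quadratic
    form, and each of the three multiplies the series. *)
Lemma power_series_form r C F (M : R) (m : R -> R) a b w : 0 < r ->
  adm n M a b m -> inH 1 w -> power_series r C F ->
  exists C', power_series r C' (fun h => F h * form m a b (w + h) (w + h)).
Proof.
move=> r0 mM Hw FC; have M0 : 0 <= M by case: mM.
have K0 : 0 <= 2 * M * Hnorm 1 w by rewrite !mulr_ge0 ?Hnorm_ge0.
have p1 := power_seriesZ (form m a b w w) FC.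
have p2 := power_series_mul r0 K0 (reads_polar (n := n) m a b w) (nml_polar mM Hw) FC.
have p3 := power_series_mul r0 M0 (reads_form (n := n) m a b) (nml_form mM) FC.
eexists; apply: eq_power_series (power_seriesD (power_seriesD p1 p2) p3) => h Hh.
by rewrite (form_line mM Hw Hh); ring.
Qed.

Lemma form_id_ge0 h : inH 1 h -> 0 <= form id false false h h.
Proof.
move=> Hh; rewrite formE; apply: sumZ_ge0; first exact: (summ_form (adm_id R n) Hh Hh).
by move=> j _; apply: mulr_ge0; [exact: freq2_ge0|exact: rp_ge0].
Qed.

(** The power series of A = 1 / (1 + D_1) around w is given by a recursion:
    D_1 (w + h) = D_1 w + l h + q h with l linear and q quadratic, so the
    homogeneous terms A_m of A satisfy
    (1 + D_1 w) A_(m+2) + l A_(m+1) + q A_m = 0. *)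
Section inverse.
Variable w : state.
Hypothesis Hw : inH 1 w.

Let a0 : R := 1 + form id false false w w.
Let l h : R := polar id false false w h.
Let q (h h' : state) : R := form id false false h h'.

Fixpoint inv_term m : (nat -> state) -> R :=
  match m with
  | 0 => fun=> a0^-1
  | m'.+1 => fun z => - a0^-1 * (l (z 0) * inv_term m' (shift 1 z)
      + match m' with
        | 0 => 0
        | m''.+1 => q (z 0) (z 1) * inv_term m'' (shift 2 z)
        end)
  end.

Let a1 : 1 <= a0. Proof. by rewrite lerDl form_id_ge0. Qed.

(* With t = 1 / r0 the linear form l has norm at most t - 1, and the bounds t^m
   are compatible with the recursion because (t - 1) t + 1 <= t^2. *)
Let r0 : R := (2 * Hnorm 1 w + 1)^-1.

Let D0 : 0 < 2 * Hnorm 1 w + 1.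
Proof. by have := Hnorm_ge0 1 w; move: (Hnorm 1 w) => x; lra. Qed.

Lemma inv_radius_gt0 : 0 < r0. Proof. by rewrite invr_gt0. Qed.

Let r0_le1 : r0 <= 1.
Proof. by rewrite invf_le1//; have := Hnorm_ge0 1 w; move: (Hnorm 1 w) => x; lra. Qed.

Let inv_termP m : nml m (inv_term m) (1 / r0 ^+ m) /\ reads m (inv_term m).
Proof.
have rp := inv_radius_gt0.
have ai0 : 0 < a0^-1 by rewrite invr_gt0 (lt_le_trans ltr01).
have ai1 : a0^-1 <= 1 by rewrite invf_le1// (lt_le_trans ltr01).
suff H : (nml m (inv_term m) (1 / r0 ^+ m) /\ reads m (inv_term m)) /\
   (nml m.+1 (inv_term m.+1) (1 / r0 ^+ m.+1) /\ reads m.+1 (inv_term m.+1)).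
  by case: H.
have nl : nml 1 (fun z => l (z 0)) (2 * Hnorm 1 w).
  by have := nml_polar (adm_id R n) Hw; rewrite mulr1.
have nq : nml 2 (fun z => q (z 0) (z 1)) 1 := nml_form (adm_id R n).
have rl : reads 1 (fun z => l (z 0)) by exact: reads_polar.
have rq : reads 2 (fun z => q (z 0) (z 1)) by exact: reads_form.
have l0 : 0 <= 2 * Hnorm 1 w by rewrite mulr_ge0 ?Hnorm_ge0.
have wr : 2 * Hnorm 1 w = r0^-1 - 1 by rewrite /r0 invrK addrK.
elim: m => [|m [[n1 r1] [n2 r2]]].
  split; first split=> //.
    apply: nml_bound (nml_cst n _); by rewrite expr0 divr1 ger0_norm//; exact: ltW.
  split; last by move=> z z' zz' /=; rewrite zz'.
  rewrite /=; split=> [z i c h1 h2 i1 Hz H1 H2|z Hz].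
    have [E _] := nl; rewrite !addr0 (E z i c h1 h2 i1 Hz H1 H2).
    by move: (l _) (l _) => p p'; ring.
  rewrite addr0 normrM normrN (ger0_norm (ltW ai0)) normrM (ger0_norm (ltW ai0)).
  have [_ /(_ z Hz)] := nl; have := prod_Hnorm_ge0 1 z.
  rewrite wr expr1 div1r; move: (\prod_(p < 1) _) `|l (z 0)| (normr_ge0 (l (z 0))).
  move=> P L L0 P0 LP; apply: (@le_trans _ _ L).
    by rewrite mulrCA ler_piMr// mulr_ile1// ltW.
  by apply: le_trans LP _; rewrite ler_wpM2r// lerBlDr lerDl.
split=> //; split.
  have N1 := nmlM rl l0 nl n2; have N2 := nmlM rq ler01 nq n1.
  have := nmlZ (- a0^-1) (nmlD N1 N2); apply: nml_bound.
  have t1 : 1 <= r0^-1 by rewrite invf_ge1.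
  rewrite normrN (ger0_norm (ltW ai0)) wr !div1r !exprS !invfM.
  have s0 : 0 < (r0 ^+ m)^-1 by rewrite invr_gt0 exprn_gt0.
  move: (r0^-1) (r0 ^+ m)^-1 t1 s0 => t s t1 s0.
  apply: (@le_trans _ _ ((t - 1) * (t * s) + s)).
    apply: ler_piMl => //; apply: addr_ge0; last exact: ltW.
    by rewrite !mulr_ge0 ?subr_ge0// ltW// (lt_le_trans ltr01).
  by rewrite -subr_ge0 (_ : _ - _ = (t - 1) * s); [rewrite mulr_ge0 ?subr_ge0// ltW|ring].
move=> z z' zz'; have E1 := reads_shift rl r2 zz'; have E2 := reads_shift rq r1 zz'.
by rewrite -[LHS]/(- a0^-1 * (l (z 0) * inv_term m.+1 (shift 1 z)
  + q (z 0) (z 1) * inv_term m (shift 2 z))) E1 E2.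
Qed.

(** Summing the recursion telescopes: (a0 + l h + q h) times a partial sum is 1
    plus terms which tend to zero together with the general term. *)
Lemma power_series_inv :
  power_series r0 1 (fun h => (1 + form id false false (w + h) (w + h))^-1).
Proof.
split=> //; exists inv_term; split; first exact: inv_termP.
move=> h Hh hr.
have rp := inv_radius_gt0.
pose u m := inv_term m (fun=> h).
pose x := l h; pose y := q h h.
have den : 1 + form id false false (w + h) (w + h) = a0 + x + y.
  by rewrite (form_line (adm_id R n) Hw Hh) /a0 /x /y /l /q !addrA.
have den1 : 1 <= a0 + x + y.
  by rewrite -den lerDl; exact: form_id_ge0 (inHD Hw Hh).
have a00 : a0 != 0 by rewrite gt_eqF// (lt_le_trans ltr01).
have rec m : a0 * u m.+2 = - (x * u m.+1 + y * u m).
  by rewrite /u -[inv_term m.+2 _]/(- a0^-1 * (x * u m.+1 + y * u m)) mulrA mulrN mulfV// mulN1r.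
have rec0 : a0 * u 0%N = 1 by rewrite /u /= mulfV.
have rec1 : a0 * u 1%N = - (x * u 0%N).
  by rewrite /u /= addr0 mulrA mulrN mulfV// mulN1r.
have u0 : u @ \oo --> (0 : R).
  have rho : `|Hnorm 1 h / r0| < 1.
    by rewrite ger0_norm ?divr_ge0 ?Hnorm_ge0 ?ltW// ltr_pdivrMr// mul1r.
  have geo := cvg_geometric 1 rho.
  have ngeo : (fun m => - geometric 1 (Hnorm 1 h / r0) m) @ \oo --> (0 : R).
    by rewrite -[X in _ --> X]oppr0; exact: cvgN.
  apply: (squeeze_cvgr _ ngeo geo); apply: nearW => m.
  rewrite -ler_norml /= mul1r.
  have [[_ B] _] := inv_termP m; apply: le_trans (B _ (fun=> Hh)) _.
  by rewrite prodr_const card_ord expr_div_n mulrC div1r.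
rewrite den -[series _]/(series u); clear den.
move: (u) (x) (y) rec rec0 rec1 u0 den1 => {}u {}x {}y rec rec0 rec1 u0 den1.
have part N : (a0 + x + y) * series u N.+2 = 1 + (x * u N.+1 + y * (u N.+1 + u N)).
  elim: N => [|N IH].
    rewrite /series /= big_nat_recr//= big_nat1.
    transitivity (a0 * u 0%N + a0 * u 1%N + (x + y) * (u 0%N + u 1%N)); first by ring.
    by rewrite rec0 rec1; ring.
  rewrite seriesSr mulrDr IH.
  transitivity (1 + (x * u N.+1 + y * (u N.+1 + u N)) + (a0 * u N.+2 + (x + y) * u N.+2)).
    by ring.
  by rewrite rec; ring.
have lim1 : (fun N => (a0 + x + y)^-1 * (1 + (x * u N.+1 + y * (u N.+1 + u N)))) @ \oo
   --> (a0 + x + y)^-1.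
  have us : (fun N => u N.+1) @ \oo --> (0 : R) by rewrite (cvg_shiftS u).
  have := cvgM (cvg_cst (a0 + x + y)^-1) (cvgD (cvg_cst (1 : R))
    (cvgD (cvgM (cvg_cst x) us) (cvgM (cvg_cst y) (cvgD us u0)))).
  by rewrite !addr0 !mulr0 !addr0 mulr1; exact.
rewrite -(cvg_shiftn 2) /=.
rewrite (_ : (fun N => _) = fun N => (a0 + x + y)^-1 * (1 + (x * u N.+1 + y * (u N.+1 + u N))))//.
apply/funext => N; rewrite -part addn2 mulKf// gt_eqF// (lt_le_trans ltr01)//.
Qed.

End inverse.

End power_series.

(** * Boundedness and analyticity of the first integrals *)

Section regularity.
Variables (R : realType) (n : nat).
Local Notation state := (state R n).
Implicit Types (w h : state) (z : nat -> state) (m d : nat) (C r nu : R).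

(* All the polynomials below are sums of a quadratic and a quartic form. *)
Let bounded_polynomial24 (B2 B4 : (nat -> state) -> R) C2 C4 (P : state -> R) :
  nml 2 B2 C2 -> reads 2 B2 -> nml 4 B4 C4 -> reads 4 B4 ->
  (forall w, inH 1 w -> P w = B2 (fun=> w) + B4 (fun=> w)) ->
  bounded_polynomial P.
Proof.
move=> n2 r2 n4 r4 PE.
pose L m z := if m == 2 then B2 z else if m == 4 then B4 z else 0.
pose C m := if m == 2 then C2 else if m == 4 then C4 else 0.
exists 5%N, (fun m (z : 'I_m -> state) => L m (extend z)), C; split=> [m|w Hw].
  apply: nml_bounded; rewrite /L /C; case: eqP => [->//|_]; case: eqP => [->//|_].
  exact: nml0.
have ext m p : (p < m)%N -> extend (fun _ : 'I_m => w) p = w.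
  by move=> pm; rewrite /extend insubT.
rewrite !big_ord_recl big_ord0 /L /= !add0r !addr0 PE//; congr (_ + _).
  by apply: r2 => p /ext.
by apply: r4 => p /ext.
Qed.

Lemma bounded_polynomial_quad (M : R) (m : R -> R) a b (c : R) : adm n M a b m ->
  bounded_polynomial (fun w : state => c * form m a b w w).
Proof.
move=> mM.
apply: (bounded_polynomial24 (nmlZ c (nml_form mM)) _ (nml0 n 4 (lexx 0))).
- by move=> z z' zz'; rewrite !zz'.
- by [].
- by move=> w _; rewrite addr0.
Qed.

Let nml_form2 (M M' : R) (m m' : R -> R) a b a' b' : adm n M a b m -> adm n M' a' b' m' ->
  nml 4 (fun z => form m a b (z 0) (z 1) * form m' a' b' (z 2) (z 3)) (M * M').
Proof.
move=> mM mM'; have M0 : 0 <= M by case: mM.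
exact: (nmlM (reads_form (n := n) m a b) M0 (nml_form mM) (nml_form mM')).
Qed.

Lemma I2_bounded_polynomial nu : Lambda n nu -> bounded_polynomial (@I2 R n nu).
Proof.
move=> Ln.
have N1 := nml_form2 (adm_ind n nu false false) (adm_ind n nu true true).
have N2 := nmlZ (-1) (nml_form2 (adm_ind n nu false true) (adm_ind n nu false true)).
apply: (bounded_polynomial24 (nml0 n 2 (lexx 0)) _ (nmlD N1 N2)).
- by [].
- by move=> z z' zz'; rewrite !zz'.
- by move=> w Hw; rewrite I2E//; ring.
Qed.

(** The part of I1 that does not involve the factor A, which is rational and not
    polynomial in the state. *)
Definition I1_rest nu w := form (ind nu) true true w w
    + form (ind nu) false false w w * form (cc nu) true true w w
    + form (ind nu) true true w w * form (cc nu) false false w w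
    - 2 * (form (ind nu) false true w w * form (cc nu) false true w w).

Lemma I1_rest_bounded_polynomial nu : Lambda n nu -> bounded_polynomial (I1_rest nu).
Proof.
move=> Ln.
have N1 := nml_form2 (adm_ind n nu false false) (adm_cc true true Ln).
have N2 := nml_form2 (adm_ind n nu true true) (adm_cc false false Ln).
have N3 := nmlZ (-2) (nml_form2 (adm_ind n nu false true) (adm_cc false true Ln)).
apply: (bounded_polynomial24 (nml_form (adm_ind n nu true true)) _ (nmlD (nmlD N1 N2) N3)).
- by move=> z z' zz'; rewrite !zz'.
- by move=> z z' zz'; rewrite !zz'.
- by move=> w Hw; rewrite /I1_rest; ring.
Qed.

Lemma I2_analytic nu : Lambda n nu -> analytic (@I2 R n nu).
Proof.
move=> Ln; apply: power_series_analytic => w Hw.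
have p0 := power_series_cst n 1 (@ltr01 R).
have [C1 p1] := power_series_form ltr01 (adm_ind n nu false false) Hw p0.
have [C2 p2] := power_series_form ltr01 (adm_ind n nu true true) Hw p1.
have [C3 p3] := power_series_form ltr01 (adm_ind n nu false true) Hw p0.
have [C4 p4] := power_series_form ltr01 (adm_ind n nu false true) Hw p3.
eexists; eexists; split; first exact: ltr01.
apply: eq_power_series (power_seriesD p2 (power_seriesZ (-1) p4)) => h Hh.
by rewrite (I2E Ln (inHD Hw Hh)); ring.
Qed.

(** The term with A is the only one that is not a polynomial; its expansion comes
    from that of 1 / (1 + D_1), and fixes the radius. *)
Lemma I1_analytic nu : Lambda n nu -> analytic (@I1 R n nu).
Proof.
move=> Ln; apply: power_series_analytic => w Hw.
have r0 := inv_radius_gt0 w.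
have pA := power_series_inv Hw.
have p0 := power_series_cst n 1 r0.
have [C1 p1] := power_series_form r0 (adm_ind n nu false false) Hw pA.
have [C2 p2] := power_series_form r0 (adm_ind n nu true true) Hw p0.
have [C3 p3] := power_series_form r0 (adm_ind n nu false false) Hw p0.
have [C4 p4] := power_series_form r0 (adm_cc true true Ln) Hw p3.
have [C5 p5] := power_series_form r0 (adm_cc false false Ln) Hw p2.
have [C6 p6] := power_series_form r0 (adm_ind n nu false true) Hw p0.
have [C7 p7] := power_series_form r0 (adm_cc false true Ln) Hw p6.
eexists; eexists; split; first exact: r0.
apply: eq_power_series (power_seriesD (power_seriesD (power_seriesD (power_seriesD
  (power_seriesZ nu p1) p2) p4) p5) (power_seriesZ (-2) p7)) => h Hh.
have Hwh := inHD Hw Hh.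
by rewrite (I1E Ln Hwh) (blockAE Hwh); ring.
Qed.

End regularity.

(** * Symbols and gradients *)

Section gradients.
Variables (R : realType) (n : nat).
Local Notation Zn := 'rV[int]_n.
Local Notation state := (state R n).
Local Notation mu := (torus_measure R n).
Local Notation ip := (ip mu).
Implicit Types (w h z : state) (j k : Zn) (nu la : R) (m : R -> R) (M c : R).

Lemma adm0 a b : @adm R n 0 a b (fun=> 0).
Proof. by split=> // nu _; rewrite normr0 mul0r. Qed.

Lemma adm_lin M1 M2 c m1 m2 a b : adm n M1 a b m1 -> adm n M2 a b m2 ->
  adm n (`|c| * M1 + M2) a b (fun nu => c * m1 nu + m2 nu).
Proof.
move=> [p1 H1] [p2 H2]; split; first by rewrite addr_ge0 ?mulr_ge0.
move=> nu Ln; apply: le_trans (ler_normD _ _) _.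
by rewrite mulrDl lerD ?H2// normrM -mulrA ler_wpM2l ?H1.
Qed.

Lemma form_lin M1 M2 c m1 m2 a b z z' : adm n M1 a b m1 -> adm n M2 a b m2 ->
  inH 1 z -> inH 1 z' ->
  form (fun nu => c * m1 nu + m2 nu) a b z z' = c * form m1 a b z z' + form m2 a b z z'.
Proof.
move=> A1 A2 Hz Hz'; rewrite !formE.
have s1 := summ_form A1 Hz Hz'; have s2 := summ_form A2 Hz Hz'.
rewrite -(sumZZ c s1) -(sumZD (summZ c s1) s2); apply: eq_sumZ => j _.
by rewrite mulrDl mulrA.
Qed.

Lemma form0 a b z z' : form (fun=> 0) a b z z' = 0 :> R.
Proof.
rewrite formE; apply: etrans (sumZ0 R n); apply: eq_sumZ => j _.
by rewrite mul0r.
Qed.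

Lemma formZl M m a b c h z : adm n M a b m -> inH 1 h -> inH 1 z ->
  form m a b (c *: h) z = c * form m a b h z.
Proof.
move=> mM Hh Hz; have H0 := inH0 R n 1.
have f0 : form m a b (0 : state) z = 0.
  by have := formDl 1 mM H0 H0 Hz; rewrite scaler0 add0r mul1r => E; lra.
by have := formDl c mM Hh H0 Hz; rewrite f0 !addr0.
Qed.

Lemma formZr M m a b c h z : adm n M a b m -> inH 1 h -> inH 1 z ->
  form m a b z (c *: h) = c * form m a b z h.
Proof. by move=> /admC mM Hh Hz; rewrite formC (formZl c mM Hh Hz) formC. Qed.

Lemma derive_form M m a b w h : adm n M a b m -> inH 1 w -> inH 1 h ->
  is_derive (0 : R) 1 (fun t : R => form m a b (w + t *: h) (w + t *: h))
    (polar m a b w h).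
Proof.
move=> mM Hw Hh.
have E t : form m a b (w + t *: h) (w + t *: h) =
    form m a b w w + (t * polar m a b w h + t * (t * form m a b h h)).
  have Ht := inHZ t Hh.
  rewrite (form_line mM Hw Ht) /polar (formZl t mM Hh Hw) (formZr t mM Hh Hw).
  by rewrite (formZl t mM Hh Ht) (formZr t mM Hh Hh); ring.
rewrite (funext E).
apply: is_derive_eq.
by rewrite /= /GRing.scale /=; ring.
Qed.

(** The functionals of interest depend on w through the moments
    |u_j|^2, |v_j|^2, Re (u_j conj v_j) only; fx, fy, fz are the partial
    derivatives with respect to these moments, as functions of |j|^2. *)
Definition has_symbol (F : state -> R) w (fx fy fz : R -> R) : Prop :=
  [/\ exists M, adm n M false false fx, exists M, adm n M true true fy,
      exists M, adm n M false true fz &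
      forall h, inH 1 h -> is_derive (0 : R) 1 (fun t : R => F (w + t *: h))
        (polar fx false false w h + polar fy true true w h + polar fz false true w h)].

(** Existence of G is kept apart from its being a gradient, because only the
    former asks for more than w in H^1. *)
Definition symbol_gradient w (fx fy fz : R -> R) (G : state) : Prop :=
  [/\ L2zero G.1, L2zero G.2,
      forall j, fcoef G.1 j = (2 * fx (freq2 R j))%:C * cf false w j
                            + (fz (freq2 R j))%:C * cf true w j &
      forall j, fcoef G.2 j = (fz (freq2 R j))%:C * cf false w j
                            + (2 * fy (freq2 R j))%:C * cf true w j].

Let multiplier_function (p q : R -> R) M N w : inH 2 w ->
  (forall nu, Lambda n nu -> `|p nu| <= M * nu) ->
  (forall nu, Lambda n nu -> `|q nu| <= N) ->
  exists2 g, L2zero g & forall j, fcoef g j =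
    (fun j => (p (freq2 R j))%:C * cf false w j + (q (freq2 R j))%:C * cf true w j) j.
Proof.
move=> Hw pM qN; apply: riesz_fischer.
- move=> j; rewrite freq2N !(cfN _ _ Hw).
  by case: (cf false w j) (cf true w j) => a b [a' b']; simpc => /=; congr (_ +i* _); ring.
- have [[/L2zero_fcoef0 u0 _] [/L2zero_fcoef0 v0 _]] := Hw.
  by rewrite /cf u0 v0 !mulr0 addr0.
have [/sobolevP[_ su] /(sobolev_le (leq0n 1))/sobolevP[_ sv]] := Hw.
apply: summ_le (summD (summZ (2 * M ^+ 2) su) (summZ (2 * N ^+ 2) sv)) => j j0.
have Lj : Lambda n (freq2 R j) by exists j.
rewrite ger0_norm ?rp_ge0// -/(cf false w j) -/(cf true w j) expr0 mul1r.
have := pM _ Lj; have := qN _ Lj; set a := p _; set b := q _ => bN aM.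
have a2 : a ^+ 2 <= M ^+ 2 * freq2 R j ^+ 2.
  rewrite -exprMn -real_normK ?num_real// lerXn2r ?nnegrE//.
  exact: le_trans (normr_ge0 _) aM.
have b2 : b ^+ 2 <= N ^+ 2.
  rewrite -real_normK ?num_real// lerXn2r ?nnegrE//.
  exact: le_trans (normr_ge0 _) bN.
apply: (@le_trans _ _ (2 * (a ^+ 2 * rp (cf false w j) (cf false w j))
   + 2 * (b ^+ 2 * rp (cf true w j) (cf true w j)))).
  case: (cf false w j) (cf true w j) => u v [u' v']; rewrite !rpE; simpc => /=.
  have := sqr_ge0 (a * u - b * u'); have := sqr_ge0 (a * v - b * v').
  by nra.
rewrite -(mulrA 2 (M ^+ 2)) -(mulrA 2 (N ^+ 2)); apply: lerD; rewrite ler_pM2l//.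
  by rewrite mulrA ler_wpM2r// rp_ge0.
by rewrite ler_wpM2r// rp_ge0.
Qed.

(** Here the regularity H^2 is used: fx may grow like nu, so fx u is square
    summable only when u is in H^2. *)
Lemma symbol_gradient_exists w fx fy fz : inH 2 w ->
  (exists M, adm n M false false fx) -> (exists M, adm n M true true fy) ->
  (exists M, adm n M false true fz) -> exists G, symbol_gradient w fx fy fz G.
Proof.
move=> Hw [Mx [Mx0 Hx]] [My [My0 Hy]] [Mz [Mz0 Hz]].
have [g1 L1 c1] : exists2 g, L2zero g & forall j, fcoef g j =
    (fun j => (2 * fx (freq2 R j))%:C * cf false w j + (fz (freq2 R j))%:C * cf true w j) j.
  apply: (@multiplier_function (fun nu => 2 * fx nu) fz (2 * Mx) Mz) => // nu Ln.
    by rewrite normrM ger0_norm// -mulrA ler_wpM2l//; exact: Hx.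
  by have := Hz nu Ln; rewrite mulr1.
have [g2 L2 c2] : exists2 g, L2zero g & forall j, fcoef g j =
    (fun j => (fz (freq2 R j))%:C * cf false w j + (2 * fy (freq2 R j))%:C * cf true w j) j.
  apply: (@multiplier_function fz (fun nu => 2 * fy nu) Mz (2 * My)) => // nu Ln.
    have := Hz nu Ln; rewrite mulr1 => /le_trans; apply.
    by rewrite ler_peMr//; exact: Lambda_gt0 Ln.
  by rewrite normrM ger0_norm// ler_wpM2l//; have := Hy nu Ln; rewrite mulr1.
exists (g1, g2); split; [exact: L1|exact: L2|exact: c1|exact: c2].
Qed.

Lemma symbol_gradientP F w fx fy fz G : inH 1 w -> has_symbol F w fx fy fz ->
  symbol_gradient w fx fy fz G -> is_L2gradient F w G.
Proof.
move=> Hw [[Mx Ax] [My Ay] [Mz Az] dF] [G1 G2 c1 c2]; split=> // h Hh.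
have -> : (\int[mu]_x (G.1 x * h.1 x) + \int[mu]_x (G.2 x * h.2 x))%R =
   polar fx false false w h + polar fy true true w h + polar fz false true w h.
  have [Lh1 Lh2] := inH_L2 Hh.
  rewrite -/(ip G.1 h.1) -/(ip G.2 h.2) (parseval G1 Lh1) (parseval G2 Lh2).
  rewrite /polar !formE.
  have sx1 := summ_form Ax Hw Hh; have sx2 := summ_form Ax Hh Hw.
  have sy1 := summ_form Ay Hw Hh; have sy2 := summ_form Ay Hh Hw.
  have sz1 := summ_form Az Hw Hh; have sz2 := summ_form Az Hh Hw.
  have sx := summD sx1 sx2; have sy := summD sy1 sy2; have sz := summD sz1 sz2.
  rewrite -(sumZD sx1 sx2) -(sumZD sy1 sy2) -(sumZD sz1 sz2).
  rewrite -(sumZD sx sy) -(sumZD (summD sx sy) sz).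
  rewrite -sumZD; last 2 first.
  - exact: summ_rp (L2zero_summ G1) (L2zero_summ (sobolev_L2zero Hh.1)).
  - exact: summ_rp (L2zero_summ G2) (L2zero_summ (sobolev_L2zero Hh.2)).
  apply: eq_sumZ => j _; rewrite c1 c2 -/(cf false h j) -/(cf true h j).
  case: (cf false w j) (cf true w j) (cf false h j) (cf true h j) => a b [c d] [e f] [p q].
  by simpc; rewrite !rpE /=; ring.
exact: dF.
Qed.

End gradients.

(** * Poisson brackets of functions with symbols *)

Section brackets.
Variables (R : realType) (n : nat).
Local Notation Zn := 'rV[int]_n.
Local Notation state := (state R n).
Local Notation mu := (torus_measure R n).
Local Notation ip := (ip mu).
Implicit Types (w h z : state) (j k : Zn) (nu la : R) (m : R -> R) (M c : R).

Lemma polar_lin M1 M2 c m1 m2 a b w h : adm n M1 a b m1 -> adm n M2 a b m2 ->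
  inH 1 w -> inH 1 h ->
  polar (fun nu => c * m1 nu + m2 nu) a b w h = c * polar m1 a b w h + polar m2 a b w h.
Proof.
move=> A1 A2 Hw Hh; rewrite /polar (form_lin c A1 A2 Hw Hh) (form_lin c A1 A2 Hh Hw).
by ring.
Qed.

Lemma polar0 a b w h : polar (fun=> 0) a b w h = 0 :> R.
Proof. by rewrite /polar !form0 addr0. Qed.

(** The symbols of the first integrals of frequency nu.  The sum is nested to the
    right and ends with 0, so that linearity peels off one multiplier at a
    time. *)
Definition lin3 nu (p q r : R) : R -> R :=
  fun x => p * ind nu x + (q * cc nu x + (r * x + 0)).

Lemma adm_lin3 nu p q r a b : Lambda n nu -> (a || b -> r = 0) ->
  exists M, adm n M a b (lin3 nu p q r).
Proof.
move=> Ln r0; have [M AM] : exists M, adm n M a b (fun x : R => r * x + 0).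
  case: (boolP (a || b)) => [/r0 ->|].
    exists 0; have := adm0 R n a b; congr (adm _ _ _ _ _).
    by apply/funext => x; rewrite mul0r addr0.
  case: a r0 => //; case: b => // _ _; eexists.
  exact: (adm_lin r (adm_id R n) (adm0 R n false false)).
by eexists; exact: (adm_lin p (adm_ind n nu a b) (adm_lin q (adm_cc a b Ln) AM)).
Qed.

Lemma polar_lin3 nu p q r w h : Lambda n nu -> inH 1 w -> inH 1 h ->
  polar (lin3 nu p q r) false false w h =
    p * polar (ind nu) false false w h + q * polar (cc nu) false false w h
    + r * polar id false false w h.
Proof.
move=> Ln Hw Hh.
have A1 := adm_lin r (adm_id R n) (adm0 R n false false).
have A2 := adm_lin q (adm_cc false false Ln) A1.
rewrite /lin3 (polar_lin p (adm_ind n nu false false) A2 Hw Hh).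
rewrite (polar_lin q (adm_cc false false Ln) A1 Hw Hh).
rewrite (polar_lin r (adm_id R n) (adm0 R n false false) Hw Hh) polar0.
by rewrite addr0 addrA.
Qed.

Lemma polar_lin2 nu p q a b w h : Lambda n nu -> inH 1 w -> inH 1 h ->
  polar (lin3 nu p q 0) a b w h =
    p * polar (ind nu) a b w h + q * polar (cc nu) a b w h.
Proof.
move=> Ln Hw Hh.
have E : lin3 nu p q 0 = fun x => p * ind nu x + (q * cc nu x + 0).
  by apply/funext => x; rewrite /lin3 mul0r addr0.
have A2 := adm_lin q (adm_cc a b Ln) (adm0 R n a b).
rewrite E (polar_lin p (adm_ind n nu a b) A2 Hw Hh).
by rewrite (polar_lin q (adm_cc a b Ln) (adm0 R n a b) Hw Hh) polar0 addr0.
Qed.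

Section symbols.
Variables (nu : R) (w : state).
Hypotheses (Ln : Lambda n nu) (Hw : inH 1 w).

Local Notation A := (blockA w).
Local Notation X := (form (ind nu) false false w w).
Local Notation Y := (form (ind nu) true true w w).
Local Notation Z := (form (ind nu) false true w w).
Local Notation Tx := (form (cc nu) false false w w).
Local Notation Ty := (form (cc nu) true true w w).
Local Notation Tz := (form (cc nu) false true w w).

Lemma symbol_I2 : has_symbol (@I2 R n nu) w
  (lin3 nu Y 0 0) (lin3 nu X 0 0) (lin3 nu (- (2 * Z)) 0 0).
Proof.
split; [exact: adm_lin3..|]; move=> h Hh.
have Hl t : inH 1 (w + t *: h) := inHD Hw (inHZ t Hh).
have -> : (fun t : R => I2 nu (w + t *: h)) = fun t =>
    form (ind nu) false false (w + t *: h) (w + t *: h)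
      * form (ind nu) true true (w + t *: h) (w + t *: h)
    - form (ind nu) false true (w + t *: h) (w + t *: h)
      * form (ind nu) false true (w + t *: h) (w + t *: h).
  by apply/funext => t; rewrite (I2E Ln (Hl t)) expr2.
have dX := derive_form (adm_ind n nu false false) Hw Hh.
have dY := derive_form (adm_ind n nu true true) Hw Hh.
have dZ := derive_form (adm_ind n nu false true) Hw Hh.
apply: is_derive_eq.
rewrite !(polar_lin2 _ _ _ _ Ln Hw Hh) scale0r addr0 /GRing.scale /=.
by ring.
Qed.

Lemma symbol_I1 : has_symbol (@I1 R n nu) w
  (lin3 nu (A * nu + Ty) Y (- (A ^+ 2 * nu * X)))
  (lin3 nu (1 + Tx) X 0) (lin3 nu (- (2 * Tz)) (- (2 * Z)) 0).
Proof.
split; [exact: adm_lin3..|]; move=> h Hh.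
have Hl t : inH 1 (w + t *: h) := inHD Hw (inHZ t Hh).
pose q m a b t := form m a b (w + t *: h) (w + t *: h).
have -> : (fun t : R => I1 nu (w + t *: h)) = fun t =>
    (1 + q id false false t)^-1 * (nu * q (ind nu) false false t)
    + q (ind nu) true true t
    + q (ind nu) false false t * q (cc nu) true true t
    + q (ind nu) true true t * q (cc nu) false false t
    - 2 * (q (ind nu) false true t * q (cc nu) false true t).
  by apply/funext => t; rewrite (I1E Ln (Hl t)) (blockAE (Hl t)).
have dX := derive_form (adm_ind n nu false false) Hw Hh.
have dY := derive_form (adm_ind n nu true true) Hw Hh.
have dZ := derive_form (adm_ind n nu false true) Hw Hh.
have dTx := derive_form (adm_cc false false Ln) Hw Hh.
have dTy := derive_form (adm_cc true true Ln) Hw Hh.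
have dTz := derive_form (adm_cc false true Ln) Hw Hh.
have dD := derive_form (adm_id R n) Hw Hh.
rewrite /q.
have D0 : 1 + form id false false (w + (0 : R) *: h) (w + (0 : R) *: h) != 0.
  by rewrite scale0r addr0 gt_eqF//; have := form_id_ge0 Hw; lra.
have dA := is_deriveV D0.
apply: is_derive_eq.
rewrite !(polar_lin2 _ _ _ _ Ln Hw Hh) (polar_lin3 _ _ _ Ln Hw Hh) scale0r addr0 /GRing.scale /=.
rewrite (blockAE Hw); move: D0; rewrite scale0r addr0 => D0.
by field.
Qed.

End symbols.

Lemma gradient_bracketE (G K : state) :
  L2zero G.1 -> L2zero G.2 -> L2zero K.1 -> L2zero K.2 ->
  gradient_bracket G K =
  sumZ (fun j => rp (fcoef G.1 j) (fcoef K.2 j) - rp (fcoef G.2 j) (fcoef K.1 j)).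
Proof.
move=> G1 G2 K1 K2.
have [LG1 LG2] := (L2zero_L2 G1, L2zero_L2 G2).
have [LK1 LK2] := (L2zero_L2 K1, L2zero_L2 K2).
rewrite /gradient_bracket (RintegralB measurableT (integrable_ip LG1 LK2) (integrable_ip LG2 LK1)).
rewrite -/(ip G.1 K.2) -/(ip G.2 K.1) (parseval G1 LK2) (parseval G2 LK1).
have s1 := summ_rp (L2zero_summ G1) (L2zero_summ K2).
have s2 := summ_rp (L2zero_summ G2) (L2zero_summ K1).
rewrite -[X in _ - X]mul1r -mulNr -(sumZZ (-1) s2) -(sumZD s1 (summZ (-1) s2)).
by apply: eq_sumZ => j _; rewrite mulN1r.
Qed.

Lemma gradient_bracketC (G K : state) :
  L2zero G.1 -> L2zero G.2 -> L2zero K.1 -> L2zero K.2 ->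
  gradient_bracket G K = 0 -> gradient_bracket K G = 0.
Proof.
move=> G1 G2 K1 K2; rewrite (gradient_bracketE G1 G2 K1 K2) (gradient_bracketE K1 K2 G1 G2).
have s1 := summ_rp (L2zero_summ G1) (L2zero_summ K2).
have s2 := summ_rp (L2zero_summ G2) (L2zero_summ K1).
move=> H; have := sumZZ (-1) (summD s1 (summZ (-1) s2)).
rewrite (_ : sumZ (fun j => rp (fcoef G.1 j) (fcoef K.2 j)
  + -1 * rp (fcoef G.2 j) (fcoef K.1 j)) = 0).
  rewrite mulr0 => <-; apply: eq_sumZ => j _.
  by rewrite [rp (fcoef K.1 j) _]rpC [rp (fcoef K.2 j) _]rpC; ring.
by rewrite -[RHS]H; apply: eq_sumZ => j _; rewrite mulN1r.
Qed.

Lemma gradient_bracket_id (G : state) : gradient_bracket G G = 0.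
Proof.
rewrite /gradient_bracket (_ : (fun x => _) = fun=> 0).
  by rewrite Rintegral_cst// mul0r.
by apply/funext => x; rewrite mulrC subrr.
Qed.

(** The canonical bracket of the moments |u|^2, |v|^2 and Re (u conj v) at one
    mode, which is that of sl_2. *)
Lemma symbol_bracketE w fx fy fz gx gy gz (G K : state) :
  symbol_gradient w fx fy fz G -> symbol_gradient w gx gy gz K ->
  gradient_bracket G K = sumZ (fun j => let x := freq2 R j in
    2 * (fx x * gz x - gx x * fz x) * rp (cf false w j) (cf false w j)
    + 4 * (fx x * gy x - gx x * fy x) * rp (cf false w j) (cf true w j)
    + 2 * (gy x * fz x - fy x * gz x) * rp (cf true w j) (cf true w j)).
Proof.
move=> [G1 G2 g1 g2] [K1 K2 k1 k2]; rewrite (gradient_bracketE G1 G2 K1 K2).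
apply: eq_sumZ => j _; rewrite g1 g2 k1 k2 /=.
case: (cf false w j) (cf true w j) => a b [c d].
by simpc; rewrite !rpE /=; ring.
Qed.

(** The multipliers attached to two frequencies span, together with the
    identity, a space closed under the products met in the brackets: with
    x = 1 / nu, cc is the kernel 1 / (x_mu - x_nu) of a Gaudin model, and the
    coefficient of cc_nu * cc_la is its partial fraction decomposition. *)
Definition lin5 nu la (p s q t r : R) : R -> R :=
  fun x => p * ind nu x + (s * ind la x + (q * cc nu x + (t * cc la x + (r * x + 0)))).

Lemma lin3_mul nu la p q r p' q' x :
  Lambda n nu -> Lambda n la -> Lambda n x -> nu != la ->
  lin3 nu p q r x * lin3 la p' q' 0 x =
  (p * q' * cc la nu + q * q' * cc la nu ^+ 2) * ind nu x
  + (- (q * p' * cc la nu) + q * q' * cc la nu ^+ 2 + r * p' * la + r * q' * la ^+ 2)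
    * ind la x
  + q * q' * cc la nu * cc nu x
  + (r * q' * la - q * q' * cc la nu) * cc la x
  - r * q' * la * x.
Proof.
move=> Ln Ll Lx nl; have nl0 : nu - la != 0 by rewrite subr_eq0.
have ln0 : la - nu != 0 by rewrite subr_eq0 eq_sym.
rewrite /lin3 /ind; have [->|xn] := eqVneq x nu.
  by rewrite (negbTE nl) cc_diag /cc; field.
have xn0 : nu - x != 0 by rewrite subr_eq0 eq_sym.
have [->|xl] := eqVneq x la.
  by rewrite cc_diag /cc; field; rewrite nl0 ln0.
have xl0 : la - x != 0 by rewrite subr_eq0 eq_sym.
by rewrite /cc; field; rewrite xl0 xn0 ln0.
Qed.

Let form_lin2 nu la (p s q t : R) a b w : Lambda n nu -> Lambda n la -> inH 1 w ->
  form (lin5 nu la p s q t 0) a b w w =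
  p * form (ind nu) a b w w + s * form (ind la) a b w w
  + q * form (cc nu) a b w w + t * form (cc la) a b w w.
Proof.
move=> Ln Ll Hw.
have -> : lin5 nu la p s q t 0 = fun x =>
    p * ind nu x + (s * ind la x + (q * cc nu x + (t * cc la x + 0))).
  by apply/funext => x; rewrite /lin5 mul0r addr0.
have A1 := adm_lin t (adm_cc a b Ll) (adm0 R n a b).
have A2 := adm_lin q (adm_cc a b Ln) A1.
have A3 := adm_lin s (adm_ind n la a b) A2.
rewrite (form_lin p (adm_ind n nu a b) A3 Hw Hw) (form_lin s (adm_ind n la a b) A2 Hw Hw).
rewrite (form_lin q (adm_cc a b Ln) A1 Hw Hw).
by rewrite (form_lin t (adm_cc a b Ll) (adm0 R n a b) Hw Hw) form0; ring.
Qed.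

Let form_lin5 nu la (p s q t r : R) w : Lambda n nu -> Lambda n la -> inH 1 w ->
  form (lin5 nu la p s q t r) false false w w =
  p * form (ind nu) false false w w + s * form (ind la) false false w w
  + q * form (cc nu) false false w w + t * form (cc la) false false w w
  + r * form id false false w w.
Proof.
move=> Ln Ll Hw.
have A0 := adm_lin r (adm_id R n) (adm0 R n false false).
have A1 := adm_lin t (adm_cc false false Ll) A0.
have A2 := adm_lin q (adm_cc false false Ln) A1.
have A3 := adm_lin s (adm_ind n la false false) A2.
rewrite (form_lin p (adm_ind n nu false false) A3 Hw Hw).
rewrite (form_lin s (adm_ind n la false false) A2 Hw Hw).
rewrite (form_lin q (adm_cc false false Ln) A1 Hw Hw).
rewrite (form_lin t (adm_cc false false Ll) A0 Hw Hw).
by rewrite (form_lin r (adm_id R n) (adm0 R n false false) Hw Hw) form0; ring.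
Qed.

Let adm_lin5 nu la (p s q t r : R) a b : Lambda n nu -> Lambda n la ->
  (a || b -> r = 0) -> exists M, adm n M a b (lin5 nu la p s q t r).
Proof.
move=> Ln Ll r0; have [M AM] := adm_lin3 0 t Ll r0.
have -> : lin5 nu la p s q t r =
    fun x => p * ind nu x + (s * ind la x + (q * cc nu x + lin3 la 0 t r x)).
  by apply/funext => x; rewrite /lin5 /lin3 mul0r add0r.
by eexists; exact: (adm_lin p (adm_ind n nu a b) (adm_lin s (adm_ind n la a b)
  (adm_lin q (adm_cc a b Ln) AM))).
Qed.

(** The bracket is a sum over modes of products of symbols, and lin3_mul turns each
    product into a combination of single multipliers, that is of forms.  The
    hypothesis relating r q1' to r' q1 cancels the identity multiplier in the
    mixed term u v, where it would not be admissible on H^1. *)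
Lemma bracket_distinct nu la w p q r p1 q1 p2 q2 p' q' r' p1' q1' p2' q2' (G K : state) :
  Lambda n nu -> Lambda n la -> nu != la -> inH 1 w ->
  symbol_gradient w (lin3 nu p q r) (lin3 nu p1 q1 0) (lin3 nu p2 q2 0) G ->
  symbol_gradient w (lin3 la p' q' r') (lin3 la p1' q1' 0) (lin3 la p2' q2' 0) K ->
  r * q1' * la = r' * q1 * nu ->
  let k := cc la nu in let l := cc nu la in
  gradient_bracket G K =
    2 * ((p * q2' * k + q * q2' * k ^+ 2
          - (- (q' * p2 * l) + q' * q2 * l ^+ 2 + r' * p2 * nu + r' * q2 * nu ^+ 2))
           * form (ind nu) false false w w
         + (- (q * p2' * k) + q * q2' * k ^+ 2 + r * p2' * la + r * q2' * la ^+ 2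
          - (p' * q2 * l + q' * q2 * l ^+ 2)) * form (ind la) false false w w
         + (q * q2' * k - (r' * q2 * nu - q' * q2 * l)) * form (cc nu) false false w w
         + (r * q2' * la - q * q2' * k - q' * q2 * l) * form (cc la) false false w w
         + (r' * q2 * nu - r * q2' * la) * form id false false w w)
  + 4 * ((p * q1' * k + q * q1' * k ^+ 2
          - (- (q' * p1 * l) + q' * q1 * l ^+ 2 + r' * p1 * nu + r' * q1 * nu ^+ 2))
           * form (ind nu) false true w w
         + (- (q * p1' * k) + q * q1' * k ^+ 2 + r * p1' * la + r * q1' * la ^+ 2
          - (p' * q1 * l + q' * q1 * l ^+ 2)) * form (ind la) false true w w
         + (q * q1' * k - (r' * q1 * nu - q' * q1 * l)) * form (cc nu) false true w w
         + (r * q1' * la - q * q1' * k - q' * q1 * l) * form (cc la) false true w w)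
  + 2 * ((p2 * q1' * k + q2 * q1' * k ^+ 2 - (p1 * q2' * k + q1 * q2' * k ^+ 2))
           * form (ind nu) true true w w
         + (- (q2 * p1' * k) + q2 * q1' * k ^+ 2 - (- (q1 * p2' * k) + q1 * q2' * k ^+ 2))
           * form (ind la) true true w w
         + (q2 * q1' * k - q1 * q2' * k) * form (cc nu) true true w w
         + (q1 * q2' * k - q2 * q1' * k) * form (cc la) true true w w).
Proof.
move=> Ln Ll nl Hw gG gK rr k l; rewrite (symbol_bracketE gG gK) /=.
have ln : la != nu by rewrite eq_sym.
pose mx := lin5 nu la
  (2 * (p * q2' * k + q * q2' * k ^+ 2
          - (- (q' * p2 * l) + q' * q2 * l ^+ 2 + r' * p2 * nu + r' * q2 * nu ^+ 2)))
  (2 * (- (q * p2' * k) + q * q2' * k ^+ 2 + r * p2' * la + r * q2' * la ^+ 2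
          - (p' * q2 * l + q' * q2 * l ^+ 2)))
  (2 * (q * q2' * k - (r' * q2 * nu - q' * q2 * l)))
  (2 * (r * q2' * la - q * q2' * k - q' * q2 * l))
  (2 * (r' * q2 * nu - r * q2' * la)).
pose mz := lin5 nu la
  (4 * (p * q1' * k + q * q1' * k ^+ 2
          - (- (q' * p1 * l) + q' * q1 * l ^+ 2 + r' * p1 * nu + r' * q1 * nu ^+ 2)))
  (4 * (- (q * p1' * k) + q * q1' * k ^+ 2 + r * p1' * la + r * q1' * la ^+ 2
          - (p' * q1 * l + q' * q1 * l ^+ 2)))
  (4 * (q * q1' * k - (r' * q1 * nu - q' * q1 * l)))
  (4 * (r * q1' * la - q * q1' * k - q' * q1 * l)) 0.
pose my := lin5 nu la
  (2 * (p2 * q1' * k + q2 * q1' * k ^+ 2 - (p1 * q2' * k + q1 * q2' * k ^+ 2)))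
  (2 * (- (q2 * p1' * k) + q2 * q1' * k ^+ 2 - (- (q1 * p2' * k) + q1 * q2' * k ^+ 2)))
  (2 * (q2 * q1' * k - q1 * q2' * k))
  (2 * (q1 * q2' * k - q2 * q1' * k)) 0.
have [Mx Ax] : exists M, adm n M false false mx by exact: adm_lin5.
have [Mz Az] : exists M, adm n M false true mz by exact: adm_lin5.
have [My Ay] : exists M, adm n M true true my by exact: adm_lin5.
transitivity (form mx false false w w + form mz false true w w + form my true true w w).
  have sx := summ_form Ax Hw Hw; have sz := summ_form Az Hw Hw.
  have sy := summ_form Ay Hw Hw.
  rewrite !formE -(sumZD sx sz) -(sumZD (summD sx sz) sy); apply: eq_sumZ => j j0.
  have Lx : Lambda n (freq2 R j) by exists j.
  move: (freq2 R j) Lx => x Lx; congr (_ * _ + _ * _ + _ * _).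
  - rewrite (lin3_mul p q r p2' q2' Ln Ll Lx nl) (lin3_mul p' q' r' p2 q2 Ll Ln Lx ln).
    by rewrite /mx /lin5 -/k -/l; ring.
  - rewrite (lin3_mul p q r p1' q1' Ln Ll Lx nl) (lin3_mul p' q' r' p1 q1 Ll Ln Lx ln).
    apply/eqP; rewrite -subr_eq0 /mz /lin5 -/k -/l; apply/eqP.
    transitivity (4 * x * (r' * q1 * nu - r * q1' * la)); first by ring.
    by rewrite rr subrr mulr0.
  - rewrite [lin3 la _ _ _ _ * _]mulrC (lin3_mul p2 q2 0 p1' q1' Ln Ll Lx nl).
    rewrite (lin3_mul p1 q1 0 p2' q2' Ln Ll Lx nl) -/k /my /lin5; ring.
rewrite (form_lin5 _ _ _ _ _ Ln Ll Hw) (form_lin2 _ _ _ _ _ _ Ln Ll Hw).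
by rewrite (form_lin2 _ _ _ _ _ _ Ln Ll Hw); ring.
Qed.

(** The moments X, Y, Z of one shell span a copy of sl_2 and I2 = X Y - Z^2 is its
    Casimir function; the other symbol matters only through its values at nu. *)
Lemma bracket_same nu w p q r p1 q1 p2 q2 (G K : state) :
  Lambda n nu -> inH 1 w ->
  let X := form (ind nu) false false w w in
  let Y := form (ind nu) true true w w in
  let Z := form (ind nu) false true w w in
  symbol_gradient w (lin3 nu p q r) (lin3 nu p1 q1 0) (lin3 nu p2 q2 0) G ->
  symbol_gradient w (lin3 nu Y 0 0) (lin3 nu X 0 0) (lin3 nu (- (2 * Z)) 0 0) K ->
  gradient_bracket G K = 0.
Proof.
move=> Ln Hw X Y Z gG gK; rewrite (symbol_bracketE gG gK) /=.
have E a b c x : lin3 nu a b c x * ind nu x = (a + c * nu) * ind nu x.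
  by rewrite /lin3 /ind; case: eqP => [->|_]; rewrite ?cc_diag; ring.
transitivity (
   2 * (- (p + r * nu) * (2 * Z) - p2 * Y) * form (ind nu) false false w w
  + 4 * ((p + r * nu) * X - p1 * Y) * form (ind nu) false true w w
  + 2 * (p2 * X + p1 * (2 * Z)) * form (ind nu) true true w w); last first.
  by rewrite -/X -/Y -/Z; ring.
have sx := summ_form (adm_ind n nu false false) Hw Hw.
have sz := summ_form (adm_ind n nu false true) Hw Hw.
have sy := summ_form (adm_ind n nu true true) Hw Hw.
rewrite !formE -!sumZZ// -(sumZD (summZ _ sx) (summZ _ sz)).
rewrite -(sumZD (summD (summZ _ sx) (summZ _ sz)) (summZ _ sy)).
apply: eq_sumZ => j _; move: (freq2 R j) => x.
have L1 c : lin3 nu c 0 0 x = c * ind nu x by rewrite /lin3; ring.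
rewrite !L1.
transitivity (2 * (- (lin3 nu p q r x * ind nu x) * (2 * Z) - Y * (lin3 nu p2 q2 0 x * ind nu x))
    * rp (cf false w j) (cf false w j)
  + 4 * (X * (lin3 nu p q r x * ind nu x) - Y * (lin3 nu p1 q1 0 x * ind nu x))
    * rp (cf false w j) (cf true w j)
  + 2 * (X * (lin3 nu p2 q2 0 x * ind nu x) + (2 * Z) * (lin3 nu p1 q1 0 x * ind nu x))
    * rp (cf true w j) (cf true w j)); first by ring.
by rewrite !E; ring.
Qed.

End brackets.

(** * Commutation of the first integrals *)

Section commutation.
Variables (R : realType) (n : nat).
Local Notation Zn := 'rV[int]_n.
Local Notation state := (state R n).
Local Notation Im := complex.Im.
Implicit Types (w h z : state) (j k : Zn) (nu la : R) (m : R -> R) (M c : R).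

Let grad_I1 nu w : Lambda n nu -> inH 2 w -> exists2 G,
  symbol_gradient w
    (lin3 nu (blockA w * nu + form (cc nu) true true w w) (form (ind nu) true true w w)
       (- (blockA w ^+ 2 * nu * form (ind nu) false false w w)))
    (lin3 nu (1 + form (cc nu) false false w w) (form (ind nu) false false w w) 0)
    (lin3 nu (- (2 * form (cc nu) false true w w)) (- (2 * form (ind nu) false true w w)) 0)
    G & is_L2gradient (@I1 R n nu) w G.
Proof.
move=> Ln Hw; have Hw1 : inH 1 w := inH_le (isT : (1 <= 2)%N) Hw.
have S := symbol_I1 Ln Hw1; have [Ax Ay Az _] := S.
have [G gG] := symbol_gradient_exists Hw Ax Ay Az.
by exists G => //; exact: symbol_gradientP Hw1 S gG.
Qed.

Let grad_I2 nu w : Lambda n nu -> inH 2 w -> exists2 G,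
  symbol_gradient w (lin3 nu (form (ind nu) true true w w) 0 0)
    (lin3 nu (form (ind nu) false false w w) 0 0)
    (lin3 nu (- (2 * form (ind nu) false true w w)) 0 0)
    G & is_L2gradient (@I2 R n nu) w G.
Proof.
move=> Ln Hw; have Hw1 : inH 1 w := inH_le (isT : (1 <= 2)%N) Hw.
have S := symbol_I2 Ln Hw1; have [Ax Ay Az _] := S.
have [G gG] := symbol_gradient_exists Hw Ax Ay Az.
by exists G => //; exact: symbol_gradientP Hw1 S gG.
Qed.

Let commuting w (F F' : state -> R) : Prop := exists G K,
  [/\ is_L2gradient F w G, is_L2gradient F' w K & gradient_bracket G K = 0].

Let commutingC w F F' : commuting w F F' -> commuting w F' F.
Proof.
move=> [G [K [gG gK GK]]]; exists K, G; split=> //.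
have [G1 G2 _] := gG; have [K1 K2 _] := gK.
exact: (gradient_bracketC G1 G2 K1 K2 GK).
Qed.

(* After bracket_distinct the claim is an identity between rational functions of
   the forms; the derivative of A enters through A^2 (1 + D_1) = A. *)
Let commuting_I1 nu la w : Lambda n nu -> Lambda n la -> nu != la -> inH 2 w ->
  commuting w (@I1 R n nu) (@I1 R n la).
Proof.
move=> Ln Ll nl Hw; have Hw1 : inH 1 w := inH_le (isT : (1 <= 2)%N) Hw.
have [G gG iG] := grad_I1 Ln Hw; have [K gK iK] := grad_I1 Ll Hw.
exists G, K; split=> //.
have nl0 : nu - la != 0 by rewrite subr_eq0.
have ln0 : la - nu != 0 by rewrite subr_eq0 eq_sym.
rewrite (bracket_distinct Ln Ll nl Hw1 gG gK); last by ring.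
have D0 : 1 + form id false false w w != 0.
  by rewrite gt_eqF//; have := form_id_ge0 Hw1; lra.
rewrite (blockAE Hw1).
move: (form id false false w w) D0 => D D0.
move: (form (ind nu) false false w w) (form (ind nu) true true w w)
  (form (ind nu) false true w w) => X Y Z.
move: (form (ind la) false false w w) (form (ind la) true true w w)
  (form (ind la) false true w w) => X' Y' Z'.
move: (form (cc nu) false false w w) (form (cc nu) true true w w)
  (form (cc nu) false true w w) => Tx Ty Tz.
move: (form (cc la) false false w w) (form (cc la) true true w w)
  (form (cc la) false true w w) => Tx' Ty' Tz'.
by rewrite /cc; field; rewrite D0 nl0 ln0.
Qed.

Let commuting_I1_I2 nu la w : Lambda n nu -> Lambda n la -> inH 2 w ->
  commuting w (@I1 R n nu) (@I2 R n la).
Proof.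
move=> Ln Ll Hw; have Hw1 : inH 1 w := inH_le (isT : (1 <= 2)%N) Hw.
have [G gG iG] := grad_I1 Ln Hw; have [K gK iK] := grad_I2 Ll Hw.
exists G, K; split=> //.
have [nl|nl] := eqVneq nu la.
  by subst la; exact: (bracket_same Ln Hw1 gG gK).
have nl0 : nu - la != 0 by rewrite subr_eq0.
have ln0 : la - nu != 0 by rewrite subr_eq0 eq_sym.
rewrite (bracket_distinct Ln Ll nl Hw1 gG gK); last by ring.
by rewrite [cc nu la]ccC; ring.
Qed.

Let commuting_I2 nu la w : Lambda n nu -> Lambda n la -> nu != la -> inH 2 w ->
  commuting w (@I2 R n nu) (@I2 R n la).
Proof.
move=> Ln Ll nl Hw; have Hw1 : inH 1 w := inH_le (isT : (1 <= 2)%N) Hw.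
have [G gG iG] := grad_I2 Ln Hw; have [K gK iK] := grad_I2 Ll Hw.
exists G, K; split=> //.
by rewrite (bracket_distinct Ln Ll nl Hw1 gG gK); last ring; ring.
Qed.

Let commuting_id w F G : is_L2gradient F w G -> commuting w F F.
Proof. by move=> gG; exists G, G; split=> //; exact: gradient_bracket_id. Qed.

Let commuting_calI (a b : bool) nu la w : Lambda n nu -> Lambda n la -> inH 2 w ->
  commuting w (@calI R n a nu) (@calI R n b la).
Proof.
move=> Ln Ll Hw; case: a; case: b => /=.
- have [nl|nl] := eqVneq nu la; last exact: commuting_I2.
  by subst la; have [G _ gG] := grad_I2 Ln Hw; exact: commuting_id gG.
- exact/commutingC/commuting_I1_I2.
- exact: commuting_I1_I2.
- have [nl|nl] := eqVneq nu la; last exact: commuting_I1.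
  by subst la; have [G _ gG] := grad_I1 Ln Hw; exact: commuting_id gG.
Qed.

Lemma L2zero0 : L2zero (fun _ : n.-tuple (measurableTypeR R) => 0 : R).
Proof. exact: (sobolev_L2zero (sobolev0 R n 0)). Qed.

Let gradient_cst (F : state -> R) (c : R) w : (forall y, inH 1 y -> F y = c) ->
  inH 1 w -> is_L2gradient F w (0 : state).
Proof.
move=> Fc Hw; split; [exact: L2zero0|exact: L2zero0|] => h Hh.
have -> : (fun t : R => F (w + t *: h)) = cst c.
  by apply/funext => t; exact: (Fc _ (inHD Hw (inHZ t Hh))).
rewrite (_ : (_ + _)%R = 0); first exact: is_derive_cst.
rewrite /Rintegral.
rewrite (_ : (fun x => _) = fun=> 0%E); last by apply/funext => x; rewrite mul0r.
rewrite [X in _ + fine X](_ : _ = \int[torus_measure R n]_x 0)%E.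
  by rewrite integral0 addr0.
by apply: eq_integral => x _; rewrite mul0r.
Qed.

Let gradient_bracket0l (K : state) : gradient_bracket (0 : state) K = 0.
Proof.
rewrite /gradient_bracket (_ : (fun x => _) = fun=> 0).
  by rewrite Rintegral_cst// mul0r.
by apply/funext => x; rewrite !mul0r subrr.
Qed.

Let gradient_bracket0r (K : state) : gradient_bracket K (0 : state) = 0.
Proof.
rewrite /gradient_bracket (_ : (fun x => _) = fun=> 0).
  by rewrite Rintegral_cst// mul0r.
by apply/funext => x; rewrite !mulr0 subrr.
Qed.

Theorem has_bracket_calI (a b : bool) nu la w : Lambda n nu -> Lambda n la -> inH 2 w ->
  has_bracket (fun y : state => (calI a nu y)%:C) (fun y : state => (calI b la y)%:C) w 0.
Proof.
move=> Ln Ll Hw; have Hw1 : inH 1 w := inH_le (isT : (1 <= 2)%N) Hw.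
have [G [K [gG gK GK]]] := commuting_calI a b Ln Ll Hw.
exists G, 0, K, 0; split.
- exact: gG.
- exact: (gradient_cst (c := 0)).
- exact: gK.
- exact: (gradient_cst (c := 0)).
by rewrite GK !gradient_bracket0r gradient_bracket0l subr0 addr0.
Qed.

Let tw w j : R := Im (cf false w j * conjc (cf true w j)).

Let momentumE w j : inH 1 w -> momentum j w = 0 +i* tw w j.
Proof.
move=> Hw; rewrite /momentum /tw -/(cf false w j) -/(cf true w j).
rewrite -/(cf false w (- j)) -/(cf true w (- j)) !(cfN _ _ Hw).
case: (cf false w j) (cf true w j) => a b [c d]; simpc => /=.
by congr (_ +i* _); field.
Qed.

(* The sign with which the modes k = j and k = - j enter; real coefficients odd
   in k, times i, give a real function. *)
Let sg j k : R := (j == k)%:R - (j == - k)%:R.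

Let sgN j k : sg j (- k) = - sg j k.
Proof. by rewrite /sg opprK opprB. Qed.

Let sumZ_sg j (a : Zn -> R) : j != 0 -> sumZ (fun k => a k * sg j k) = a j - a (- j).
Proof.
move=> j0; apply: sumZE; apply: cvg_near_cst; exists (nfreq j) => // N /= jN.
have -> : psum (fun k => a k * sg j k) N =
    psum (fun k => a k * (j == k)%:R) N - psum (fun k => a k * (j == - k)%:R) N.
  by rewrite /psum -sumrB; apply: eq_bigr => k _; rewrite mulrBr.
by rewrite psum_delta psum_deltaN mem_bl j0 jN.
Qed.

Let momentum_coef (s : R) (b : bool) j w : inH 1 w ->
  exists2 g, L2zero g & forall k, fcoef g k =
    (fun k => (0 +i* (s * sg j k)) * cf b w k) k.
Proof.
move=> Hw; have [u0 v0] := Hw; apply: riesz_fischer.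
- move=> k; rewrite sgN (cfN _ _ Hw); case: (cf b w k) => p q; simpc => /=.
  by congr (_ +i* _); ring.
- have -> : cf b w 0 = 0; last by rewrite mulr0.
  rewrite /cf; case: b => /=.
    exact: L2zero_fcoef0 (sobolev_L2zero v0).
  exact: L2zero_fcoef0 (sobolev_L2zero u0).
have sb : summ (fun k => rp (cf b w k) (cf b w k)).
  by rewrite /cf; case: b; [exact: L2zero_summ (sobolev_L2zero v0)|exact: L2zero_summ (sobolev_L2zero u0)].
apply: summ_le (summZ ((2 * s) ^+ 2) sb) => k _.
rewrite ger0_norm ?rp_ge0// rp_imul ler_wpM2r ?rp_ge0// !exprMn mulrC.
rewrite ler_wpM2r ?sqr_ge0// /sg.
by case: (j == k); case: (j == - k); rewrite /= !expr2; lra.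
Qed.

Let momentum_gradient j w : j != 0 -> inH 1 w -> exists2 K : state,
  is_L2gradient (fun y : state => Im (momentum j y)) w K &
  (forall k, fcoef K.1 k = (0 +i* (2^-1 * sg j k)) * cf true w k) /\
  (forall k, fcoef K.2 k = (0 +i* (- 2^-1 * sg j k)) * cf false w k).
Proof.
move=> j0 Hw.
have [K1 L1 c1] := momentum_coef (2^-1) true j Hw.
have [K2 L2 c2] := momentum_coef (- 2^-1) false j Hw.
exists (K1, K2); last by split; [exact: c1|exact: c2].
split; [exact: L1|exact: L2|] => h Hh.
have E (t : R) : Im (momentum j (w + t *: h)) =
   tw w j + (t * Im (cf false h j * conjc (cf true w j) + cf false w j * conjc (cf true h j))
    + t * (t * tw h j)).
  rewrite (momentumE _ (inHD Hw (inHZ t Hh))) -[LHS]/(tw _ _) /tw [w + _]addrC !(cf_lincomb _ _ _ Hh Hw).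
  case: (cf false w j) (cf true w j) (cf false h j) (cf true h j) => a b [c d] [e f] [p q].
  by simpc => /=; ring.
rewrite (funext E); apply: is_derive_eq.
rewrite -[X in _ = X + _]/(ip (torus_measure R n) K1 h.1) -[X in _ = _ + X]/(ip (torus_measure R n) K2 h.2).
have [Lh1 Lh2] := inH_L2 Hh.
have s1 := summ_rp (L2zero_summ L1) (L2zero_summ (sobolev_L2zero Hh.1)).
have s2 := summ_rp (L2zero_summ L2) (L2zero_summ (sobolev_L2zero Hh.2)).
rewrite (parseval L1 Lh1) (parseval L2 Lh2) -(sumZD s1 s2).
pose a k := 2^-1 * (rp ((0 +i* 1) * cf true w k) (cf false h k)
                    - rp ((0 +i* 1) * cf false w k) (cf true h k)).
have aN : a (- j) = - a j.
  rewrite /a !(cfN _ _ Hw) !(cfN _ _ Hh).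
  case: (cf false w j) (cf true w j) (cf false h j) (cf true h j) => p q [c d] [e f] [r s].
  by simpc => /=; rewrite !rpE /=; ring.
transitivity (a j - a (- j)).
  rewrite aN /a.
  case: (cf false w j) (cf true w j) (cf false h j) (cf true h j) => p q [c d] [e f] [r s].
  by simpc => /=; rewrite !rpE /= /GRing.scale /=; field.
rewrite -(sumZ_sg a j0); apply: eq_sumZ => k _; rewrite c1 c2 /a -/(cf false h k) -/(cf true h k).
case: (cf false w k) (cf true w k) (cf false h k) (cf true h k) => p q [c d] [e f] [r s].
by simpc => /=; rewrite !rpE /=; field.
Qed.

(** The momentum is i Im (u_j conj v_j): it generates rotations of the modes j and
    - j by opposite angles, and the moments are invariant under rotations.  In
    terms of gradients: those of the momentum are i times real multiples of v_k
    and u_k, while those of the first integrals are real combinations of u_k and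
    v_k. *)
Theorem has_bracket_momentum (a : bool) nu j w : Lambda n nu -> j != 0 -> inH 2 w ->
  has_bracket (fun y : state => (calI a nu y)%:C) (momentum j) w 0.
Proof.
move=> Ln j0 Hw; have Hw1 : inH 1 w := inH_le (isT : (1 <= 2)%N) Hw.
have [G [fx [fy [fz gG]]] iG] : exists2 G,
    (exists fx fy fz, symbol_gradient w fx fy fz G) & is_L2gradient (@calI R n a nu) w G.
  case: a => /=.
    by have [G gG iG] := grad_I2 Ln Hw; exists G => //; do 3 eexists; exact: gG.
  by have [G gG iG] := grad_I1 Ln Hw; exists G => //; do 3 eexists; exact: gG.
have [K iK [k1 k2]] := momentum_gradient j0 Hw1.
exists G, 0, 0, K; split.
- exact: iG.
- exact: (gradient_cst (c := 0)).
- by apply: (gradient_cst (c := 0)) => // y Hy; rewrite momentumE.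
- exact: iK.
have [G1 G2 g1 g2] := gG; have [K1 K2 _] := iK.
have GK : gradient_bracket G K = 0.
  rewrite (gradient_bracketE G1 G2 K1 K2); apply: etrans (sumZ0 R n).
  apply: eq_sumZ => k _; rewrite g1 g2 k1 k2.
  by case: (cf false w k) (cf true w k) => p q [c d]; simpc => /=; rewrite !rpE /=; ring.
by rewrite GK !gradient_bracket0r !gradient_bracket0l subr0 addr0.
Qed.

End commutation.

(** * Double sums over pairs of frequencies *)

Section pair_sums.
Variables (R : realType) (n : nat).
Local Notation Zn := 'rV[int]_n.
Implicit Types (j k : Zn) (a b p q x y z : Zn -> R) (K : Zn -> Zn -> R).

Lemma sumZ_tail a b N : summ b -> (forall j, j != 0 -> `|a j| <= b j) ->
  `|sumZ a - psum a N| <= sumZ b - psum b N.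
Proof.
move=> sb ab; have sa := summ_le ab sb.
have tail (c : R) : `|c| <= 1 -> c * (sumZ a - psum a N) <= sumZ b - psum b N.
  move=> c1.
  have ge0 j : j != 0 -> 0 <= b j + - c * a j.
    move=> j0; rewrite mulNr subr_ge0; apply: le_trans (ler_norm _) _.
    rewrite normrM; apply: le_trans (ab j j0).
    by rewrite ler_piMl.
  have := psum_le_sumZ N (summD sb (summZ (- c) sa)) ge0.
  rewrite (sumZD sb (summZ (- c) sa)) (sumZZ _ sa).
  rewrite /psum big_split /= -mulr_sumr.
  move: (sumZ a) (sumZ b) (\sum_(i <- _) a i) (\sum_(i <- _) b i) => A B A' B'.
  by lra.
rewrite ler_norml; have := tail 1; have := tail (-1); rewrite normrN normr1 lexx.
move=> /(_ isT) t1 /(_ isT) t2; apply/andP; split; last by rewrite mul1r in t2.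
by rewrite lerNl -mulN1r.
Qed.

(** The difference between the iterated sum and the sum over ball x ball is
    controlled by the tails of q and q', because the bound on K factorizes. *)
Lemma double_sum (p q p' q' : Zn -> R) K :
  summ p -> summ q -> summ p' -> summ q' ->
  (forall j, j != 0 -> 0 <= p j) -> (forall j, j != 0 -> 0 <= p' j) ->
  (forall j k, j != 0 -> k != 0 -> `|K j k| <= p j * q k + p' j * q' k) ->
  [/\ forall j, j != 0 -> summ (K j), summ (fun j => sumZ (K j)) &
  (fun N => psum (fun j => psum (K j) N) N) @ \oo --> sumZ (fun j => sumZ (K j))].
Proof.
move=> sp sq sp' sq' p0 p'0 Kb.
have sb j : summ (fun k => p j * q k + p' j * q' k).
  exact: summD (summZ (p j) sq) (summZ (p' j) sq').
have sbE j : sumZ (fun k => p j * q k + p' j * q' k) = p j * sumZ q + p' j * sumZ q'.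
  by rewrite (sumZD (summZ (p j) sq) (summZ (p' j) sq')) (sumZZ _ sq) (sumZZ _ sq').
have sK : summ (fun j => sumZ (K j)).
  apply: summ_le (summD (summZ (sumZ q) sp) (summZ (sumZ q') sp')) => j j0.
  rewrite [sumZ q * _]mulrC [sumZ q' * _]mulrC -sbE.
  apply: (le_norm_sumZ (sb j)) => k k0; exact: Kb.
split=> //; first by move=> j j0; apply: summ_le (sb j) => k; exact: Kb.
pose t N := sumZ q - psum q N; pose t' N := sumZ q' - psum q' N.
pose e N := sumZ p * `|t N| + sumZ p' * `|t' N|.
have e0 : e @ \oo --> (0 : R).
  have tail f : summ f -> (fun N => `|sumZ f - psum f N|) @ \oo --> (0 : R).
    move=> sf; apply/norm_cvg0P; rewrite -[X in _ --> X](subrr (sumZ f)).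
    by apply: cvgB; [exact: cvg_cst|exact: cvg_psum].
  rewrite -[X in _ --> X](addr0 (0 : R)).
  rewrite -[X in _ --> (X + _)](mulr0 (sumZ p)) -[X in _ --> (_ + X)](mulr0 (sumZ p')).
  by apply: cvgD; (apply: cvgM; [exact: cvg_cst|exact: tail]).
have d0 : (fun N => psum (fun j => sumZ (K j)) N - psum (fun j => psum (K j) N) N)
    @ \oo --> (0 : R).
  apply/norm_cvg0P; apply: (squeeze_cvgr _ (cvg_cst 0) e0); apply: nearW => N.
  rewrite normr_ge0 /= /psum -sumrB; apply: le_trans (ler_norm_sum _ _ _) _.
  apply: (@le_trans _ _ (psum (fun j => p j * `|t N| + p' j * `|t' N|) N)); last first.
    rewrite /psum big_split /= -!mulr_suml /e.
    by apply: lerD; rewrite ler_wpM2r// psum_le_sumZ.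
  apply: (@le_psum _ _ (fun j => `|sumZ (K j) - psum (K j) N|)) => j j0.
  apply: (@le_trans _ _ (sumZ (fun k => p j * q k + p' j * q' k)
      - psum (fun k => p j * q k + p' j * q' k) N)).
    by apply: (sumZ_tail N (sb j)) => k k0; exact: Kb.
  rewrite sbE /psum big_split /= -!mulr_sumr opprD addrACA -!mulrBr.
  by apply: lerD; rewrite ler_wpM2l ?ler_norm ?p0 ?p'0.
rewrite -[X in _ --> X]subr0.
rewrite (_ : (fun N => psum (fun j => psum (K j) N) N) =
  fun N => psum (fun j => sumZ (K j)) N
    - (psum (fun j => sumZ (K j)) N - psum (fun j => psum (K j) N) N)).
  by apply: cvgB d0; exact: cvg_psum.
by apply/funext => N; rewrite subKr.
Qed.

(** The part of |u_j v_k - u_k v_j|^2 that survives summation over shells, written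
    with x, y, z for the moments |u|^2, |v|^2, Re (u conj v). *)
Definition pair_weight x y z j k : R :=
  x j * y k + y j * x k - 2 * (z j * z k).

Lemma pair_weightC x y z j k : pair_weight x y z j k = pair_weight x y z k j.
Proof. by rewrite /pair_weight; ring. Qed.

Section estimates.
Variables x y z : Zn -> R.
Hypothesis x0 : forall j, 0 <= x j.
Hypothesis y0 : forall j, 0 <= y j.
Hypothesis zxy : forall j, z j ^+ 2 <= x j * y j.
Local Notation W := (pair_weight x y z).
Local Notation nu := (freq2 R).

Lemma norm_pair_weight j k : `|W j k| <= 2 * (x j * y k) + 2 * (y j * x k).
Proof.
have p0 : 0 <= x j * y k by exact: mulr_ge0.
have q0 : 0 <= y j * x k by exact: mulr_ge0.
suff : `|2 * (z j * z k)| <= x j * y k + y j * x k.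
  by rewrite /pair_weight => zz; apply: le_trans (ler_normB _ _) _; rewrite ger0_norm; lra.
rewrite -(ler_pXn2r (n := 2)) ?nnegrE ?addr_ge0// real_normK ?num_real//.
rewrite !exprMn; have := ler_pM (sqr_ge0 _) (sqr_ge0 _) (zxy j) (zxy k).
rewrite (_ : x j * y j * (x k * y k) = x j * y k * (y j * x k)); last by ring.
move: (z j ^+ 2 * z k ^+ 2) (x j * y k) (y j * x k) => t f g H.
by have := sqr_ge0 (f - g); rewrite !expr2; lra.
Qed.

(** The two terms of the weight need different bounds on the divisor: the
    symmetric one next to x_j y_k, and next to y_j x_k the one that puts all the
    growth on the frequency of k.  With this choice the hypotheses hold for (u, v)
    in H^(m + 1), or in H^2 when m = 0. *)
Lemma double_sum_cc (m : nat) :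
  summ (fun j => nu j ^+ m.+1 * x j) -> summ (fun j => nu j ^+ m * y j) ->
  summ (fun j => nu j ^+ 2 * x j) -> summ (fun j => nu j ^+ 1 * y j) ->
  let K j k := nu j ^+ m * (cc (nu j) (nu k) * W j k) in
  [/\ forall j, j != 0 -> summ (K j), summ (fun j => sumZ (K j)) &
  (fun N => psum (fun j => psum (K j) N) N) @ \oo --> sumZ (fun j => sumZ (K j))].
Proof.
move=> sx sy s2 s1 K.
apply: (double_sum (summZ 2 sx) s1 (summZ 2 sy) (summZ 2 s2)) => [j _|j _|j k j0 k0].
- by rewrite mulr_ge0 ?mulr_ge0 ?exprn_ge0 ?freq2_ge0.
- by rewrite mulr_ge0 ?mulr_ge0 ?exprn_ge0 ?freq2_ge0.
have Lj : Lambda n (nu j) by exists j.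
have Lk : Lambda n (nu k) by exists k.
have [c1 _] := norm_cc Lj Lk; have [_ c2] := norm_cc Lk Lj.
rewrite ccC normrN in c2.
have nj := freq2_ge1 R j0; have nk := freq2_ge1 R k0.
have m0 : 0 <= nu j ^+ m by rewrite exprn_ge0 ?freq2_ge0.
have p0 : 0 <= x j * y k by exact: mulr_ge0.
have q0 : 0 <= y j * x k by exact: mulr_ge0.
rewrite /K normrM (ger0_norm m0) normrM.
have cW : `|cc (nu j) (nu k)| * `|W j k| <=
    2 * (nu j * nu k * (x j * y k)) + 2 * (2 * nu k ^+ 2 * (y j * x k)).
  apply: le_trans (ler_wpM2l (normr_ge0 _) (norm_pair_weight j k)) _.
  rewrite mulrDr; apply: lerD; rewrite mulrCA ler_wpM2l//; apply: ler_wpM2r => //.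
  by apply: le_trans c2 _; rewrite expr2; nra.
apply: le_trans (ler_wpM2l m0 cW) _.
rewrite [nu j ^+ m.+1]exprS expr1 le_eqVlt; apply/orP; left; apply/eqP.
by ring.
Qed.

Lemma double_sum_ind (m : nat) :
  summ (fun j => nu j ^+ m * x j) -> summ y ->
  let K j k := nu j ^+ m * (2^-1 * (ind (nu j) (nu k) * W j k)) in
  [/\ forall j, j != 0 -> summ (K j), summ (fun j => sumZ (K j)) &
  (fun N => psum (fun j => psum (K j) N) N) @ \oo --> sumZ (fun j => sumZ (K j))].
Proof.
move=> sx sy K.
apply: (double_sum sx sy sy sx) => [j _|j _|j k j0 k0].
- by rewrite mulr_ge0 ?exprn_ge0 ?freq2_ge0.
- exact: y0.
have r0 i k' : 0 <= nu i ^+ m * x i * y k' by rewrite !mulr_ge0 ?exprn_ge0 ?freq2_ge0.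
rewrite /K /ind; case: eqP => [jk|_]; last first.
  by rewrite mul0r !mulr0 normr0; apply: addr_ge0; rewrite // mulrC.
rewrite mul1r normrM (ger0_norm (exprn_ge0 _ (freq2_ge0 _ _))).
rewrite normrM ger0_norm ?invr_ge0//.
have m0 : 0 <= nu j ^+ m by rewrite exprn_ge0 ?freq2_ge0.
have := ler_wpM2l m0 (norm_pair_weight j k).
rewrite jk; move: (nu j ^+ m) (x j) (y j) (x k) (y k) `|W j k| => a b c d e f.
by rewrite (mulrCA c a d) -mulrA mulrDr !(mulrCA a 2) => H; lra.
Qed.

(** The interaction is antisymmetric in the two frequencies. *)
Lemma psum_cc N : psum (fun j => psum (fun k => cc (nu j) (nu k) * W j k) N) N = 0.
Proof.
set S := LHS; have : S = - S; last by lra.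
rewrite {1}/S /psum exchange_big /= -sumrN; apply: eq_bigr => k _.
by rewrite -sumrN; apply: eq_bigr => j _; rewrite ccC pair_weightC mulNr.
Qed.

Let h (m : nat) (s t : R) : R := \sum_(i < m) s ^+ (m - i) * t ^+ i.+1.

(** Symmetrizing removes the divisors: the quotient of differences is a
    polynomial, and its diagonal value is what the shell terms supply. *)
Let symmetrize m (s t : R) :
  s ^+ m * cc s t + t ^+ m * cc t s + m%:R * (s ^+ m.+1 * ind s t) = h m s t.
Proof.
rewrite /ind; case: eqP => [->|/eqP ts].
  rewrite !cc_diag !mulr0 !add0r mulr1 /h mulr_natl.
  under eq_bigr => i _ do rewrite -exprD addnS subnK ?(ltnW (ltn_ord i))//.
  by rewrite sumr_const card_ord.
have st0 : s - t != 0 by rewrite subr_eq0 eq_sym.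
rewrite !mulr0 addr0 (ccC t s) mulrN -mulrBl subrXX /cc /h.
rewrite mulrC -!mulrA [X in s * (t * X)]mulrA mulVf// mul1r mulrA mulr_sumr.
apply: eq_bigr => i _.
have -> : (m - i = (m.-1 - i).+1)%N by have := ltn_ord i; lia.
by rewrite !exprS; ring.
Qed.

(** Both sides are finite sums over ball x ball.  The weight being symmetric, the
    coefficient can be symmetrized; it becomes the polynomial h, whose monomials
    split the double sum into products of simple sums. *)
Lemma psum_symmetrized m N :
  psum (fun j => psum (fun k => nu j ^+ m * (cc (nu j) (nu k) * W j k)) N) N
  + m%:R * psum (fun j => psum (fun k =>
      nu j ^+ m.+1 * (2^-1 * (ind (nu j) (nu k) * W j k))) N) N
  = \sum_(i < m) (psum (fun j => nu j ^+ (m - i) * x j) N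
                  * psum (fun j => nu j ^+ i.+1 * y j) N
                - psum (fun j => nu j ^+ (m - i) * z j) N
                  * psum (fun j => nu j ^+ i.+1 * z j) N).
Proof.
pose G j k := nu j ^+ m * (cc (nu j) (nu k) * W j k)
   + m%:R * (nu j ^+ m.+1 * (2^-1 * (ind (nu j) (nu k) * W j k))).
have GW j k : G j k + G k j = h m (nu j) (nu k) * W j k.
  rewrite -symmetrize /G (pair_weightC _ _ _ k j).
  have -> : nu k ^+ m.+1 * (2^-1 * (ind (nu k) (nu j) * W j k)) =
      nu j ^+ m.+1 * (2^-1 * (ind (nu j) (nu k) * W j k)).
    by rewrite /ind [nu j == _]eq_sym; case: eqP => [->|_]; rewrite ?mul0r ?mulr0.
  by field.
transitivity (\sum_(j <- bl n N) \sum_(k <- bl n N) G j k).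
  rewrite /psum mulr_sumr -big_split; apply: eq_bigr => j _ /=.
  by rewrite mulr_sumr -big_split; apply: eq_bigr.
transitivity (2^-1 * \sum_(j <- bl n N) \sum_(k <- bl n N) h m (nu j) (nu k) * W j k).
  set S := LHS; have -> : S = 2^-1 * (S + S) by field.
  rewrite {2}/S exchange_big /= /S -big_split; congr (_ * _); apply: eq_bigr => j _ /=.
  by rewrite -big_split; apply: eq_bigr => k _ /=; exact: GW.
pose D i := psum (fun j => nu j ^+ i * x j) N; pose B i := psum (fun j => nu j ^+ i * y j) N.
pose Q i := psum (fun j => nu j ^+ i * z j) N.
have term i i' : \sum_(j <- bl n N) \sum_(k <- bl n N) nu j ^+ i * nu k ^+ i' * W j k
    = D i * B i' + B i * D i' - 2 * (Q i * Q i').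
  rewrite /D /B /Q /psum !mulr_suml mulr_sumr -big_split -sumrB; apply: eq_bigr => j _ /=.
  rewrite !mulr_sumr -big_split -sumrB; apply: eq_bigr => k _ /=.
  by rewrite /pair_weight; ring.
transitivity (2^-1 * \sum_(i < m) (D (m - i)%N * B i.+1 + B (m - i)%N * D i.+1
     - 2 * (Q (m - i)%N * Q i.+1))).
  congr (_ * _); transitivity (\sum_(i < m) \sum_(j <- bl n N) \sum_(k <- bl n N)
      nu j ^+ (m - i) * nu k ^+ i.+1 * W j k); last by apply: eq_bigr => i _; exact: term.
  rewrite [RHS]exchange_big; apply: eq_bigr => j _ /=.
  by rewrite [RHS]exchange_big; apply: eq_bigr => k _ /=; rewrite /h mulr_suml.
rewrite sumrB big_split /=.
have -> : \sum_(i < m) B (m - i)%N * D i.+1 = \sum_(i < m) D (m - i)%N * B i.+1.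
  rewrite (reindex_inj rev_ord_inj) /=; apply: eq_bigr => i _.
  rewrite mulrC; congr (D _ * B _); have := ltn_ord i; lia.
rewrite -mulr_sumr [RHS]sumrB -/D.
move: (\sum_(i < m) _ * B _) (\sum_(i < m) _ * Q _) => a b.
by field.
Qed.

End estimates.

End pair_sums.

(** * Sums of the first integrals *)

Section sums.
Variables (R : realType) (n : nat).
Local Notation Zn := 'rV[int]_n.
Local Notation state := (state R n).
Implicit Types (w : state) (j k : Zn) (s m : nat).
Local Notation nu := (freq2 R).

Definition mode (a b : bool) w j : R := rp (cf a w j) (cf b w j).

Definition mode_weight w j k : R :=
  pair_weight (mode false false w) (mode true true w) (mode false true w) j k.

Definition moment (i : nat) (a b : bool) w : R := sumZ (fun j => nu j ^+ i * mode a b w j).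

Let x0 w j : 0 <= mode false false w j. Proof. exact: rp_ge0. Qed.
Let y0 w j : 0 <= mode true true w j. Proof. exact: rp_ge0. Qed.
Let zxy w j : mode false true w j ^+ 2 <= mode false false w j * mode true true w j.
Proof. exact: rp_CauchySchwarz. Qed.

Lemma summ_mode s i a b w : (i + (a || b) <= s)%N -> inH s w ->
  summ (fun j => nu j ^+ i * mode a b w j).
Proof.
move=> ais [u v]; rewrite /mode /cf; case: a b ais => [] [] /= ais.
- by apply: (summ_weighted_rp _ v v); lia.
- by apply: (summ_weighted_rp _ v u); lia.
- by apply: (summ_weighted_rp _ u v); lia.
- by apply: (summ_weighted_rp _ u u); lia.
Qed.

Let summ_mode0 s w : (0 < s)%N -> inH s w -> summ (mode true true w).
Proof.
move=> s0 Hw; rewrite (_ : mode _ _ _ = fun j => nu j ^+ 0 * mode true true w j).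
  exact: summ_mode Hw.
by apply/funext => j; rewrite mul1r.
Qed.

Lemma I1_shell (la : R) w : Lambda n la -> inH 1 w ->
  I1 la w = \sum_(j \in @shell R n la)
    (blockA w * (nu j * mode false false w j) + mode true true w j
     + sumZ (fun k => cc (nu j) (nu k) * mode_weight w j k)).
Proof.
move=> Ll Hw; apply: eq_fsbigr => j /set_mem jla; have [_ jE] := jla.
rewrite (interaction_sum Ll Hw jla).2 !normc_sqr -jE; congr (_ + _ + _); first by rewrite mulrA.
rewrite -jE in Ll.
have sy := summ_form (adm_cc true true Ll) Hw Hw.
have sx := summ_form (adm_cc false false Ll) Hw Hw.
have sz := summ_form (adm_cc false true Ll) Hw Hw.
rewrite !formE -(sumZZ _ sy) -(sumZZ _ sx) -(sumZZ _ sz) -(sumZZ 2 (summZ _ sz)).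
rewrite -(sumZD (summZ _ sy) (summZ _ sx)) -[X in _ - X]mul1r -mulNr.
rewrite -(sumZZ (- 1) (summZ 2 (summZ _ sz))).
rewrite -(sumZD (summD (summZ _ sy) (summZ _ sx)) (summZ _ (summZ _ (summZ _ sz)))).
by apply: eq_sumZ => k _; rewrite /mode_weight /pair_weight /mode; ring.
Qed.

Lemma I2_shell (la : R) w : Lambda n la -> inH 1 w ->
  I2 la w = \sum_(j \in @shell R n la)
    sumZ (fun k => 2^-1 * (ind (nu j) (nu k) * mode_weight w j k)).
Proof.
move=> Ll Hw; rewrite (I2E Ll Hw).
transitivity (\sum_(j \in @shell R n la)
  (2^-1 * (mode false false w j * form (ind la) true true w w
    + mode true true w j * form (ind la) false false w w
    - 2 * (mode false true w j * form (ind la) false true w w)))).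
  have [N laN] := natP la.
  have sE a b : form (ind la) a b w w = \sum_(j <- bl n N | nu j == la) mode a b w j.
    by rewrite formE sumZ_ind (sum_shell _ laN).
  rewrite (sum_shell _ laN) -mulr_sumr sumrB big_split /= -mulr_sumr -!mulr_suml -!sE.
  move: (form _ false false w w) (form _ true true w w) (form _ false true w w) => X Y Z.
  by field.
apply: eq_fsbigr => j /set_mem[_ jE]; rewrite jE.
have sy := summ_form (adm_ind n la true true) Hw Hw.
have sx := summ_form (adm_ind n la false false) Hw Hw.
have sz := summ_form (adm_ind n la false true) Hw Hw.
rewrite !formE -(sumZZ _ sy) -(sumZZ _ sx) -(sumZZ _ sz) -(sumZZ 2 (summZ _ sz)).
rewrite -(sumZD (summZ _ sy) (summZ _ sx)) -[X in _ - X]mul1r -mulNr.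
rewrite -(sumZZ (- 1) (summZ 2 (summZ _ sz))).
rewrite -(sumZD (summD (summZ _ sy) (summZ _ sx)) (summZ _ (summZ _ (summZ _ sz)))).
rewrite -(sumZZ _ (summD (summD (summZ _ sy) (summZ _ sx)) (summZ _ (summZ _ (summZ _ sz))))).
by apply: eq_sumZ => k _; rewrite /mode_weight /pair_weight /mode; ring.
Qed.

Let shell_weight m (la : R) (a : Zn -> R) :
  la ^+ m * \sum_(j \in @shell R n la) a j = \sum_(j \in @shell R n la) nu j ^+ m * a j.
Proof.
have [N laN] := natP la; rewrite !(sum_shell _ laN) mulr_sumr.
by apply: eq_bigr => j /eqP ->.
Qed.

(** Over all modes the terms of I1 with A and |v_j|^2 give moments; the interactions
    give a double sum whose inner sum is over all the other modes. *)
Lemma I1_sum s m w : (1 < s)%N -> (m < s)%N -> inH s w ->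
  let K j k := nu j ^+ m * (cc (nu j) (nu k) * mode_weight w j k) in
  abs_summable (Lambda n) (fun la => la ^+ m * I1 la w) /\
  asum (Lambda n) (fun la => la ^+ m * I1 la w) =
    blockA w * moment m.+1 false false w + moment m true true w + sumZ (fun j => sumZ (K j)).
Proof.
move=> s1 ms Hw K; have Hw1 := inH_le (ltnW s1) Hw.
have sx : summ (fun j => nu j ^+ m.+1 * mode false false w j).
  by apply: summ_mode Hw; rewrite addn0.
have sy : summ (fun j => nu j ^+ m * mode true true w j).
  by apply: summ_mode Hw; rewrite addn1.
have [sK sKK _] : [/\ forall j, j != 0 -> summ (K j), summ (fun j => sumZ (K j)) &
    (fun N => psum (fun j => psum (K j) N) N) @ \oo --> sumZ (fun j => sumZ (K j))].
  apply: (double_sum_cc (x0 w) (y0 w) (zxy w) sx sy).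
    by apply: summ_mode Hw.
  by apply: summ_mode Hw.
pose a j := blockA w * (nu j ^+ m.+1 * mode false false w j)
  + nu j ^+ m * mode true true w j + sumZ (K j).
have sa : summ a by exact: summD (summD (summZ _ sx) sy) sKK.
have [|H1 H2] := @Lambda_sum R n (fun la => la ^+ m * I1 la w) a sa.
  move=> la Ll; rewrite (I1_shell Ll Hw1) shell_weight.
  apply: eq_fsbigr => j /set_mem[j0 jla]; have Lj : Lambda n (nu j) by exists j.
  have sc : summ (fun k => cc (nu j) (nu k) * mode_weight w j k).
    have -> : (fun k => cc (nu j) (nu k) * mode_weight w j k) = fun k => nu j ^- m * K j k.
      apply/funext => k; rewrite /K mulKf// expf_neq0// gt_eqF//.
      exact: lt_le_trans ltr01 (freq2_ge1 R j0).
    exact: summZ (sK j j0).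
  rewrite /a /K (sumZZ _ sc) exprSr; move: (sumZ _) => S; ring.
split=> //; rewrite H2 (sumZD (summD (summZ _ sx) sy) sKK).
by rewrite (sumZD (summZ _ sx) sy) (sumZZ _ sx).
Qed.

Lemma I2_sum s m w : (0 < s)%N -> (m <= s)%N -> inH s w ->
  let K j k := nu j ^+ m * (2^-1 * (ind (nu j) (nu k) * mode_weight w j k)) in
  abs_summable (Lambda n) (fun la => la ^+ m * I2 la w) /\
  asum (Lambda n) (fun la => la ^+ m * I2 la w) = sumZ (fun j => sumZ (K j)).
Proof.
move=> s0 ms Hw K; have Hw1 := inH_le s0 Hw.
have [sK sKK _] : [/\ forall j, j != 0 -> summ (K j), summ (fun j => sumZ (K j)) &
    (fun N => psum (fun j => psum (K j) N) N) @ \oo --> sumZ (fun j => sumZ (K j))].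
  apply: (double_sum_ind (x0 w) (y0 w) (zxy w)).
    by apply: summ_mode Hw; rewrite addn0.
  exact: summ_mode0 Hw.
apply: Lambda_sum => // la Ll; rewrite (I2_shell Ll Hw1) shell_weight.
apply: eq_fsbigr => j /set_mem[j0 jla]; have Lj : Lambda n (nu j) by exists j.
rewrite /K sumZZ//.
have -> : (fun k => 2^-1 * (ind (nu j) (nu k) * mode_weight w j k)) =
    fun k => nu j ^- m * K j k.
  apply/funext => k; rewrite /K mulKf// expf_neq0// gt_eqF//.
  exact: lt_le_trans ltr01 (freq2_ge1 R j0).
exact: summZ (sK j j0).
Qed.

Lemma blockDE i w : inH i w -> blockD i w = moment i false false w.
Proof. by move=> [u _]; rewrite /blockD nabla_dotE. Qed.

Lemma blockBE i w : inH i w -> blockB i w = moment i.-1 true true w.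
Proof. by move=> [_ v]; rewrite /blockB nabla_dotE. Qed.

Lemma blockQE i w : inH i w -> blockQ i w = moment i.-1 false true w.
Proof.
by move=> [u v]; rewrite /blockQ (nabla_dotE (sobolev_le (leq_pred i) u) v).
Qed.

(** The limit of psum_symmetrized along balls. *)
Lemma sum_pairs m w : (0 < m)%N -> inH m.+1 w ->
  sumZ (fun j => sumZ (fun k => nu j ^+ m * (cc (nu j) (nu k) * mode_weight w j k)))
  + m%:R * sumZ (fun j => sumZ (fun k =>
       nu j ^+ m.+1 * (2^-1 * (ind (nu j) (nu k) * mode_weight w j k))))
  = \sum_(i < m) (moment (m - i) false false w * moment i.+1 true true w
                - moment (m - i) false true w * moment i.+1 false true w).
Proof.
move=> m0 Hw.
have [_ _ c1] := double_sum_cc (x0 w) (y0 w) (zxy w)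
  (summ_mode (s := m.+1) (i := m.+1) (a := false) (b := false) (eq_leq (addn0 _)) Hw)
  (summ_mode (s := m.+1) (i := m) (a := true) (b := true) (eq_leq (addn1 _)) Hw)
  (summ_mode (s := m.+1) (i := 2) (a := false) (b := false) m0 Hw)
  (summ_mode (s := m.+1) (i := 1) (a := true) (b := true) m0 Hw).
have [_ _ c2] := double_sum_ind (x0 w) (y0 w) (zxy w)
  (summ_mode (s := m.+1) (i := m.+1) (a := false) (b := false) (eq_leq (addn0 _)) Hw)
  (summ_mode0 (ltn0Sn m) Hw).
pose F N := \sum_(i < m)
     (psum (fun j => nu j ^+ (m - i) * mode false false w j) N
        * psum (fun j => nu j ^+ i.+1 * mode true true w j) N
      - psum (fun j => nu j ^+ (m - i) * mode false true w j) N
        * psum (fun j => nu j ^+ i.+1 * mode false true w j) N).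
have c3 : F @ \oo --> \sum_(i < m) (moment (m - i) false false w * moment i.+1 true true w
                - moment (m - i) false true w * moment i.+1 false true w).
  apply: cvg_big => [|i _]; first exact: add_continuous.
  have mi : (m - i <= m)%N := leq_subr i m.
  have im : (i < m)%N := ltn_ord i.
  apply: cvgB; apply: cvgM; apply: cvg_psum; apply: summ_mode Hw; lia.
rewrite -(cvg_lim _ c3)//; apply/esym/cvg_lim => //.
rewrite (_ : F = fun N => psum (fun j => psum (fun k =>
       nu j ^+ m * (cc (nu j) (nu k) * mode_weight w j k)) N) N
     + m%:R * psum (fun j => psum (fun k =>
       nu j ^+ m.+1 * (2^-1 * (ind (nu j) (nu k) * mode_weight w j k))) N) N).
  by apply: cvgD; [exact: c1|apply: cvgM; [exact: cvg_cst|exact: c2]].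
by apply/funext => N; rewrite psum_symmetrized.
Qed.

End sums.

(** * The Hamiltonian and the functionals J_k *)

Section sum_identities.
Variables (R : realType) (n : nat).
Local Notation state := (state R n).
Implicit Types (w : state) (i k p : nat).

(** By antisymmetry the partial sums over ball x ball all vanish. *)
Lemma sumZ_cc w : inH 2 w ->
  sumZ (fun j : 'rV[int]_n => sumZ (fun k : 'rV[int]_n => freq2 R j ^+ 0 * (cc (freq2 R j) (freq2 R k) * mode_weight w j k)))
  = 0.
Proof.
move=> Hw.
have [_ _ c1] := double_sum_cc (m := 0)
  (fun j => rp_ge0 (cf false w j)) (fun j => rp_ge0 (cf true w j))
  (fun j => rp_CauchySchwarz (cf false w j) (cf true w j))
  (summ_mode (s := 2) (i := 1) (a := false) (b := false) isT Hw)
  (summ_mode (s := 2) (i := 0) (a := true) (b := true) isT Hw)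
  (summ_mode (s := 2) (i := 2) (a := false) (b := false) isT Hw)
  (summ_mode (s := 2) (i := 1) (a := true) (b := true) isT Hw).
rewrite -(cvg_lim _ c1)//; apply: cvg_lim => //.
rewrite (_ : (fun N => _) = fun=> 0); first exact: cvg_cst.
apply/funext => N.
rewrite -[RHS](@psum_cc R n (mode false false w) (mode true true w) (mode false true w) N).
by rewrite /psum; apply: eq_bigr => j _; apply: eq_bigr => k _; rewrite mul1r.
Qed.

Let moment1_ge0 w : inH 1 w -> 0 <= moment 1 false false w.
Proof.
move=> Hw; apply: sumZ_ge0 => [|j _]; first exact: summ_mode Hw.
by rewrite mulr_ge0 ?exprn_ge0 ?freq2_ge0 ?rp_ge0.
Qed.

Let blockA_moment w : inH 1 w -> blockA w = (1 + moment 1 false false w)^-1.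
Proof. by move=> Hw; rewrite /blockA blockDE. Qed.

(** The interactions cancel in the sum over all frequencies, which leaves
    A D_1 + B_1 = 1 - A + B_1. *)
Theorem Hamiltonian_sum w : inH 2 w ->
  abs_summable (Lambda n) (fun nu => I1 nu w) /\
  Hamiltonian w = 2^-1 * (asum (Lambda n) (fun nu => I1 nu w) - 1).
Proof.
move=> Hw; have Hw1 := inH_le (isT : (1 <= 2)%N) Hw.
have [] := @I1_sum R n 2 0 w isT isT Hw.
rewrite (_ : (fun la : R => la ^+ 0 * I1 la w) = fun la => I1 la w); last first.
  by apply/funext => la; rewrite mul1r.
move=> sI ->; split=> //; rewrite sumZ_cc// addr0.
rewrite /Hamiltonian -[X in 2^-1 * X - _]/(blockB 1 w) -[X in _ - _ * (1 + X)^-1 = _]/(blockD 1 w).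
rewrite (blockBE Hw1) (blockDE Hw1) (blockA_moment Hw1) /=.
have D0 := moment1_ge0 Hw1.
move: (moment 1 _ _ w) (moment 0 _ _ w) D0 => D B D0.
by field; rewrite gt_eqF//; lra.
Qed.

Let blockEF i (j : nat) w : inH 1 w ->
  blockE i w * blockE j w - blockF i w * blockF j w
  = 2 * (blockB i w * blockD j w + blockD i w * blockB j w).
Proof.
move=> Hw; have D0 := moment1_ge0 Hw.
rewrite /blockE /blockF (blockA_moment Hw).
move: (blockB i w) (blockB j w) (blockD i w) (blockD j w) (moment 1 _ _ w) D0 => a b c d D D0.
by field; rewrite gt_eqF//; lra.
Qed.

(* With E_i E_j - F_i F_j = 2 (B_i D_j + D_i B_j) the sum over 2 <= j < k becomes,
   by the symmetry j -> k + 1 - j, the sum of the products B_j D_(k+1-j); the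
   missing product j = k is the term B_k D_1 of E_k = B_k (1 + D_1) + A D_k. *)
Let blockJE p w : inH p.+2 w -> blockJ p.+2 w =
  blockA w * moment p.+2 false false w + moment p.+1 true true w
  + \sum_(i < p.+1) (moment (p.+1 - i) false false w * moment i.+1 true true w
                - moment (p.+1 - i) false true w * moment i.+1 false true w).
Proof.
move=> Hw; have Hw1 : inH 1 w := inH_le (ltn0Sn p.+1) Hw.
pose d i := moment i false false w; pose b i := moment i true true w.
pose q i := moment i false true w.
have dE i : (i <= p.+2)%N -> blockD i w = d i by move=> ip; exact: blockDE (inH_le ip Hw).
have bE i : (i <= p.+2)%N -> blockB i w = b i.-1 by move=> ip; exact: blockBE (inH_le ip Hw).
have qE i : (i <= p.+2)%N -> blockQ i w = q i.-1 by move=> ip; exact: blockQE (inH_le ip Hw).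
have Qs : \sum_(2 <= j < p.+3) blockQ j w * blockQ (p.+2 + 2 - j) w
    = \sum_(i < p.+1) q (p.+1 - i)%N * q i.+1.
  rewrite -[2%N]add0n big_addn subn2 /= big_mkord; apply: eq_bigr => i _.
  have ip := ltn_ord i; rewrite !qE; [|lia|lia].
  by rewrite mulrC; congr (q _ * q _); lia.
have EFs : 4^-1 * \sum_(2 <= j < p.+2) (blockE j w * blockE (p.+2 + 1 - j) w
      - blockF j w * blockF (p.+2 + 1 - j) w)
    = \sum_(i < p) d (p.+1 - i)%N * b i.+1.
  transitivity (2^-1 * (\sum_(i < p) d (p.+1 - i)%N * b i.+1
       + \sum_(i < p) d i.+2 * b (p - i)%N)).
    rewrite -big_split mulr_sumr -[2%N]add0n big_addn subn2 /= big_mkord mulr_sumr.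
    apply: eq_bigr => i _ /=; have ip := ltn_ord i.
    rewrite (blockEF _ _ Hw1) !dE ?bE; [|lia|lia|lia|lia].
    have -> : (i + (0 + 2)).-1 = i.+1 by lia.
    have -> : (p.+2 + 1 - (i + (0 + 2)) = p.+1 - i)%N by lia.
    have -> : (p.+1 - i).-1 = (p - i)%N by lia.
    have -> : (i + (0 + 2) = i.+2)%N by lia.
    by field.
  have -> : \sum_(i < p) d i.+2 * b (p - i)%N = \sum_(i < p) d (p.+1 - i)%N * b i.+1.
    rewrite (reindex_inj rev_ord_inj) /=; apply: eq_bigr => i _.
    by have ip := ltn_ord i; congr (d _ * b _); lia.
  by field.
have -> : \sum_(i < p.+1) (d (p.+1 - i)%N * b i.+1 - q (p.+1 - i)%N * q i.+1)
    = \sum_(i < p) d (p.+1 - i)%N * b i.+1 + d 1%N * b p.+1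
      - \sum_(i < p.+1) q (p.+1 - i)%N * q i.+1.
  by rewrite sumrB [X in X - _]big_ord_recr /= subSnn.
have D0 : 0 <= d 1%N := moment1_ge0 Hw1.
rewrite /blockJ Qs EFs /blockE dE// bE// (blockA_moment Hw1) /= -/(d p.+2) -/(b p.+1) -/(d 1%N).
move: (\sum_(i < p) _) (\sum_(i < p.+1) _) (d 1%N) (d p.+2) (b p.+1) D0 => S T D Dp B D0.
by field; rewrite gt_eqF//; lra.
Qed.

Theorem blockJ_sum k w : (2 <= k)%N -> inH k w ->
  [/\ abs_summable (Lambda n) (fun nu : R => nu ^+ k.-1 * I1 nu w),
      abs_summable (Lambda n) (fun nu : R => nu ^+ k * I2 nu w) &
      blockJ k w = asum (Lambda n) (fun nu : R => nu ^+ k.-1 * I1 nu w)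
        + k.-1%:R * asum (Lambda n) (fun nu : R => nu ^+ k * I2 nu w)].
Proof.
case: k => [//|[//|p]] _ Hw /=.
have [s1 ->] := @I1_sum R n p.+2 p.+1 w isT (leqnn _) Hw.
have [s2 ->] := @I2_sum R n p.+2 p.+2 w isT (leqnn _) Hw.
split=> //; rewrite (blockJE Hw) -(sum_pairs (ltn0Sn p) Hw).
by rewrite addrA.
Qed.

End sum_identities.

Theorem theorem1p1 (R : realType) (n : nat) (n_gt0 : (0 < n)%N) :
  [/\ forall nu : R, Lambda n nu ->
        [/\ forall (w : state R n) (j : 'rV[int]_n), inH 1 w -> shell nu j ->
              abs_summable (Lambda n `\ nu) (interaction w nu j),
            exists P Q : state R n -> R,
              [/\ bounded_polynomial P, bounded_polynomial Q &
                  forall w : state R n, inH 1 w ->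
                    I1 nu w = blockA w * P w + Q w],
            bounded_polynomial (@I2 R n nu),
            analytic (@I1 R n nu) &
            analytic (@I2 R n nu)],
      forall w : state R n, inH 3 w ->
        (forall (a b : bool) (nu nu' : R), Lambda n nu -> Lambda n nu' ->
           has_bracket (fun y : state R n => (calI a nu y)%:C)
                       (fun y : state R n => (calI b nu' y)%:C) w 0) /\
        (forall (a : bool) (nu : R) (j : 'rV[int]_n), Lambda n nu -> j != 0 ->
           has_bracket (fun y : state R n => (calI a nu y)%:C)
                       (momentum j) w 0),
      forall w : state R n, inH 2 w ->
        abs_summable (Lambda n) (fun nu => I1 nu w) /\
        Hamiltonian w = 2^-1 * (asum (Lambda n) (fun nu => I1 nu w) - 1) &
      forall (k : nat) (w : state R n), (2 <= k)%N -> inH k w ->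
        [/\ abs_summable (Lambda n) (fun nu => nu ^+ k.-1 * I1 nu w),
            abs_summable (Lambda n) (fun nu => nu ^+ k * I2 nu w) &
            blockJ k w =
              asum (Lambda n) (fun nu => nu ^+ k.-1 * I1 nu w)
              + k.-1%:R * asum (Lambda n) (fun nu => nu ^+ k * I2 nu w)]].
Proof.
split.
- move=> nu Lnu; split.
  + by move=> w j Hw jnu; have [] := interaction_sum Lnu Hw jnu.
  + exists (fun w => nu * form (ind nu) false false w w), (I1_rest nu); split.
    * exact: bounded_polynomial_quad (adm_ind n nu false false).
    * exact: I1_rest_bounded_polynomial.
    * by move=> w Hw; rewrite (I1E Lnu Hw) /I1_rest !addrA.
  + exact: I2_bounded_polynomial.
  + exact: I1_analytic.
  + exact: I2_analytic.
- move=> w Hw; have Hw2 : inH 2 w := inH_le (isT : (2 <= 3)%N) Hw.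
  split=> [a b nu la Lnu Lla|a nu j Lnu j0].
    exact: has_bracket_calI.
  exact: has_bracket_momentum.
- exact: Hamiltonian_sum.
- exact: blockJ_sum.
Qed.
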